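(* Let $f, g_1,\ldots,g_m:\mathbb{R}^n\to\mathbb{R}^n$, $\varphi_1,\ldots,\varphi_m:\mathbb{R}^n\to\mathbb{R}^p$, $A_1,\ldots,A_m:\mathbb{R}^n\to\mathbb{R}^q$ be smooth mappings with $f(0)=0$ and $\varphi_1(0)=\cdots=\varphi_m(0)=0$. Suppose that the following two assumptions hold. (A) There exist a constant $\sigma\in\mathbb{R}$ and smooth mappings $V,Q:\mathbb{R}^n\to\mathbb{R}_+$, $s_i:\mathbb{R}^n\to\mathbb{R}_+$, $\delta_i:\mathbb{R}^n\to\mathbb{R}$ ($i=1,\ldots,m$), with $V$ and $Q$ positive definite and radially unbounded, such that for all $y\in\mathbb{R}^n$ $$\nabla V(y) f(y)\le -Q(y)+\sigma\sum_{i=1}^m \delta_i(y)\nabla V(y)g_i(y)+\sum_{i=1}^m s_i(y)\left(\nabla V(y)g_i(y)\right)^2 .$$ (B) There exist a smooth mapping $\mu:\mathbb{R}^n\to(0,+\infty)$ and a constant $\Lambda\ge 0$ such that for all $y\in\mathbb{R}^n$ $$\sum_{i=1}^m|\varphi_i(y)|^2\le \mu(y)\left(Q(y)+\Lambda\right).$$ Let $\varepsilon,\Gamma,C,\kappa>0$ be given constants with $2C\kappa\ge 1$. For $(y,z)\in\mathbb{R}^n\times\mathbb{R}$ and $i=1,\ldots,m$ define $$P_i(y,z):=|\varphi_i(y)|^2+|A_i(y)|^2+(\kappa+\exp(z))^2\mu(y)+\delta_i^2(y),$$ $$\begin{aligned} r_i(y,z):={}& C(\kappa+\exp(z))s_i^2(y)\left(\nabla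 V(y)g_i(y)\right)^2+(\kappa+\exp(z))s_i(y)\\ &+C^3(\kappa+\exp(z))^3P_i^2(y,z)\left(\nabla V(y)g_i(y)\right)^2+C(\kappa+\exp(z))^2P_i(y,z),\end{aligned}$$ and for $s_1,s_2,s_4\ge 0$, $s_3>0$ define $$\chi(s_1,s_2,s_3,s_4):=\frac{m s_1^2+m\sigma^2+m\left((s_2-\kappa-s_4)^+\right)^2+2C\kappa\Lambda+2m s_3\left(\left(\frac{1}{s_3}-\kappa-s_4\right)^+\right)^2}{4C(\kappa+s_4)} .$$ Consider the closed-loop system with state $(y,z)\in\mathbb{R}^n\times\mathbb{R}$ and inputs $d(t)\in\mathbb{R}^q$, $\theta(t)\in\mathbb{R}^p$, $b(t)=(b_1(t),\ldots,b_m(t))\in(0,+\infty)^m$: $$\dot y=f(y)+\sum_{i=1}^m g_i(y)\left(b_iu_i+\varphi_i'(y)\theta+A_i'(y)d\right),$$ $$u_i=-r_i(y,z)\nabla V(y)g_i(y)\quad (i=1,\ldots,m),$$ $$\dot z=\Gamma\exp(-z)\left(V(y)-\varepsilon\right)^+ .$$ Then there exist functions $\omega\in KL$, $\zeta\in K_\infty$ and $R\in C^0(\mathbb{R}^{n+1}\times\mathbb{R}_+^2\times(0,+\infty))$ such that for every $(y_0,z_0)\in\mathbb{R}^n\times\mathbb{R}$, $d\in L^\infty(\mathbb{R}_+;\mathbb{R}^q)$, $\theta\in L^\infty(\mathbb{R}_+;\mathbb{R}^p)$, $b\in L^\infty(\mathbb{R}_+;(0,+\infty)^m)$ with $\inf_{t\ge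 0}(b_i(t))>0$ for $i=1,\ldots,m$, the unique solution $(y(t),z(t))$ of the closed-loop system with initial condition $(y(0),z(0))=(y_0,z_0)$ satisfies the following estimates for all $t\ge 0$: $$\limsup_{t\to+\infty}\left(V(y(t))\right)\le\varepsilon,$$ $$V(y(t))\le\omega\left(V(y_0),t\right)+\zeta\left(\chi\left(\|d\|_\infty,\|\theta\|_\infty,\min_{i=1,\ldots,m}\left(\inf_{s\ge 0}(b_i(s))\right),\exp(z_0)\right)\right),$$ $$z_0\le z(t)\le\lim_{s\to+\infty}(z(s))\le R\left(y_0,z_0,\|d\|_\infty,\|\theta\|_\infty,\min_{i=1,\ldots,m}\left(\inf_{s\ge 0}(b_i(s))\right)\right).$$
   Context: Notation and conventions. $n,m,p,q$ are positive integers. $\mathbb{R}_+=[0,+\infty)$. For a vector $x$, $|x|$ is its Euclidean norm and $x'$ its transpose; $\varphi_i'(y)$ and $A_i'(y)$ denote the transposes of the column vectors $\varphi_i(y)$ and $A_i(y)$ (not derivatives). For $x\in\mathbb{R}$, $x^+=\max(x,0)$. $\nabla V(y)=\left(\frac{\partial V}{\partial y_1}(y),\ldots,\frac{\partial V}{\partial y_n}(y)\right)$ is a row vector. Smooth means $C^\infty$. $C^0(S)$ is the set of continuous real-valued functions on $S$. A function $V:\mathbb{R}^n\to\mathbb{R}_+$ is positive definite if $V(0)=0$ and $V(x)>0$ for all $x\ne 0$; a continuous $V:\mathbb{R}^n\to\mathbb{R}_+$ is radially unbounded if for every $M>0$ the set $\{x\in\mathbb{R}^n: V(x)\le M\}$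 is compact. $K$ is the class of (strictly) increasing continuous functions $a:\mathbb{R}_+\to\mathbb{R}_+$ with $a(0)=0$. $K_\infty$ is the class of $a\in K$ with $\lim_{s\to+\infty}a(s)=+\infty$. $KL$ is the set of continuous functions $\omega:\mathbb{R}_+\times\mathbb{R}_+\to\mathbb{R}_+$ such that for each $t\ge 0$ the mapping $\omega(\cdot,t)$ is of class $K$, and for each $s\ge 0$ the mapping $\omega(s,\cdot)$ is non-increasing with $\lim_{t\to+\infty}\omega(s,t)=0$. $L^\infty(\mathbb{R}_+;D)$ is the class of essentially bounded, Lebesgue measurable functions $\mathbb{R}_+\to D$; $\|d\|_\infty$ is the essential supremum of $|d(t)|$ over $t\ge 0$. For the measurable functions $b_i$, $\inf_{t\ge 0}(b_i(t))$ is understood as the essential infimum. Solutions are understood in the Carathéodory sense (locally absolutely continuous functions satisfying the differential equations for almost every $t$); the assertion that the estimates hold for all $t\ge 0$ includes that the unique solution is defined for all $t\ge 0$. The functions $\omega,\zeta,R$ may depend on the system data ($f,g_i,\varphi_i,A_i$), on $\sigma,V,Q,s_i,\delta_i,\mu,\Lambda$ and on the constants $\varepsilon,\Gamma,C,\kappa$, but not on $y_0,z_0,d,\theta,b$. *)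

(* Defs.v *)
(* MathComp-Analysis: R is an abstract realType.  Functions whose mathematical
   domain is [0, +oo[ are total functions on R constrained only on [0, +oo[. *)
From mathcomp Require Import all_boot all_order all_algebra.
From mathcomp Require Import all_classical all_reals all_analysis.
From mathcomp Require Import measurable_realfun ess_sup_inf.

Set Implicit Arguments.
Unset Strict Implicit.
Unset Printing Implicit Defensive.
Import Order.TTheory GRing.Theory Num.Theory.
Import numFieldNormedType.Exports.

Local Open Scope classical_set_scope.
Local Open Scope ring_scope.

(* The library norm on matrices is the max norm, which induces the same
   topology but must not be used for quantitative Euclidean bounds. *)
Definition enorm {R : realType} {k : nat} (x : 'cV[R]_k) : R :=
  Num.sqrt (\sum_(i < k) x i ord0 ^+ 2).

Definition partial {R : realType} {n : nat} {W : normedModType R} (i : 'I_n)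
    (f : 'cV[R]_n -> W) : 'cV[R]_n -> W :=
  fun y => 'D_(delta_mx i ord0) f y.

(* C^oo: the partial derivatives of all orders, indexed by the lists s of
   differentiation directions, exist everywhere and are continuous. *)
Definition smooth {R : realType} {n : nat} {W : normedModType R}
    (f : 'cV[R]_n -> W) : Prop :=
  forall s : seq 'I_n,
    continuous (foldr partial f s) /\
    forall (i : 'I_n) (y : 'cV[R]_n),
      derivable (foldr partial f s) y (delta_mx i ord0).

Definition grad {R : realType} {n : nat} (V : 'cV[R]_n -> R)
    (y : 'cV[R]_n) : 'rV[R]_n :=
  \row_i partial i V y.

(* The scalar grad V (y) g(y). *)
Definition lie {R : realType} {n : nat} (V : 'cV[R]_n -> R)
    (g : 'cV[R]_n -> 'cV[R]_n) (y : 'cV[R]_n) : R :=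
  (grad V y *m g y) ord0 ord0.

Definition posdef {R : realType} {n : nat} (V : 'cV[R]_n -> R) : Prop :=
  V 0 = 0 /\ forall x, x != 0 -> 0 < V x.

Definition radially_unbounded {R : realType} {n : nat}
    (V : 'cV[R]_n -> R) : Prop :=
  forall M : R, 0 < M -> compact [set x | V x <= M].

Definition classK {R : realType} (a : R -> R) : Prop :=
  [/\ a 0 = 0,
      forall s, 0 <= s -> 0 <= a s,
      forall s t, 0 <= s -> s < t -> a s < a t
    & {within `[0, +oo[, continuous a}].

Definition classKoo {R : realType} (a : R -> R) : Prop :=
  classK a /\ a s @[s --> +oo] --> +oo.

Definition classKL {R : realType} (w : R -> R -> R) : Prop :=
  [/\ {within [set x : R * R | 0 <= x.1 /\ 0 <= x.2],
         continuous (fun x : R * R => w x.1 x.2)},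
      forall t, 0 <= t -> classK (fun s => w s t),
      forall s t1 t2, 0 <= s -> 0 <= t1 -> t1 <= t2 -> w s t2 <= w s t1
    & forall s, 0 <= s -> w s t @[t --> +oo] --> 0].

(* Measurability with respect to the completed (Lebesgue) sigma-algebra; the
   library's [measurable_fun] on R alone would mean Borel measurability. *)
Definition lebesgue_measurable_fun {R : realType} (D : set R)
    (x : R -> R) : Prop :=
  measurable_fun
    (D : set (g_sigma_algebraType (completed_algebra_gen (@lebesgue_measure R))))
    (x : g_sigma_algebraType (completed_algebra_gen (@lebesgue_measure R)) ->
         measurableTypeR R).

Definition half_line_measurable {R : realType} :
  measurable (`[0, +oo[%classic : set (measurableTypeR R)) :=
  measurable_itv `[0, +oo[.

(* Lebesgue measure restricted to [0, +oo[, so that values at negative times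
   are irrelevant to essential suprema and infima. *)
Definition half_line_measure {R : realType} :
  {measure set (measurableTypeR R) -> \bar R} :=
  mrestr (@lebesgue_measure R) half_line_measurable.

Definition ess_sup_norm {R : realType} {k : nat} (x : R -> 'cV[R]_k) : \bar R :=
  ess_sup half_line_measure (fun t => (enorm (x t))%:E).

Definition Linfty {R : realType} {k : nat} (D : set 'cV[R]_k)
    (x : R -> 'cV[R]_k) : Prop :=
  [/\ forall t, 0 <= t -> D (x t),
      forall i, lebesgue_measurable_fun `[0, +oo[ (fun t => x t i ord0)
    & (ess_sup_norm x < +oo)%E].

Definition norm_infty {R : realType} {k : nat} (x : R -> 'cV[R]_k) : R :=
  fine (ess_sup_norm x).

Definition ess_inf_coord {R : realType} {m : nat} (b : R -> 'cV[R]_m)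
    (i : 'I_m) : \bar R :=
  ess_inf half_line_measure (fun t => (b t i ord0)%:E).

Definition min_ess_inf {R : realType} {m : nat} (b : R -> 'cV[R]_m) : R :=
  fine (\big[mine/+oo%E]_(i < m) ess_inf_coord b i).

Definition abs_continuous {R : realType} {W : normedModType R} (a c : R)
    (x : R -> W) : Prop :=
  forall e : R, 0 < e -> exists2 d : R, 0 < d &
    forall (N : nat) (u v : 'I_N -> R),
      (forall i, [/\ a <= u i, u i <= v i & v i <= c]) ->
      trivIset setT (fun i => `]u i, v i[%classic) ->
      \sum_(i < N) (v i - u i) < d ->
      \sum_(i < N) `|x (v i) - x (u i)| < e.

(* Caratheodory solution of x' = F(t, x) on [0, T[, with T possibly +oo. *)
Definition caratheodory {R : realType} {W : normedModType R} (T : \bar R)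
    (x : R -> W) (xdot : R -> W) : Prop :=
  (forall c : R, 0 <= c -> (c%:E < T)%E -> abs_continuous 0 c x) /\
  {ae (@lebesgue_measure R), forall t : R,
    0 <= t -> (t%:E < T)%E -> is_derive t (1 : R) x (xdot t)}.

Definition gainP {R : realType} {n p q : nat} (kappa : R)
    (phi : 'cV[R]_n -> 'cV[R]_p) (A : 'cV[R]_n -> 'cV[R]_q)
    (mu delta : 'cV[R]_n -> R) (y : 'cV[R]_n) (z : R) : R :=
  enorm (phi y) ^+ 2 + enorm (A y) ^+ 2 + (kappa + expR z) ^+ 2 * mu y
  + delta y ^+ 2.

Definition gainr {R : realType} {n p q : nat} (C kappa : R)
    (V : 'cV[R]_n -> R) (g : 'cV[R]_n -> 'cV[R]_n)
    (phi : 'cV[R]_n -> 'cV[R]_p) (A : 'cV[R]_n -> 'cV[R]_q)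
    (mu delta s : 'cV[R]_n -> R) (y : 'cV[R]_n) (z : R) : R :=
  let P := gainP kappa phi A mu delta y z in
  C * (kappa + expR z) * s y ^+ 2 * lie V g y ^+ 2
  + (kappa + expR z) * s y
  + C ^+ 3 * (kappa + expR z) ^+ 3 * P ^+ 2 * lie V g y ^+ 2
  + C * (kappa + expR z) ^+ 2 * P.

Definition feedback {R : realType} {n p q : nat} (C kappa : R)
    (V : 'cV[R]_n -> R) (g : 'cV[R]_n -> 'cV[R]_n)
    (phi : 'cV[R]_n -> 'cV[R]_p) (A : 'cV[R]_n -> 'cV[R]_q)
    (mu delta s : 'cV[R]_n -> R) (y : 'cV[R]_n) (z : R) : R :=
  - gainr C kappa V g phi A mu delta s y z * lie V g y.

Definition pos_part {R : realType} (x : R) : R := Num.max x 0.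

Definition chi {R : realType} (m : nat) (sigma C kappa Lambda : R)
    (s1 s2 s3 s4 : R) : R :=
  (m%:R * s1 ^+ 2 + m%:R * sigma ^+ 2
   + m%:R * pos_part (s2 - kappa - s4) ^+ 2
   + 2 * C * kappa * Lambda
   + 2 * m%:R * s3 * pos_part (s3^-1 - kappa - s4) ^+ 2)
  / (4 * C * (kappa + s4)).

Definition ydot {R : realType} {n m p q : nat}
    (f : 'cV[R]_n -> 'cV[R]_n) (g : 'I_m -> 'cV[R]_n -> 'cV[R]_n)
    (phi : 'I_m -> 'cV[R]_n -> 'cV[R]_p) (A : 'I_m -> 'cV[R]_n -> 'cV[R]_q)
    (u : 'I_m -> R) (b : 'cV[R]_m) (theta : 'cV[R]_p) (d : 'cV[R]_q)
    (y : 'cV[R]_n) : 'cV[R]_n :=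
  f y + \sum_(i < m)
    (b i ord0 * u i + ((phi i y)^T *m theta) ord0 ord0
     + ((A i y)^T *m d) ord0 ord0) *: g i y.

Definition zdot {R : realType} {n : nat} (Gamma eps : R) (V : 'cV[R]_n -> R)
    (y : 'cV[R]_n) (z : R) : R :=
  Gamma * expR (- z) * pos_part (V y - eps).

Definition closed_loop_solution {R : realType} {n m p q : nat}
    (f : 'cV[R]_n -> 'cV[R]_n) (g : 'I_m -> 'cV[R]_n -> 'cV[R]_n)
    (phi : 'I_m -> 'cV[R]_n -> 'cV[R]_p) (A : 'I_m -> 'cV[R]_n -> 'cV[R]_q)
    (V mu : 'cV[R]_n -> R) (s delta : 'I_m -> 'cV[R]_n -> R)
    (eps Gamma C kappa : R)
    (d : R -> 'cV[R]_q) (theta : R -> 'cV[R]_p) (b : R -> 'cV[R]_m)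
    (y0 : 'cV[R]_n) (z0 : R) (T : \bar R)
    (y : R -> 'cV[R]_n) (z : R -> R) : Prop :=
  [/\ y 0 = y0, z 0 = z0,
      caratheodory T y (fun t =>
        ydot f g phi A
          (fun i => feedback C kappa V (g i) (phi i) (A i) mu (delta i) (s i)
                      (y t) (z t))
          (b t) (theta t) (d t) (y t))
    & caratheodory T z (fun t => zdot Gamma eps V (y t) (z t))].

(* Main.v *)
(* Write w = kappa + exp z.  Completing squares with weight C w in each control
   channel gives, along solutions,
     d/dt V(y) <= - Q(y) / 2 + chi(|d|, |theta|, min b, exp z),
   and chi is nonincreasing in its last argument while z is nondecreasing.  With
   rho of class K_oo and rho(V) <= Q / 2 this yields the estimate of V: as long
   as V(y(t)) > zeta(chi) the function V decreases at rate at least rho(V) / 2.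
   Moreover chi = O(1 / exp z), so once exp z passes a threshold depending only
   on the data, V decreases at rate rho(eps) / 2 wherever V > eps and
     exp z + Gamma / rho(eps) * ((V - eps)^+)^2
   is nonincreasing; this bounds z.  As exp z increases at rate
   Gamma (V - eps)^+ and V grows at a bounded rate, limsup V <= eps.
   These bounds hold on every interval of existence, hence a solution of the
   system truncated outside a large ball, obtained by Picard iteration, solves
   the system itself.  All differential inequalities only hold almost everywhere
   and are integrated by a Cousin covering argument. *)
Require Import Defs.
From mathcomp Require Import all_boot all_order all_algebra.
From mathcomp Require Import all_classical all_reals all_analysis.
From mathcomp Require Import measurable_realfun ess_sup_inf.
From mathcomp Require Import ring lra.

Set Implicit Arguments.
Unset Strict Implicit.
Unset Printing Implicit Defensive.
Import Order.TTheory GRing.Theory Num.Theory.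
Import numFieldNormedType.Exports.

Local Open Scope classical_set_scope.
Local Open Scope ring_scope.

(** * Absolutely continuous functions *)

(** The control gains [b i] are known to the analysis only through a lower bound beta, so nothing
    can be cancelled exactly. The feedback is built from terms a S^2 + w S, since beta times such a
    term dominates S up to beta ((1/beta - w)^+)^2 / (4 a). Taking S = s L^2 and S = a P L^2, with L
    the Lie derivative in the channel and a = C w, produces the four summands of [gainr] and the
    factor 2 in [chi]. The parameter theta is compared with w in the same spirit: the excess
    (|theta| - w)^+ goes into [chi], the rest is paid by the summand w^2 mu of [gainP]. This leaves
    a fraction 1 / (4 C w) of Q + Lambda, whose Q part 2 C kappa >= 1 keeps below Q / 2; hence the
    halved dissipation. The size of [b] must not enter the estimates: it serves only for Lipschitz
    constants of the vector field, that is for existence and uniqueness. Finally, exp z is a better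
    variable than z because its derivative cancels the factor exp(-z) of the adaptation law. *)

Lemma ae_imply {R : realType} (P Q : R -> Prop) : (forall t, P t -> Q t) ->
  {ae (@lebesgue_measure R), forall t, P t} ->
  {ae (@lebesgue_measure R), forall t, Q t}.
Proof.
move=> PQ; apply: filterS => //.
exact: (ae_filter_ringOfSetsType lebesgue_measure).
Qed.

Lemma ae_imply2 {R : realType} (P1 P2 Q : R -> Prop) :
  (forall t, P1 t -> P2 t -> Q t) ->
  {ae (@lebesgue_measure R), forall t, P1 t} ->
  {ae (@lebesgue_measure R), forall t, P2 t} ->
  {ae (@lebesgue_measure R), forall t, Q t}.
Proof.
move=> PQ; apply: filterS2 => //.
exact: (ae_filter_ringOfSetsType lebesgue_measure).
Qed.

(** The gauge at the supremum of the points already reached carries [S] from slightly below it to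
    beyond it, so [b] is reached. The value of [S] at the supremum itself never intervenes, which
    makes the principle usable for properties that are not closed. *)
Lemma straddle_induction {R : realType} (a b : R) (S : R -> Prop) : a <= b ->
  S a ->
  (forall t, a <= t -> t <= b -> exists2 g, 0 < g & forall u v,
    a <= u -> u <= t -> t <= v -> v <= b -> v - u < g -> S u -> S v) ->
  S b.
Proof.
move=> ab Sa gauge.
pose E := [set c | [/\ a <= c, c <= b & S c]].
have Ea : E a by split.
have supE : has_sup E by split; [exists a | exists b => c []].
have [a_s sb] : a <= sup E /\ sup E <= b.
  by split; [exact: sup_upper_bound | apply: ge_sup => [|c []]//; exists a].
have [g g0 gP] := gauge _ a_s sb.
have [c' [ac' c'b Sc'] c's] := sup_adherent (divr_gt0 g0 (ltr0n _ 2)) supE.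
have c's' : c' <= sup E by apply: sup_upper_bound.
have [bs|bs] := leP b (sup E + g / 3).
  by apply: (gP c') => //; lra.
have : E (sup E + g / 3).
  by split; [lra | exact: ltW | apply: (gP c') => //; lra].
by move/(sup_upper_bound supE); lra.
Qed.

(* A Cousin-type argument: [a, b] is cut into tagged pieces which are either
   controlled by the local estimate at their tag or contained in a thin open
   set covering the exceptional times, where absolute continuity applies. *)
Lemma ae_local_le0 {R : realType} (a b : R) (D : R -> R -> R) : a <= b ->
  (forall u v w, a <= u -> u <= v -> v <= w -> w <= b ->
    D u w <= D u v + D v w) ->
  (forall e : R, 0 < e -> exists2 d : R, 0 < d &
    forall (N : nat) (u v : 'I_N -> R),
      (forall i, [/\ a <= u i, u i <= v i & v i <= b]) ->
      trivIset setT (fun i => `]u i, v i[%classic) ->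
      \sum_(i < N) (v i - u i) < d -> \sum_(i < N) D (u i) (v i) < e) ->
  {ae (@lebesgue_measure R), forall t : R, a < t -> t < b ->
    forall e : R, 0 < e -> exists2 d : R, 0 < d &
      forall u v, a <= u -> u <= t -> t <= v -> v <= b -> v - u < d ->
        D u v <= e * (v - u)} ->
  D a b <= 0.
Proof.
move=> ab Dsub Dac [A [mA muA0 subA]].
apply/ler_addgt0Pr => e e_gt0; rewrite add0r.
(* Half of the budget [e] goes to the well-behaved pieces, half to the thin cover; the [+ 1] keeps
   the denominator positive when [a = b]. *)
pose e1 := e / 2 / (b - a + 1).
have ba1 : 0 < b - a + 1 by lra.
have e1_gt0 : 0 < e1 by rewrite !divr_gt0.
have [d d_gt0 dP] := Dac (e / 2) (divr_gt0 e_gt0 (ltr0n _ 2)).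
(* The endpoints join the exceptional set, as the local estimate is available for [a < t < b]
   only. *)
pose A' := A `|` [set a; b].
have mab : measurable [set a; b] by apply: measurableU.
have mA' : measurable A' by exact: measurableU.
have muA'0 : lebesgue_measure A' = 0%E.
  apply/eqP; rewrite -measure_le0 (le_trans (measureU2 _ _ _))//.
  have ab0 : lebesgue_measure [set a; b] = 0%E.
    exact/countable_lebesgue_measure0/finite_set_countable.
  by rewrite [X in (X + _)%E]muA0 add0e [leLHS]ab0.
have [|U [oU A'U muU]] := lebesgue_regularity_outer mA' _ d_gt0.
  by rewrite [X in (X < _)%E]muA'0.
have mU : measurable U by exact: open_measurable.
have muUd : (lebesgue_measure U < d%:E)%E.
  rewrite (le_lt_trans _ muU)// -[leRHS]adde0 -muA'0.
  rewrite (le_trans _ (measureU2 _ _ _))//; last exact: measurableD.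
  by rewrite le_measure ?inE//; [exact: measurableU (measurableD mU mA') mA'|
     move=> x Ux; have [?|?] := pselect (A' x); [right|left]].
(* Invariant: up to [c], [D] is controlled by the slope [e1] plus a finite ordered list of intervals
   inside [U], left for absolute continuity to handle all at once. *)
pose S c := exists (N : nat) (u v : nat -> R),
  [/\ forall i, (i < N)%N -> [/\ a <= u i, u i <= v i, v i <= c &
         `]u i, v i[%classic `<=` U],
      forall i j, (i < j)%N -> (j < N)%N -> v i <= u j &
      D a c <= e1 * (c - a) + \sum_(i < N) D (u i) (v i)].
have Sa : S a.
  (* The list starts with the degenerate interval at [a], because subadditivity gives no upper bound
     on [D a a]. *)
  exists 1, (cst a), (cst a); split => //.
  - by move=> i _; split => // x /=; rewrite in_itv/=; lra.
  - by rewrite big_ord1/= subrr mulr0 add0r.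
have gauge t : a <= t -> t <= b -> exists2 g, 0 < g & forall u v,
    a <= u -> u <= t -> t <= v -> v <= b -> v - u < g ->
    `]u, v[%classic `<=` U \/ D u v <= e1 * (v - u).
  move=> at_ tb; have [/A'U At|At] := pselect (A' t).
    have [g /= g0 gU] := (nbhs_ballP t U).1 (open_nbhs_nbhs (conj oU At)).
    exists g => // u v _ ut tv _ vug; left => x /=; rewrite in_itv/= => xuv.
    by apply: gU; rewrite /ball/= ltr_norml; lra.
  have {}At' : ~ A t by move=> ?; apply: At; left.
  have nta : t <> a by move=> ?; apply: At; right; left.
  have ntb : t <> b by move=> ?; apply: At; right; right.
  have /contrapT good := contra_not (subA t) At'.
  have [||g g0 gP] := good _ _ e1 e1_gt0.
  - by rewrite lt_neqAle at_ andbT; apply/eqP => /esym.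
  - by rewrite lt_neqAle tb andbT; apply/eqP.
  by exists g => // u v *; right; exact: gP.
have ext t c' c : S c' -> a <= c' -> c' <= t -> t <= c -> c <= b ->
    (`]c', c[%classic `<=` U \/ D c' c <= e1 * (c - c')) -> S c.
  move=> [N [u [v [uvP uvd DS]]]] ac' c't tc cb.
  have Dac' : D a c <= D a c' + D c' c by apply: Dsub => //; lra.
  case=> [cU|cD]; last first.
    exists N, u, v; split => //; last by lra.
    by move=> i /uvP[? ? ? ?]; split => //; lra.
  exists N.+1, (fun i => if (i < N)%N then u i else c'),
    (fun i => if (i < N)%N then v i else c); split.
  - move=> i _; case: ifPn => [/uvP[? ? ? ?]|_]; split => //; lra.
  - move=> i j ij; rewrite ltnS leq_eqVlt => /predU1P[jN|jN].
      by rewrite jN in ij *; rewrite ij ltnn; have [] := uvP i ij.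
    by rewrite jN (ltn_trans ij jN); exact: uvd.
  - rewrite big_ord_recr/= ltnn.
    have -> : \sum_(i < N) D (if (i < N)%N then u i else c')
        (if (i < N)%N then v i else c) = \sum_(i < N) D (u i) (v i).
      by apply: eq_bigr => i _; rewrite ltn_ord.
    have : e1 * (c' - a) <= e1 * (c - a) by rewrite (ler_wpM2l (ltW e1_gt0))//;
      lra.
    lra.
have Sb : S b.
  apply: (straddle_induction ab Sa) => t at_ tb.
  have [g g0 gP] := gauge t at_ tb; exists g => // u v au ut tv vb vug Su.
  by apply: (ext t u) => //; exact: gP.
have [N [u [v [uvP uvd DS]]]] := Sb.
have triv : trivIset `I_N (fun i => `]u i, v i[%classic).
  move=> i j /= iN jN [x []] /=; rewrite !in_itv/= => xi xj.
  have [ij|ij|//] := ltngtP i j; exfalso.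
    by have := uvd _ _ ij jN; lra.
  by have := uvd _ _ ij iN; lra.
(* The ordering makes the intervals disjoint and they all lie in [U], so their total length is below
   [d]. *)
have sumE : (\sum_(i < N) (v i - u i))%:E =
    lebesgue_measure (\big[setU/set0]_(i < N) `]u i, v i[%classic : set R).
  rewrite (@measure_semi_additive_ord_I _ _ _ lebesgue_measure
    (fun i => `]u i, v i[%classic))//; last exact: bigsetU_measurable.
  rewrite -sumEFin; apply: eq_bigr => i _.
  rewrite [RHS](lebesgue_measure_itv `]u i, v i[)/= lte_fin;
    case: ltP => [//|vu].
  by have [_ uv _ _] := uvP i (ltn_ord i); congr EFin; lra.
have sumd : \sum_(i < N) (v i - u i) < d.
  rewrite -lte_fin sumE (le_lt_trans _ muUd)// le_measure ?inE//.
    exact: bigsetU_measurable.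
  rewrite -(bigcup_mkord N (fun i => `]u i, v i[%classic)) => x [i /= iN].
  by have [_ _ _] := uvP i iN; apply.
have sumD : \sum_(i < N) D (u i) (v i) < e / 2.
  apply: (dP N (u \o val) (v \o val)) => // [i|].
    by have [] := uvP i (ltn_ord i).
  by move=> i j _ _ /(triv i j (ltn_ord i) (ltn_ord j))/val_inj.
have : e1 * (b - a) <= e / 2.
  rewrite /e1 -mulrA ger_pMr ?divr_gt0// mulrC ler_pdivrMr//; lra.
lra.
Qed.

(** Derivative without difference quotient: [s = t] needs no exclusion, and two such estimates can
    be subtracted, as intervals straddling a tag require. *)
Definition has_deriv {R : realType} {W : normedModType R} (x : R -> W) (t : R)
    (v : W) : Prop :=
  forall e : R, 0 < e -> exists2 d : R, 0 < d &
    forall s, `|s - t| < d -> `|x s - x t - (s - t) *: v| <= e * `|s - t|.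

Lemma is_deriveP {R : realType} {W : normedModType R} (x : R -> W) (t : R)
    (v : W) : is_derive t 1 x v <-> has_deriv x t v.
Proof.
split=> [[dx <-] e e0|xv].
  have /cvgrPdist_le /(_ _ e0) /nbhs_ballP[d /= d0 dP] := dx.
  exists d => // s std; have [->|st] := eqVneq s t.
    by rewrite !subrr scale0r subr0 !normr0 mulr0.
  have st0 : s - t != 0 by rewrite subr_eq0.
  have := dP (s - t); rewrite /ball/= sub0r normrN => /(_ std st0).
  rewrite [in X in X -> _](_ : (s - t) *: 1 = s - t)//; last exact: mulr1.
  rewrite subrK => {}dP.
  have -> : x s - x t - (s - t) *: 'D_1 x t =
      - ((s - t) *: ('D_1 x t - (s - t)^-1 *: (x s - x t))).
    by rewrite scalerBr scalerA divff// scale1r opprB.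
  by rewrite normrN normrZ mulrC ler_wpM2r.
have xc : (fun h : R => h^-1 *: ((x \o shift t) (h *: 1) - x t)) @ 0^' --> v.
  apply/cvgrPdist_le => e e0; have [d d0 dP] := xv e e0.
  apply/nbhs_ballP; exists d => //= h; rewrite /ball/= sub0r normrN => hd h0.
  rewrite [in X in x X](_ : h *: 1 = h)//; last exact: mulr1.
  have -> : v - h^-1 *: (x (h + t) - x t) =
      - (h^-1 *: (x (h + t) - x t - h *: v)).
    by rewrite [in RHS]scalerBr scalerA mulVf// scale1r opprB.
  rewrite normrN normrZ normfV mulrC ler_pdivrMr ?normr_gt0//.
  by have := dP (h + t); rewrite addrK; apply.
apply: DeriveDef; first by apply/cvg_ex; exists v.
exact: (cvg_lim _ xc).
Qed.

(** Subtracting the estimates at the two ends loses nothing because [t] lies between them: the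
    distances to [t] add up to [b - a]. *)
Lemma has_deriv_straddle {R : realType} {W : normedModType R} (x : R -> W)
    (t : R) (v : W) : has_deriv x t v ->
  forall e, 0 < e -> exists2 d, 0 < d & forall a b, a <= t -> t <= b ->
    b - a < d -> `|x b - x a - (b - a) *: v| <= e * (b - a).
Proof.
move=> xv e e0; have [d d0 dP] := xv e e0; exists d => // a b at_ tb abd.
have -> : x b - x a - (b - a) *: v =
    (x b - x t - (b - t) *: v) - (x a - x t - (a - t) *: v).
  have -> : b - a = (b - t) - (a - t) by lra.
  rewrite (scalerBl (b - t)) !opprB.
  rewrite [RHS](_ : _ = x b - x a - ((b - t) *: v - (a - t) *: v) + (x t - x
    t)).
    by rewrite subrr addr0 opprB.
  by rewrite !opprB !addrA (ACl (1*6*4*3*5*2)).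
rewrite (le_trans (ler_normB _ _))//.
have bt : `|b - t| < d by rewrite ltr_norml; lra.
have at' : `|a - t| < d by rewrite ltr_norml; lra.
have := lerD (dP _ bt) (dP _ at').
rewrite -mulrDr (ger0_norm (_ : 0 <= b - t)) ?subr_ge0//.
rewrite (ler0_norm (_ : a - t <= 0)) ?subr_le0//.
by have -> : b - t + - (a - t) = b - a by lra.
Qed.

Lemma ac_dominated {R : realType} {W1 W2 W : normedModType R} (a b K : R)
    (x1 : R -> W1) (x2 : R -> W2) (x : R -> W) : 0 <= K ->
  abs_continuous a b x1 -> abs_continuous a b x2 ->
  (forall s t, a <= s <= b -> a <= t <= b ->
    `|x t - x s| <= K * (`|x1 t - x1 s| + `|x2 t - x2 s|)) ->
  abs_continuous a b x.
Proof.
move=> K0 ac1 ac2 xle e e0.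
have K1 : 0 < 2 * (K + 1) by lra.
have e1 : 0 < e / (2 * (K + 1)) by rewrite divr_gt0.
have [d1 d10 d1P] := ac1 _ e1; have [d2 d20 d2P] := ac2 _ e1.
exists (Num.min d1 d2); first by rewrite lt_min d10.
move=> N u v uv triv; rewrite lt_min => /andP[uvd1 uvd2].
have le1 := d1P N u v uv triv uvd1; have le2 := d2P N u v uv triv uvd2.
apply: (@le_lt_trans _ _ (K * (\sum_(i < N) `|x1 (v i) - x1 (u i)| +
    \sum_(i < N) `|x2 (v i) - x2 (u i)|))).
  rewrite -big_split/= mulr_sumr; apply: ler_sum => i _.
  by have [? ? ?] := uv i; apply: xle; lra.
set S1 := \sum_(i < N) _ in le1 *; set S2 := \sum_(i < N) _ in le2 *.
have S10 : 0 <= S1 by apply: sumr_ge0.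
have S20 : 0 <= S2 by apply: sumr_ge0.
apply: (@le_lt_trans _ _ ((K + 1) * (S1 + S2))).
  by rewrite ler_wpM2r ?addr_ge0//; lra.
have -> : e = (K + 1) * (e / (2 * (K + 1)) + e / (2 * (K + 1))).
  by field; rewrite gt_eqF//; lra.
by rewrite ltr_pM2l ?ltrD//; lra.
Qed.

Lemma ac_id {R : realType} (a b : R) : abs_continuous a b (@id R).
Proof.
move=> e e0; exists e => // N u v uv _.
rewrite (_ : \sum_(i < N) `|_| = \sum_(i < N) (v i - u i))//.
by apply: eq_bigr => i _; rewrite ger0_norm// subr_ge0; have [] := uv i.
Qed.

Lemma ac_lipschitz {R : realType} {W : normedModType R} (a b K : R)
    (x : R -> W) : 0 <= K ->
  (forall s t, a <= s <= b -> a <= t <= b -> `|x t - x s| <= K * `|t - s|) ->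
  abs_continuous a b x.
Proof.
move=> K0 xK; apply: (ac_dominated K0 (ac_id a b) (ac_id a b)) => s t sab tab.
by rewrite (le_trans (xK _ _ sab tab))// ler_wpM2l// lerDl.
Qed.

Lemma ac_lipschitz_comp {R : realType} {W1 W : normedModType R} (a b K : R)
    (x1 : R -> W1) (x : R -> W) : 0 <= K -> abs_continuous a b x1 ->
  (forall s t, a <= s <= b -> a <= t <= b ->
    `|x t - x s| <= K * `|x1 t - x1 s|) ->
  abs_continuous a b x.
Proof.
move=> K0 ac1 xK; apply: (ac_dominated K0 ac1 (ac_id a b)) => s t sab tab.
by rewrite (le_trans (xK _ _ sab tab))// ler_wpM2l// lerDl.
Qed.

Lemma ac_subitv {R : realType} {W : normedModType R} (a b a' b' : R)
    (x : R -> W) : a <= a' -> b' <= b ->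
  abs_continuous a b x -> abs_continuous a' b' x.
Proof.
move=> aa bb ac e e0; have [d d0 dP] := ac e e0; exists d => // N u v uv.
by apply: dP => i; have [? ? ?] := uv i; split => //; lra.
Qed.

Lemma ac_le {R : realType} {W : normedModType R} (a b : R) (x : R -> W) :
  abs_continuous a b x -> forall e, 0 < e -> exists2 d, 0 < d &
    forall s t, a <= s <= b -> a <= t <= b -> `|t - s| < d -> `|x t - x s| < e.
Proof.
move=> ac e e0; have [d d0 dP] := ac e e0; exists d => //.
have le s t : a <= s -> s <= t -> t <= b -> t - s < d -> `|x t - x s| < e.
  move=> as_ st tb std; have := dP 1 (cst s) (cst t).
  rewrite !big_ord1/=; apply => //.
  by move=> i j _ _ _; rewrite (ord1 i) (ord1 j).
move=> s t /andP[? ?] /andP[? ?] std; have [st|/ltW ts] := leP s t.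
  by apply: le => //; apply: le_lt_trans std; exact: ler_norm.
rewrite distrC; apply: le => //; apply: le_lt_trans std.
by rewrite distrC; exact: ler_norm.
Qed.

Lemma continuous_distP {R : realType} {W1 W2 : normedModType R} (x : W1 -> W2) :
  (forall s e, 0 < e -> exists2 d, 0 < d &
    forall t, `|t - s| < d -> `|x t - x s| < e) <-> continuous x.
Proof.
split=> [H s|cx s e e0].
  apply/cvgrPdist_lt => e e0; have [d d0 dP] := H s e e0.
  apply/nbhs_ballP; exists d => //= t; rewrite -ball_normE/= => st.
  by rewrite distrC; apply: dP; rewrite distrC.
have /cvgrPdist_lt /(_ _ e0) /nbhs_ballP[d /= d0 dP] := cx s.
exists d => // t ts; rewrite distrC; apply: dP.
by rewrite -ball_normE/= distrC.
Qed.

Lemma within_continuousP {R : realType} {W1 W2 : normedModType R} (A : set W1)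
    (x : W1 -> W2) : (forall s, A s -> forall e, 0 < e -> exists2 d, 0 < d &
    forall t, A t -> `|t - s| < d -> `|x t - x s| < e) ->
  {within A, continuous x}.
Proof.
move=> H; apply/subspace_continuousP => s As; apply/cvgrPdist_lt => e e0.
have [d d0 dP] := H s As e e0.
apply/nbhs_ballP; exists d => //= t; rewrite -ball_normE/= => st At.
by rewrite distrC; apply: dP => //; rewrite distrC.
Qed.

Lemma ac_continuous {R : realType} {W : normedModType R} (a b : R)
    (x : R -> W) : abs_continuous a b x -> {within `[a, b], continuous x}.
Proof.
move=> /ac_le ac; apply: (within_continuousP (W1 := R^o)) => s /= sab e e0.
have [d d0 dP] := ac e e0; exists d => // t /= tab; apply: dP.
  by rewrite in_itv/= in sab.
by rewrite in_itv/= in tab.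
Qed.

Lemma ac_bounded {R : realType} {W : normedModType R} (a b : R) (x : R -> W) :
  abs_continuous a b x ->
  exists M, forall t, a <= t -> t <= b -> `|x t| <= M.
Proof.
move=> /ac_continuous xc.
have /compact_bounded[M [_ MP]] :=
  continuous_compact xc (@segment_compact _ a b).
exists (M + 1) => t at_ tb; apply: (MP (M + 1)); first by rewrite ltrDl.
by exists t => //=; rewrite in_itv/= at_.
Qed.

(** Stands in for the norm inequality of integrals: [phi] plays the role of a primitive of the bound
    on the derivative, and no integral is formed. *)
Lemma ac_norm_le {R : realType} {W : normedModType R} (a b : R) (x : R -> W)
    (phi : R -> R) : a <= b -> abs_continuous a b x ->
  (forall s t, a <= s -> s <= t -> t <= b -> phi s <= phi t) ->
  {ae (@lebesgue_measure R), forall t : R, a < t -> t < b ->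
    exists v w, [/\ has_deriv x t v, has_deriv phi t w & `|v| <= w]} ->
  `|x b - x a| <= phi b - phi a.
Proof.
move=> ab ac phile xphi; rewrite -subr_le0.
apply: (@ae_local_le0 _ a b (fun u v => `|x v - x u| - (phi v - phi u))) => //.
- move=> u v w *; have := ler_distD (x v) (x w) (x u); lra.
(* The increments of [phi] are nonnegative and may be dropped, so the modulus of [x] serves for
   [D]. *)
- move=> e e0; have [d d0 dP] := ac e e0; exists d => // N u v uv triv uvd.
  apply: le_lt_trans (dP N u v uv triv uvd); apply: ler_sum => i _.
  by have [? ? ?] := uv i; rewrite gerBl subr_ge0 phile.
- apply: ae_imply xphi => t H at_ tb e e0.
  have [v [w [xv phiw vw]]] := H at_ tb.
  have e2 : 0 < e / 2 by lra.
  have [d1 d10 d1P] := has_deriv_straddle xv e2.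
  have [d2 d20 d2P] := has_deriv_straddle phiw e2.
  exists (Num.min d1 d2); first by rewrite lt_min d10.
  move=> u u' _ ut tu' _; rewrite lt_min => /andP[/(d1P _ _ ut tu') A1].
  move=> /(d2P _ _ ut tu'); rewrite ler_norml /GRing.scale/= => /andP[A2 _].
  have uu' : 0 <= u' - u by lra.
  have := ler_normD (x u' - x u - (u' - u) *: v) ((u' - u) *: v).
  rewrite subrK normrZ ger0_norm// => A3.
  have : (u' - u) * `|v| <= (u' - u) * w by rewrite ler_wpM2l.
  lra.
Qed.

Lemma ac_le_slope {R : realType} (a b c : R) (x : R -> R) :
  a <= b -> abs_continuous a b x ->
  {ae (@lebesgue_measure R), forall t : R, a < t -> t < b ->
    exists2 v, has_deriv x t v & v <= c} ->
  x b - x a <= c * (b - a).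
Proof.
move=> ab ac xc; rewrite -subr_le0.
apply: (@ae_local_le0 _ a b (fun u v => x v - x u - c * (v - u))) => //.
- by move=> u v w *; lra.
- move=> e e0.
  have [|d1 d10 d1P] := ac (e / 2); first by lra.
  have c1 : 0 < e / 2 / (`|c| + 1) by rewrite !divr_gt0// ltr_wpDl.
  exists (Num.min d1 (e / 2 / (`|c| + 1))); first by rewrite lt_min d10.
  move=> N u v uv triv; rewrite lt_min => /andP[uvd1 uvd2].
  have le1 := d1P N u v uv triv uvd1.
  set S := \sum_(i < N) (v i - u i) in uvd2.
  have S0 : 0 <= S by apply: sumr_ge0 => i _; rewrite subr_ge0; have [] := uv i.
  have : \sum_(i < N) (x (v i) - x (u i) - c * (v i - u i)) <=
      \sum_(i < N) `|x (v i) - x (u i)| + `|c| * S.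
    rewrite mulr_sumr -big_split/=; apply: ler_sum => i _.
    apply: lerD; first exact: ler_norm.
    have [_ uvi _] := uv i.
    by rewrite -mulNr ler_wpM2r ?subr_ge0// -normrN ler_norm.
  have : `|c| * S <= (`|c| + 1) * S by rewrite ler_wpM2r// lerDl.
  have : (`|c| + 1) * S < e / 2 by rewrite mulrC -ltr_pdivlMr// ltr_wpDl.
  lra.
- apply: ae_imply xc => t H at_ tb e e0.
  have [v xv vc] := H at_ tb.
  have [d d0 dP] := has_deriv_straddle xv e0.
  exists d => // u u' _ ut tu' _ /(dP _ _ ut tu').
  rewrite ler_norml /GRing.scale/= => /andP[_ A2].
  have : (u' - u) * v <= (u' - u) * c by rewrite ler_wpM2l//; lra.
  lra.
Qed.

(** * Locally Lipschitz and smooth functions *)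

(** On column vectors this is local Lipschitz continuity, in a uniform form that is stable under
    products and composition, transports absolute continuity and provides the constants of the
    truncated system. *)
Definition lip_on_balls {R : realType} {W1 W2 : normedModType R}
    (F : W1 -> W2) : Prop :=
  forall M : R, exists2 K, 0 <= K &
    forall x y, `|x| <= M -> `|y| <= M -> `|F x - F y| <= K * `|x - y|.

Lemma lip_on_balls_bounded {R : realType} {W1 W2 : normedModType R}
    (F : W1 -> W2) : lip_on_balls F ->
  forall M, exists2 B, 0 <= B & forall x, `|x| <= M -> `|F x| <= B.
Proof.
(* The absolute value puts the origin in the ball even for negative [M]. *)
move=> lF M; have [K K0 KP] := lF `|M|.
exists (`|F 0| + K * `|M|) => [|x xM]; first by rewrite addr_ge0// mulr_ge0.
have xM' : `|x| <= `|M| by rewrite (le_trans xM)// ler_norm.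
have := KP x 0 xM'; rewrite normr0 subr0 => /(_ (normr_ge0 _)) FF.
have := ler_normD (F x - F 0) (F 0); rewrite subrK.
have : K * `|x| <= K * `|M| by rewrite ler_wpM2l.
lra.
Qed.

Lemma lip_on_balls_lip {R : realType} {W1 W2 : normedModType R}
    (F : W1 -> W2) K : 0 <= K -> (forall x y, `|F x - F y| <= K * `|x - y|) ->
  lip_on_balls F.
Proof. by move=> K0 KP M; exists K. Qed.

Lemma lip_on_balls_cst {R : realType} {W1 W2 : normedModType R} (c : W2) :
  lip_on_balls (fun _ : W1 => c).
Proof.
by apply: (@lip_on_balls_lip _ _ _ _ 0) => // x y; rewrite subrr normr0 mul0r.
Qed.

Lemma lip_on_ballsD {R : realType} {W1 W2 : normedModType R}
    (F G : W1 -> W2) : lip_on_balls F -> lip_on_balls G ->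
  lip_on_balls (fun x => F x + G x).
Proof.
move=> lF lG M; have [K K0 KP] := lF M; have [L L0 LP] := lG M.
exists (K + L) => [|x y xM yM]; first exact: addr_ge0.
rewrite opprD addrACA mulrDl (le_trans (ler_normD _ _))// lerD//.
  exact: KP.
exact: LP.
Qed.

Lemma lip_on_ballsZ {R : realType} {W1 W2 : normedModType R}
    (F : W1 -> R) (G : W1 -> W2) : lip_on_balls F -> lip_on_balls G ->
  lip_on_balls (fun x => F x *: G x).
Proof.
move=> lF lG M; have [K K0 KP] := lF M; have [L L0 LP] := lG M.
have [A A0 AP] := lip_on_balls_bounded lF M.
have [B B0 BP] := lip_on_balls_bounded lG M.
exists (A * L + K * B) => [|x y xM yM].
  by rewrite addr_ge0// mulr_ge0.
rewrite (_ : _ - _ = F x *: (G x - G y) + (F x - F y) *: G y); last first.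
  by rewrite scalerBr scalerBl addrA subrK.
rewrite (le_trans (ler_normD _ _))// mulrDl !normrZ lerD//.
  by rewrite -mulrA ler_pM ?AP ?LP.
by rewrite mulrAC ler_pM ?BP ?KP.
Qed.

Lemma lip_on_ballsM {R : realType} {W1 : normedModType R}
    (F G : W1 -> R) : lip_on_balls F -> lip_on_balls G ->
  lip_on_balls (fun x => F x * G x).
Proof. exact: lip_on_ballsZ. Qed.

Lemma lip_on_ballsN {R : realType} {W1 W2 : normedModType R}
    (F : W1 -> W2) : lip_on_balls F -> lip_on_balls (fun x => - F x).
Proof.
move=> lF M; have [K K0 KP] := lF M; exists K => // x y xM yM.
by rewrite -opprD normrN; exact: KP.
Qed.

Lemma lip_on_ballsX {R : realType} {W1 : normedModType R}
    (F : W1 -> R) k : lip_on_balls F -> lip_on_balls (fun x => F x ^+ k).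
Proof.
move=> lF; elim: k => [|k IH].
  by under eq_fun do rewrite expr0; exact: lip_on_balls_cst.
by under eq_fun do rewrite exprS; exact: lip_on_ballsM.
Qed.

Lemma lip_on_balls_sum {R : realType} {W1 W2 : normedModType R} (k : nat)
    (F : 'I_k -> W1 -> W2) : (forall i, lip_on_balls (F i)) ->
  lip_on_balls (fun x => \sum_(i < k) F i x).
Proof.
elim: k F => [|k IH] F lF.
  by under eq_fun do rewrite big_ord0; exact: lip_on_balls_cst.
by under eq_fun do rewrite big_ord_recr; apply: lip_on_ballsD => //; exact: IH.
Qed.

Lemma lip_on_balls_comp {R : realType} {W1 W2 W3 : normedModType R}
    (F : W1 -> W2) (G : W2 -> W3) : lip_on_balls F -> lip_on_balls G ->
  lip_on_balls (fun x => G (F x)).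
Proof.
move=> lF lG M; have [K K0 KP] := lF M.
have [B B0 BP] := lip_on_balls_bounded lF M.
have [L L0 LP] := lG B.
exists (L * K) => [|x y xM yM]; first exact: mulr_ge0.
by rewrite (le_trans (LP _ _ (BP _ xM) (BP _ yM)))// -mulrA ler_wpM2l// KP.
Qed.

Lemma coord_le_norm {R : realType} {n k : nat} (x : 'M[R]_(n, k)) i j :
  `|x i j| <= `|x|.
Proof.
by rewrite [leRHS]/Num.norm/= mx_normrE; apply: (le_bigmax _ (fun u => `|x u.1
  u.2|) (i, j)).
Qed.

Lemma norm_le_coord {R : realType} {n k : nat} (x : 'M[R]_(n, k)) M :
  0 <= M -> (forall i j, `|x i j| <= M) -> `|x| <= M.
Proof.
by move=> M0 xM; rewrite [leLHS]/Num.norm/= mx_normrE; apply/bigmax_leP; split.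
Qed.

Lemma lip_on_balls_coord {R : realType} {n k : nat} i j :
  lip_on_balls (fun x : 'M[R]_(n, k) => x i j).
Proof.
apply: (@lip_on_balls_lip _ _ _ _ 1) => // x y.
by rewrite mul1r (le_trans _ (coord_le_norm _ i j))// !mxE.
Qed.

Lemma lip_on_balls_fst {R : realType} {W1 W2 : normedModType R} :
  lip_on_balls (fun x : W1 * W2 => x.1).
Proof.
apply: (@lip_on_balls_lip _ _ _ _ 1) => // x y.
by rewrite mul1r prod_normE/= le_max lexx.
Qed.

Lemma lip_on_balls_snd {R : realType} {W1 W2 : normedModType R} :
  lip_on_balls (fun x : W1 * W2 => x.2).
Proof.
apply: (@lip_on_balls_lip _ _ _ _ 1) => // x y.
by rewrite mul1r prod_normE/= le_max lexx orbT.
Qed.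

Lemma lip_on_balls_pair {R : realType} {W1 W2 W3 : normedModType R}
    (F : W1 -> W2) (G : W1 -> W3) : lip_on_balls F -> lip_on_balls G ->
  lip_on_balls (fun x => (F x, G x)).
Proof.
move=> lF lG M; have [K K0 KP] := lF M; have [L L0 LP] := lG M.
exists (K + L) => [|x y xM yM]; first exact: addr_ge0.
rewrite prod_normE/= ge_max; apply/andP; split.
  by rewrite (le_trans (KP _ _ xM yM))// ler_wpM2r// lerDl.
by rewrite (le_trans (LP _ _ xM yM))// ler_wpM2r// lerDr.
Qed.

(** The inequality 1 + u <= exp u at u = y - x gives exp x - exp y <= exp x (x - y), hence the
    constant exp M. *)
Lemma lip_on_balls_expR {R : realType} : lip_on_balls (@expR R).
Proof.
have le (x y M : R) : `|x| <= M -> `|y| <= M -> expR x - expR y <= expR M * `|x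
  - y|.
  move=> xM yM; have : 1 + (y - x) <= expR (y - x) := expR_ge1Dx _.
  rewrite expRD expRN ler_pdivlMr ?expR_gt0// => H.
  have : expR x * (x - y) <= expR x * `|x - y|.
    by rewrite ler_wpM2l ?expR_ge0// ler_norm.
  have : expR x * `|x - y| <= expR M * `|x - y|.
    by rewrite ler_wpM2r// ler_expR (le_trans (ler_norm x)).
  lra.
move=> M; exists (expR M); first exact: expR_ge0.
move=> /= x y xM yM; rewrite ler_norml; have := le x y M xM yM.
have := le y x M yM xM; rewrite (distrC y x) => ? ?; lra.
Qed.

Lemma pos_part_ge0 {R : realType} (x : R) : 0 <= pos_part x.
Proof. by rewrite /pos_part le_max lexx orbT. Qed.

Lemma lip_on_balls_pos_part {R : realType} : lip_on_balls (@pos_part R).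
Proof.
apply: (@lip_on_balls_lip _ _ _ _ 1) => // x y; rewrite mul1r /pos_part.
by rewrite ler_norml; have := ler_norm (x - y); have := ler_norm (y - x);
  rewrite (distrC y); case: (leP x 0); case: (leP y 0); lra.
Qed.

Lemma ac_lip_on_balls {R : realType} {W1 W2 : normedModType R} (a b : R)
    (x : R -> W1) (F : W1 -> W2) : lip_on_balls F -> abs_continuous a b x ->
  abs_continuous a b (F \o x).
Proof.
move=> lF ac; have [M MP] := ac_bounded ac; have [K K0 KP] := lF M.
apply: (ac_lipschitz_comp K0 ac) => s t /andP[? ?] /andP[? ?].
by apply: KP; apply: MP.
Qed.

Lemma ac_pair {R : realType} {W1 W2 : normedModType R} (a b : R)
    (x1 : R -> W1) (x2 : R -> W2) :
  abs_continuous a b x1 -> abs_continuous a b x2 ->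
  abs_continuous a b (fun t => (x1 t, x2 t)).
Proof.
move=> ac1 ac2; apply: (ac_dominated ler01 ac1 ac2) => s t _ _.
rewrite mul1r prod_normE/= ge_max; apply/andP; split; first by rewrite lerDl.
by rewrite lerDr.
Qed.

(* [L] is the Frechet derivative; boundedness and linearity are kept explicit
   so that no bundled continuous linear map has to be built. *)
Definition has_frechet {R : realType} {W1 W2 : normedModType R}
    (F : W1 -> W2) (x : W1) (L : W1 -> W2) : Prop :=
  [/\ forall a h k, L (h - a *: k) = L h - a *: L k,
      exists2 K, 0 <= K & forall h, `|L h| <= K * `|h| &
      forall e, 0 < e -> exists2 d, 0 < d & forall h, `|h| < d ->
        `|F (x + h) - F x - L h| <= e * `|h|].

Lemma has_deriv_comp {R : realType} {W1 W2 : normedModType R}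
    (F : W1 -> W2) (x : R -> W1) t v L :
  has_frechet F (x t) L -> has_deriv x t v -> has_deriv (F \o x) t (L v).
Proof.
move=> [linL [K K0 KP] FL] xv e e0.
pose V := `|v| + 1; have V0 : 0 < V by rewrite ltr_wpDl.
have [d1 d10 d1P] := FL (e / 2 / V) (divr_gt0 (divr_gt0 e0 (ltr0n _ 2)) V0).
have K1 : 0 < K + 1 by lra.
(* The bound 1 ensures |x s - x t| <= V |s - t|; the other one pays for applying [L] to the
   remainder of [x]. *)
have [|d2 d20 d2P] := xv (Num.min 1 (e / 2 / (K + 1))).
  by rewrite lt_min ltr01 !divr_gt0.
exists (Num.min d2 (d1 / V)).
  by rewrite lt_min d20 divr_gt0.
move=> s; rewrite lt_min ltr_pdivlMr// => /andP[sd2 sd1].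
have {}d2P := d2P s sd2.
set h := x s - x t in d2P.
have hle : `|h| <= V * `|s - t|.
  have := ler_normD (h - (s - t) *: v) ((s - t) *: v); rewrite subrK normrZ.
  have : Num.min 1 (e / 2 / (K + 1)) * `|s - t| <= 1 * `|s - t|.
    by rewrite ler_wpM2r// ge_min lexx.
  rewrite /V; lra.
have hd1 : `|h| < d1 by rewrite (le_lt_trans hle)// mulrC.
have := d1P h hd1; rewrite [x t + h]addrC subrK => FF.
rewrite /= (_ : _ - _ = (F (x s) - F (x t) - L h) + L (h - (s - t) *: v));
  last by rewrite linL addrA subrK.
rewrite (le_trans (ler_normD _ _))//.
have A1 : e / 2 / V * `|h| <= e / 2 * `|s - t|.
  rewrite -mulrA ler_wpM2l ?divr_ge0 ?(ltW e0)//.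
  by rewrite mulrC ler_pdivrMr// mulrC.
have A2 : K * `|h - (s - t) *: v| <= e / 2 * `|s - t|.
  rewrite (@le_trans _ _ ((K + 1) * `|h - (s - t) *: v|))//.
    by rewrite ler_wpM2r// lerDl.
  rewrite (@le_trans _ _ ((K + 1) * (e / 2 / (K + 1) * `|s - t|)))//.
    rewrite ler_wpM2l ?(ltW K1)// (le_trans d2P)// ler_wpM2r//.
    by rewrite ge_min lexx orbT.
  by rewrite mulrA mulrCA divff ?mulr1// gt_eqF.
have := KP (h - (s - t) *: v); lra.
Qed.

Lemma has_frechet_real {R : realType} (F : R -> R) (x w : R) :
  has_deriv F x w -> has_frechet F x (fun h => w * h).
Proof.
move=> Fw; split.
- by move=> a h k; rewrite /GRing.scale/=; ring.
- by exists `|w| => // h; rewrite normrM.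
- move=> e e0; have [d d0 dP] := Fw e e0; exists d => // h hd.
  have := dP (x + h); rewrite (_ : x + h - x = h); last by ring.
  by rewrite /GRing.scale/= mulrC; apply.
Qed.

(** [pos_part] has a corner at 0, but its square is differentiable everywhere, with remainder at
    most (s - x)^2; one-sided bounds thereby become differential inequalities. *)
Lemma has_deriv_sqr_pos_part {R : realType} (x : R) :
  has_deriv (fun u : R => pos_part u ^+ 2) x (2 * pos_part x).
Proof.
move=> e e0; exists e => // s se.
rewrite (@le_trans _ _ (`|s - x| * `|s - x|))//;
  last by rewrite ler_wpM2r// ltW.
rewrite -normrM ler_norml /GRing.scale/= /pos_part.
have sq : 0 <= (s - x) * (s - x) by rewrite -expr2 sqr_ge0.
rewrite (ger0_norm sq) !expr2.
case: (leP s 0) => s0; case: (leP x 0) => x0; apply/andP; split; nra.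
Qed.

Lemma has_deriv_line {R : realType} {n : nat} {W : normedModType R}
    (f : 'cV[R]_n -> W) (y w v : 'cV[R]_n) (a t : R) : w = a *: v ->
  derivable f (y + t *: w) v ->
  has_deriv (fun s => f (y + s *: w)) t (a *: 'D_v f (y + t *: w)).
Proof.
move=> -> dfv e e0; set x := y + _; pose A := `|a| + 1.
have A0 : 0 < A by rewrite ltr_wpDl.
have /cvgrPdist_le /(_ (e / A) (divr_gt0 e0 A0)) /nbhs_ballP[d /= d0 dP] := dfv.
exists (d / A); first by rewrite divr_gt0.
move=> s; rewrite ltr_pdivlMr// => std.
pose h := (s - t) * a.
have -> : y + s *: (a *: v) = h *: v + x.
  rewrite /x !scalerA addrCA -scalerDl /h; congr (_ + _ *: _); ring.
have hA : `|h| <= `|s - t| * A by rewrite /h normrM ler_wpM2l// lerDl.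
rewrite scalerA -/h; have [->|h0] := eqVneq h 0.
  by rewrite !scale0r add0r subrr subr0 normr0 mulr_ge0// ltW.
have := dP h; rewrite /ball/= sub0r normrN => /(_ (le_lt_trans hA std) h0).
have -> : f (h *: v + x) - f x - h *: 'D_v f x =
    - (h *: ('D_v f x - h^-1 *: (f (h *: v + x) - f x))).
  by rewrite [in RHS]scalerBr scalerA divff// scale1r opprB.
rewrite normrN normrZ => {}dP.
rewrite (@le_trans _ _ (`|h| * (e / A)))// ?ler_wpM2l//.
rewrite mulrCA ler_wpM2l ?(ltW e0)// ler_pdivrMr//.
Qed.

(** Mean value inequality for values in a normed space: differentiability at a tag carries the bound
    across a small interval with slack [e], and [straddle_induction] glues the pieces. *)
Lemma line_increment {R : realType} {n : nat} {W : normedModType R}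
    (f : 'cV[R]_n -> W) (y v : 'cV[R]_n) (a K : R) (p : W) : 0 <= K ->
  (forall x, derivable f x v) ->
  (forall t, 0 <= t <= 1 -> `|'D_v f (y + t *: (a *: v)) - p| <= K) ->
  `|f (y + a *: v) - f y - a *: p| <= K * `|a|.
Proof.
move=> K0 df DK.
suff H e : 0 < e -> `|f (y + a *: v) - f y - a *: p| <= K * `|a| + e.
  exact/ler_addgt0Pr.
move=> e0; pose g t := f (y + t *: (a *: v)).
pose S c : Prop := `|g c - g 0 - c *: (a *: p)| <= (K * `|a| + e) * c.
suff : S 1 by rewrite /S /g !scale1r scale0r addr0 mulr1.
apply: (straddle_induction ler01).
  by rewrite /S subrr scale0r subr0 normr0 mulr0.
move=> t t0 t1.
have gt : has_deriv g t (a *: 'D_v f (y + t *: (a *: v))).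
  by apply: has_deriv_line => //; exact: df.
have [d d0 dP] := has_deriv_straddle gt e0.
exists d => // u u' u0 ut tu' u'1 uu'd; rewrite /S => Su.
have := dP u u' ut tu' uu'd; set D := 'D_v f _ => Du.
have -> : g u' - g 0 - u' *: (a *: p) = (g u - g 0 - u *: (a *: p)) +
    ((g u' - g u - (u' - u) *: (a *: D)) + (u' - u) *: (a *: (D - p))).
  rewrite (scalerBr a) (scalerBr (u' - u)) [X in _ = _ + X]addrA subrK.
  rewrite (scalerBl u' u (a *: p)) opprB.
  rewrite [RHS](_ : _ = (g u - g u) + (u *: (a *: p) - u *: (a *: p)) +
    (g u' - g 0 - u' *: (a *: p))); first by rewrite !subrr !add0r.
  by rewrite !addrA (ACl (1*5*6*3*4*2*7)).
have Dp : `|D - p| <= K by apply: DK; rewrite t0.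
have uu' : 0 <= u' - u by lra.
have : `|(u' - u) *: (a *: (D - p))| <= (u' - u) * (K * `|a|).
  by rewrite !normrZ ger0_norm// ler_wpM2l// mulrC ler_wpM2r.
have := ler_normD (g u' - g u - (u' - u) *: (a *: D)) ((u' - u) *: (a *: (D -
  p))).
move=> N1 N2; apply: le_trans (ler_normD _ _) _; lra.
Qed.

(* Moves from [y1] to [y2] along the coordinate directions, staying in the
   max-norm ball around [y0]. *)
Lemma partial_increment {R : realType} {n : nat} {W : normedModType R}
    (f : 'cV[R]_n -> W) (y0 y1 y2 : 'cV[R]_n) (r K : R) (p : 'I_n -> W) :
  0 <= K -> (forall i y, derivable f y (delta_mx i ord0)) ->
  (forall i y, `|y - y0| <= r -> `|partial i f y - p i| <= K) ->
  `|y1 - y0| <= r -> `|y2 - y0| <= r ->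
  `|f y2 - f y1 - \sum_(i < n) (y2 i ord0 - y1 i ord0) *: p i|
    <= n%:R * K * `|y2 - y1|.
Proof.
move=> K0 df DK y1r y2r.
(* Consecutive points of this path from [y1] to [y2] differ in one coordinate only. *)
pose c (k : nat) : 'cV[R]_n :=
  \col_i (if (i < k)%N then y2 i ord0 else y1 i ord0).
have c0 : c 0%N = y1 by apply/colP => i; rewrite mxE.
have cn : c n = y2 by apply/colP => i; rewrite mxE ltn_ord.
have -> : f y2 - f y1 = \sum_(i < n) (f (c i.+1) - f (c i)).
  by rewrite -(big_mkord xpredT (fun k => f (c k.+1) - f (c k)))
     telescope_sumr// c0 cn.
rewrite -sumrB (le_trans (ler_norm_sum _ _ _))//.
have -> : n%:R * K * `|y2 - y1| = \sum_(i < n) K * `|y2 - y1|.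
  by rewrite sumr_const card_ord -mulrA mulr_natl.
apply: ler_sum => k _; set a := y2 k ord0 - y1 k ord0.
have cS : c k.+1 = c k + a *: delta_mx k ord0.
  apply/colP => i; rewrite !mxE eqxx andbT ltnS leq_eqVlt.
  have [->|ik] := eqVneq i k; first by rewrite eqxx/= ltnn mulr1 addrC subrK.
  by rewrite (inj_eq val_inj) (negbTE ik)/= mulr0 addr0.
rewrite cS (@le_trans _ _ (K * `|a|))//.
  apply: line_increment => // t /andP[t0 t1]; apply: DK.
  (* Each coordinate of the intermediate point comes from [y1], from [y2], or is a convex
     combination of both; a max-norm ball is a box, so the point stays inside. *)
  apply: norm_le_coord => [|i j]; first exact: le_trans y1r.
  have h1 : `|y1 i j - y0 i j| <= r.
    by have := le_trans (coord_le_norm (y1 - y0) i j) y1r; rewrite !mxE.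
  have h2 : `|y2 i j - y0 i j| <= r.
    by have := le_trans (coord_le_norm (y2 - y0) i j) y2r; rewrite !mxE.
  have j0 : j = ord0 by exact: ord1.
  rewrite {}j0 in h1 h2 *; rewrite !mxE eqxx andbT.
  have [ik|ik] := eqVneq i k.
    rewrite {}ik in h1 h2 *; rewrite ltnn/= mulr1 /a.
    move: h1 h2; rewrite !ler_norml.
    move: (y1 k ord0) (y2 k ord0) (y0 k ord0) => A B D /andP[? ?] /andP[? ?].
    by apply/andP; split; nra.
  by rewrite !mulr0 addr0; case: ifP.
rewrite ler_wpM2l//; have := coord_le_norm (y2 - y1) k ord0.
by rewrite !mxE.
Qed.

(** A max-norm ball is a product of segments, hence compact; transposition carries this from row to
    column vectors. *)
Lemma cV_bounded_sup {R : realType} {n : nat} {W : normedModType R}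
    (f : 'cV[R]_n -> W) : continuous f ->
  forall M, exists2 B, 0 <= B & forall x, `|x| <= M -> `|f x| <= B.
Proof.
move=> cf M.
pose A := [set v : 'rV[R]_n | forall i, `[- M, M]%classic (v ord0 i)].
have cA : compact A.
  by apply: (@rV_compact _ _ (fun=> `[- M, M]%classic)) => i;
    exact: segment_compact.
have ct : continuous (fun v : 'rV[R]_n => f v^T).
  suff tc : continuous (fun v : 'rV[R]_n => v^T).
    by move=> v; apply: continuous_comp; [exact: tc|exact: cf].
  apply/continuous_distP => v e e0; exists e => // w wv.
  apply: le_lt_trans wv; apply: norm_le_coord => // i j.
  by rewrite !mxE; have := coord_le_norm (w - v) j i; rewrite !mxE.
have /compact_bounded[B [_ BP]] :=
  continuous_compact (continuous_subspaceT ct) cA.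
exists (`|B| + 1) => [|x xM]; first by rewrite addr_ge0.
apply: (BP (`|B| + 1)); first by rewrite ltr_pwDr// ler_norm.
exists x^T => /=; last by rewrite trmxK.
move=> i; rewrite mxE/= in_itv/= -ler_norml.
exact: le_trans (coord_le_norm _ _ _) xM.
Qed.

(** With comparison slopes 0 and centre 0, [partial_increment] turns a common bound [K] of the
    partial derivatives on the ball into the Lipschitz constant n K. *)
Lemma smooth_lip_on_balls {R : realType} {n : nat} {W : normedModType R}
    (f : 'cV[R]_n -> W) : smooth f -> lip_on_balls f.
Proof.
move=> sf M.
have [K K0 KP] : exists2 K, 0 <= K &
    forall i x, `|x| <= M -> `|partial i f x| <= K.
  have H i := cV_bounded_sup (sf [:: i]).1 M.
  pose B i := xget 0 [set b | 0 <= b /\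
    forall x, `|x| <= M -> `|partial i f x| <= b].
  have BP i : 0 <= B i /\ forall x, `|x| <= M -> `|partial i f x| <= B i.
    have [b b0 bP] := H i.
    exact: (@xgetPex _ 0 [set b | 0 <= b /\
      forall x, `|x| <= M -> `|partial i f x| <= b] (ex_intro _ b (conj b0
        bP))).
  exists (\sum_(i < n) B i) => [|i x xM].
    by apply: sumr_ge0 => i _; have [] := BP i.
  have [_ /(_ x xM) le] := BP i; apply: le_trans le _.
  by rewrite (bigD1 i)//= lerDl sumr_ge0// => j _; have [] := BP j.
exists (n%:R * K) => [|x y xM yM]; first exact: mulr_ge0.
have := @partial_increment _ _ _ f 0 y x M K (fun=> 0) K0 (sf [::]).2 _.
rewrite !subr0 => H; have := H _ yM xM.
rewrite big1 ?subr0 => [|i _]; last by rewrite scaler0.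
by apply => i z; rewrite !subr0; exact: KP.
Qed.

(** [foldr] applies the last direction of the list first, so differentiating [partial i f] along [s]
    is differentiating [f] along [rcons s i]. *)
Lemma smooth_partial {R : realType} {n : nat} {W : normedModType R}
    (f : 'cV[R]_n -> W) i : smooth f -> smooth (partial i f).
Proof.
by move=> sf s; have := sf (rcons s i); rewrite -cats1 foldr_cat.
Qed.

(** Continuous partial derivatives are nearly constant on a small box around [y]; comparison with
    their values at [y] leaves an error n K |h|, whence the choice K = e / (n + 1). *)
Lemma smooth_has_frechet {R : realType} {n : nat} (V : 'cV[R]_n -> R)
    (y : 'cV[R]_n) : smooth V ->
  has_frechet V y (fun h => (grad V y *m h) ord0 ord0).
Proof.
move=> sV; have gE h : (grad V y *m h) ord0 ord0 =
    \sum_(i < n) h i ord0 * partial i V y.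
  by rewrite mxE; apply: eq_bigr => i _; rewrite mxE mulrC.
split.
- by move=> a h k; rewrite mulmxBr -scalemxAr !mxE.
- exists (\sum_(i < n) `|partial i V y|) => [|h]; first exact: sumr_ge0.
  rewrite gE (le_trans (ler_norm_sum _ _ _))// mulr_suml.
  by apply: ler_sum => i _; rewrite normrM mulrC ler_wpM2l// coord_le_norm.
move=> e e0; pose K := e / (n%:R + 1).
have n1 : 0 < n%:R + 1 :> R by rewrite ltr_wpDl.
have K0 : 0 < K by rewrite divr_gt0.
have [d d0 dP] : exists2 d, 0 < d & forall i x, `|x - y| <= d ->
    `|partial i V x - partial i V y| <= K.
  have H i : exists d : R, 0 < d /\ forall x, `|x - y| <= d ->
      `|partial i V x - partial i V y| <= K.
    have /cvgrPdist_le /(_ _ K0) /nbhs_ballP[d /= d0 dP] := (sV [:: i]).1 y.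
    exists (d / 2); split => [|x xyd]; first by rewrite divr_gt0.
    rewrite distrC; apply: dP; rewrite -ball_normE/= distrC.
    by rewrite (le_lt_trans xyd)// ltr_pdivrMr// ltr_pMr// ltr1n.
  pose B i := xget 0 [set d : R | 0 < d /\ forall x, `|x - y| <= d ->
      `|partial i V x - partial i V y| <= K].
  have BP i := @xgetPex _ 0 [set d : R | 0 < d /\ forall x, `|x - y| <= d ->
      `|partial i V x - partial i V y| <= K] (H i).
  exists (\big[Num.min/1]_(i < n) B i).
    by apply: lt_bigmin => // i _; have [] := BP i.
  move=> i x /le_trans le; have [_] := BP i; apply; apply: le.
  exact: bigmin_le_cond.
exists d => // h hd.
have := @partial_increment _ _ _ V y y (y + h) d K (partial^~ V ^~ y) (ltW K0)
  (sV [::]).2 dP.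
rewrite subrr normr0 => /(_ (ltW d0)).
rewrite addrAC subrr add0r => /(_ (ltW hd)).
under eq_bigr do rewrite mxE addrAC subrr add0r.
rewrite gE => /le_trans; apply; rewrite ler_wpM2r// /K mulrA ler_pdivrMr//.
by rewrite mulrC ler_wpM2l ?(ltW e0)// lerDl.
Qed.

(** * Comparison functions *)

Lemma pos_part_mono {R : realType} (u v : R) : u <= v -> pos_part u <= pos_part
  v.
Proof. by move=> uv; rewrite /pos_part ge_max !le_max uv lexx orbT. Qed.

Lemma pos_part_id {R : realType} (u : R) : 0 <= u -> pos_part u = u.
Proof. exact: max_idPl. Qed.

Lemma pos_part_eq0 {R : realType} (u : R) : u <= 0 -> pos_part u = 0.
Proof. exact: max_idPr. Qed.

Lemma pos_part_lip {R : realType} (u v : R) :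
  pos_part u <= pos_part v + `|u - v|.
Proof.
by have := ler_norm (u - v); rewrite /pos_part => ?; case: (leP u 0);
  case: (leP v 0);
  have := normr_ge0 (u - v); lra.
Qed.

Lemma pos_part_dist {R : realType} (u v : R) :
  `|pos_part u - pos_part v| <= `|u - v|.
Proof.
rewrite ler_norml; have := pos_part_lip u v.
by have := pos_part_lip v u; rewrite (distrC v u); lra.
Qed.

Section gain.
Context {R : realType} {n : nat} (V Q : 'cV[R]_n -> R).

(* The infimal convolution turns the implicit lower bound of [Q] in terms of [V]
   into a nondecreasing 1-Lipschitz function with [gain_inf (V y) <= Q y / 2].
     *)
Definition gain_inf (v : R) : R :=
  inf [set Q y / 2 + pos_part (v - V y) | y in setT].

Hypothesis Q0 : forall y, 0 <= Q y.

Lemma gain_inf_has_inf v :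
  has_inf [set Q y / 2 + pos_part (v - V y) | y in setT].
Proof.
split; first by exists (Q 0 / 2 + pos_part (v - V 0)), 0.
by exists 0 => _ [y _ <-]; rewrite addr_ge0 ?divr_ge0 ?pos_part_ge0.
Qed.

Lemma gain_inf_lb v y : gain_inf v <= Q y / 2 + pos_part (v - V y).
Proof. by apply: ge_inf; [exact: (gain_inf_has_inf v).2 | exists y]. Qed.

Lemma le_gain_inf v M : (forall y, M <= Q y / 2 + pos_part (v - V y)) ->
  M <= gain_inf v.
Proof.
move=> H; apply: lb_le_inf; first exact: (gain_inf_has_inf v).1.
by move=> _ [y _ <-].
Qed.

Lemma gain_inf_ge0 v : 0 <= gain_inf v.
Proof.
by apply: le_gain_inf => y; rewrite addr_ge0 ?divr_ge0 ?pos_part_ge0.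
Qed.

Lemma gain_inf_mono u v : u <= v -> gain_inf u <= gain_inf v.
Proof.
move=> uv; apply: le_gain_inf => y; apply: le_trans (gain_inf_lb u y) _.
by rewrite lerD2l pos_part_mono// lerD2r.
Qed.

Lemma gain_inf_lip u v : gain_inf u <= gain_inf v + `|u - v|.
Proof.
rewrite -lerBlDr; apply: le_gain_inf => y; rewrite lerBlDr.
apply: le_trans (gain_inf_lb u y) _; rewrite -addrA lerD2l.
by rewrite (le_trans (pos_part_lip _ (v - V y)))// opprB addrA subrK.
Qed.

Lemma gain_inf_le y : gain_inf (V y) <= Q y / 2.
Proof.
by have := gain_inf_lb (V y) y; rewrite subrr pos_part_eq0// addr0.
Qed.

Lemma gain_inf_continuous : continuous gain_inf.
Proof.
apply/(continuous_distP (W1 := R) (W2 := R)) => s e e0; exists e => // t.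
apply: le_lt_trans; rewrite ler_norml; have := gain_inf_lip s t.
by have := gain_inf_lip t s; rewrite (distrC s t); lra.
Qed.

Hypothesis Qpos : posdef Q.
Hypothesis Qunb : radially_unbounded Q.
Hypothesis V0 : V 0 = 0.
Hypothesis Vc : continuous V.
Hypothesis Qc : continuous Q.

(** Points with V y < v / 2 already cost v / 2 through the positive part. On the others [Q] is
    bounded below by a positive number: its sublevel set is compact, and [V 0 = 0] keeps the origin
    out. *)
Lemma gain_inf_gt0 v : 0 < v -> 0 < gain_inf v.
Proof.
move=> v0; pose K := [set y | Q y <= 1] `&` [set y | v / 2 <= V y].
have cK : compact K.
  apply: compact_closedI; first exact: Qunb.
  by apply: (closed_comp (f := V)) (@closed_ge _ (v / 2)) => y _; exact: Vc.
have [e e0 eP] : exists2 e, 0 < e & forall y, v / 2 <= V y -> e <= Q y.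
  have [K0|/set0P K0] := eqVneq K set0.
    exists 1 => // y vy; rewrite leNgt; apply/negP => Q1.
    by have : set0 y by rewrite -K0; split => //=; exact: ltW.
  have [c cK' cmin] := compact_EVT_min K0 cK (continuous_subspaceT Qc).
  have Qc0 : 0 < Q c.
    apply: Qpos.2; apply/eqP => c0; move: cK'; rewrite inE => -[_ /=].
    by rewrite c0 V0; lra.
  exists (Num.min 1 (Q c)) => [|y vy]; first by rewrite lt_min ltr01.
  rewrite ge_min; have [//|Q1] := leP 1 (Q y).
  by apply: cmin; rewrite inE; split => //=; exact: ltW.
apply: (@lt_le_trans _ _ (Num.min (e / 2) (v / 2))).
  by rewrite lt_min !divr_gt0.
apply: le_gain_inf => y; have Qy := Q0 y; have pp := pos_part_ge0 (v - V y).
rewrite ge_min; have [/eP ?|Vy] := leP (v / 2) (V y).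
  by apply/orP; left; lra.
by apply/orP; right; rewrite pos_part_id; lra.
Qed.

(** For large [w] every [y] costs at least [M]: either Q y > 2 M, or [y] lies in a compact sublevel
    set of [Q], on which [V] is bounded and the positive part is large. *)
Lemma gain_inf_unbounded M : 0 < M ->
  exists2 v, 0 <= v & forall w, v <= w -> M <= gain_inf w.
Proof.
move=> M0.
have cK : compact (V @` [set y | Q y <= 2 * M]).
  apply: continuous_compact; first exact: continuous_subspaceT.
  by apply: Qunb; rewrite mulr_gt0.
have [B [_ BP]] := compact_bounded cK.
exists (`|B| + 1 + M) => [|w wB]; first by rewrite !addr_ge0// ltW.
apply: le_gain_inf => y; have Qy := Q0 y; have pp := pos_part_ge0 (w - V y).
have [QM|QM] := leP (Q y) (2 * M); last by lra.
have : `|V y| <= `|B| + 1.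
  apply: (BP (`|B| + 1)); first by rewrite ltr_pwDr// ler_norm.
  by exists y.
move=> VB; have VV := ler_norm (V y); rewrite pos_part_id; lra.
Qed.

End gain.

(* Class K_oo functions presented as total continuous functions on the line. *)
Definition Kinfty {R : realType} (h : R -> R) : Prop :=
  [/\ h 0 = 0, forall s t, 0 <= s -> s < t -> h s < h t, continuous h &
      forall M, exists2 c, 0 <= c & M <= h c].

Lemma exists_gain {R : realType} {n : nat} (V Q : 'cV[R]_n -> R) :
  (forall y, 0 <= Q y) -> posdef Q -> radially_unbounded Q -> V 0 = 0 ->
  continuous V -> continuous Q ->
  exists2 rho, Kinfty rho & forall y, rho (V y) <= Q y / 2.
Proof.
move=> Q0 Qpos Qunb V0 Vc Qc.
(* The factor [w] makes the gain strictly increasing. *)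
pose w (v : R) := pos_part v / (1 + pos_part v).
have p1 (v : R) : 0 < 1 + pos_part v by rewrite ltr_pwDl ?pos_part_ge0.
have w_ge0 v : 0 <= w v by rewrite divr_ge0 ?pos_part_ge0 ?ltW.
have w_le1 v : w v <= 1 by rewrite ler_pdivrMr// mul1r lerDr.
have w_lt s t : 0 <= s -> s < t -> w s < w t.
  move=> s0 st; rewrite /w !pos_part_id ?(le_trans s0 (ltW st))//.
  have s1 : 0 < 1 + s by lra.
  have t1 : 0 < 1 + t by lra.
  by rewrite ltr_pdivrMr// mulrAC ltr_pdivlMr//; lra.
exists (fun v => gain_inf V Q v * w v); last first.
  move=> y; apply: le_trans (gain_inf_le V Q0 y).
  by rewrite ler_piMr// gain_inf_ge0.
split.
- by rewrite /w pos_part_eq0// mul0r mulr0.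
- move=> s t s0 st; have t0 : 0 < t by exact: le_lt_trans st.
  apply: (@le_lt_trans _ _ (gain_inf V Q t * w s)).
    by rewrite ler_wpM2r// gain_inf_mono// ltW.
  by rewrite ltr_pM2l ?w_lt// gain_inf_gt0.
- have pc : continuous (@pos_part R).
    apply/(continuous_distP (W1 := R) (W2 := R)) => s e e0; exists e => // t.
    apply: le_lt_trans; rewrite ler_norml; have := pos_part_lip s t.
    by have := pos_part_lip t s; rewrite (distrC s t); lra.
  move=> v; apply: cvgM; first exact: gain_inf_continuous.
  apply: cvgM; first exact: pc.
  apply: cvgV; first by rewrite gt_eqF.
  by apply: cvgD; [exact: cvg_cst|exact: pc].
- move=> M.
  have [|v v0 vP] := gain_inf_unbounded Q0 Qunb Vc (_ : 0 < 2 * `|M| + 1).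
    by rewrite ltr_wpDl// mulr_ge0.
  (* The shift by 1 brings the factor [w] above 1/2, which the doubled target 2 |M| + 1
     compensates. *)
  exists (v + 1); first by rewrite addr_ge0.
  have := vP (v + 1); rewrite lerDl => /(_ ler01) gM.
  have w2 : 1 / 2 <= w (v + 1).
    rewrite /w pos_part_id ?addr_ge0//.
    have v1 : 0 < 1 + (v + 1) by lra.
    by rewrite ler_pdivlMr//; lra.
  have MM := ler_norm M.
  apply: (@le_trans _ _ ((2 * `|M| + 1) * (1 / 2))); first by lra.
  by apply: ler_pM => //; lra.
Qed.

Definition Kinv {R : realType} (h : R -> R) (s : R) : R :=
  xget 0 [set c | 0 <= c /\ h c = pos_part s].

Section Kinv.
Context {R : realType} (h : R -> R).
Hypothesis hK : Kinfty h.

Lemma Kinfty_ge0 s : 0 <= s -> 0 <= h s.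
Proof.
have [h0 hlt _ _] := hK; rewrite le_eqVlt => /predU1P[<-|s0];
  first by rewrite h0.
by rewrite -h0 ltW// hlt.
Qed.

Lemma Kinfty_le s t : 0 <= s -> s <= t -> h s <= h t.
Proof.
have [_ hlt _ _] := hK; move=> s0; rewrite le_eqVlt => /predU1P[->//|st].
exact/ltW/hlt.
Qed.

Lemma Kinfty_lt_inv s t : 0 <= t -> h s < h t -> s < t.
Proof.
by move=> t0; rewrite !ltNge; apply: contra => ts; exact: Kinfty_le.
Qed.

Lemma KinvP s : 0 <= Kinv h s /\ h (Kinv h s) = pos_part s.
Proof.
have [h0 hlt hc hM] := hK.
suff [c c0 cs] : exists2 c, 0 <= c & h c = pos_part s.
  exact: (@xgetPex _ 0 [set c | 0 <= c /\ h c = pos_part s]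
    (ex_intro _ c (conj c0 cs))).
have [b b0 bP] := hM (pos_part s).
have hb : h 0 <= h b by rewrite h0 Kinfty_ge0.
have [|c] := IVT b0 (continuous_subspaceT hc) (v := pos_part s).
  have ps := pos_part_ge0 s; rewrite h0 in hb *.
  by rewrite (min_idPl hb) (max_idPr hb) ps.
by rewrite in_itv/= => /andP[c0 _] cs; exists c.
Qed.

Lemma Kinv_ge0 s : 0 <= Kinv h s. Proof. exact: (KinvP s).1. Qed.

Lemma KinvK s : 0 <= s -> h (Kinv h s) = s.
Proof. by move=> s0; rewrite (KinvP s).2 pos_part_id. Qed.

Lemma Kinv_le_of s c : 0 <= c -> s <= h c -> Kinv h s <= c.
Proof.
move=> c0 sc; rewrite leNgt; apply/negP => cK.
have [_ hlt _ _] := hK; have := hlt _ _ c0 cK; rewrite (KinvP s).2.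
have hc0 := Kinfty_ge0 c0; rewrite /pos_part; case: (leP s 0) => ? ?; lra.
Qed.

Lemma Kinv_ge_of s c : 0 <= c -> h c <= s -> c <= Kinv h s.
Proof.
move=> c0 sc; rewrite leNgt; apply/negP => cK.
have [_ hlt _ _] := hK; have := hlt _ _ (Kinv_ge0 s) cK.
rewrite KinvK; first lra.
exact: le_trans (Kinfty_ge0 c0) sc.
Qed.

Lemma Kinv_le s t : s <= t -> Kinv h s <= Kinv h t.
Proof.
move=> st; apply: Kinv_le_of; first exact: Kinv_ge0.
rewrite (KinvP t).2; apply: le_trans st _.
by rewrite /pos_part le_max lexx.
Qed.

Lemma Kinv0 : Kinv h 0 = 0.
Proof.
have [h0 _ _ _] := hK; apply/eqP; rewrite eq_le Kinv_ge0 andbT.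
by apply: Kinv_le_of => //; rewrite h0.
Qed.

Lemma Kinv_lt s t : 0 <= s -> s < t -> Kinv h s < Kinv h t.
Proof.
move=> s0 st; apply: Kinfty_lt_inv; first exact: Kinv_ge0.
by rewrite !KinvK//; exact: le_trans s0 (ltW st).
Qed.

Lemma Kinv_continuous : continuous (Kinv h).
Proof.
have [h0 hlt _ _] := hK.
apply/(continuous_distP (W1 := R) (W2 := R)) => s e e0.
set c := Kinv h s; have c0 : 0 <= c by exact: Kinv_ge0.
have hc : h c = pos_part s by exact: (KinvP s).2.
have d1 : 0 < h (c + e) - h c by rewrite subr_gt0 hlt// ltrDl.
have step t : `|t - s| < h (c + e) - h c -> Kinv h t < c + e.
  move=> ts; apply: Kinfty_lt_inv; first by rewrite addr_ge0// ltW.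
  rewrite (KinvP t).2.
  by have := pos_part_lip t s; rewrite -hc; lra.
(* If [c < e] the lower estimate is free, [Kinv] being nonnegative; otherwise [c - e] is in the
   range where [h] is increasing. *)
have [ce|ce] := ltP c e.
  exists (h (c + e) - h c) => // t /step tc.
  by have := Kinv_ge0 t; rewrite ltr_norml; lra.
have d2 : 0 < h c - h (c - e).
  by rewrite subr_gt0 hlt ?subr_ge0// ltrBlDr ltrDl.
exists (Num.min (h (c + e) - h c) (h c - h (c - e))).
  by rewrite lt_min d1.
move=> t; rewrite lt_min => /andP[/step tc ts].
have : c - e < Kinv h t.
  apply: Kinfty_lt_inv; first exact: Kinv_ge0.
  rewrite (KinvP t).2; have := pos_part_lip s t.
  by rewrite distrC -hc; lra.
by rewrite ltr_norml; lra.
Qed.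

Lemma Kinv_unbounded M : exists2 s, 0 <= s & forall t, s <= t -> M <= Kinv h t.
Proof.
exists (h `|M|) => [|t ht]; first exact: Kinfty_ge0.
by rewrite (le_trans (ler_norm M))// Kinv_ge_of.
Qed.

End Kinv.

Section decay.
Context {R : realType} (rho : R -> R).
Hypothesis rhoK : Kinfty rho.

(** [pos_part t] makes this of class K_oo in [c] for every real [t], so that [Kinv] applies without
    side conditions. *)
Let decay_fun (t c : R) : R := c + pos_part t * rho c / 2.

Lemma Kinfty_decay t : Kinfty (decay_fun t).
Proof.
have [r0 rlt rc rM] := rhoK; have pt := pos_part_ge0 t; split.
- by rewrite /decay_fun r0 mulr0 mul0r addr0.
- move=> u v u0 uv; rewrite /decay_fun.
  have : pos_part t * rho u <= pos_part t * rho v.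
    by rewrite ler_wpM2l// ltW// rlt.
  lra.
- move=> c; apply: cvgD; first exact: cvg_id.
  by apply: cvgMl; apply: cvgMr; exact: rc.
- move=> M; exists `|M| => //; rewrite /decay_fun.
  have : 0 <= pos_part t * rho `|M| by rewrite mulr_ge0// (Kinfty_ge0 rhoK).
  by have := ler_norm M; lra.
Qed.

(* [decay_KL s t] bounds at time [t] every [v >= 0] with [v 0 = s] and
   [v' <= - rho v / 2]: such a [v] is nonincreasing, hence
   [v t + t * rho (v t) / 2 <= s]. *)
Definition decay_KL (s t : R) : R := Kinv (decay_fun t) s.

Lemma le_decay_KL s t c : 0 <= c -> 0 <= t -> c + t * rho c / 2 <= s ->
  c <= decay_KL s t.
Proof.
move=> c0 t0 cs; apply: (Kinv_ge_of (Kinfty_decay t)) => //.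
by rewrite /decay_fun pos_part_id.
Qed.

Lemma decay_KL_eq s t : 0 <= s -> 0 <= t ->
  0 <= decay_KL s t /\ decay_KL s t + t * rho (decay_KL s t) / 2 = s.
Proof.
move=> s0 t0; split; first exact: (Kinv_ge0 (Kinfty_decay t)).
by have := KinvK (Kinfty_decay t) s0; rewrite {1}/decay_fun pos_part_id.
Qed.

Lemma decay_KL_le s t : 0 <= s -> 0 <= t -> decay_KL s t <= s.
Proof.
move=> s0 t0; have [c0 cs] := decay_KL_eq s0 t0.
have : 0 <= t * rho (decay_KL s t) by rewrite mulr_ge0// (Kinfty_ge0 rhoK).
lra.
Qed.

(** Subtract the two defining equations: when [c' < c], monotonicity of [rho] gives t' rho c' <= t'
    rho c, and only |s - s'| and a time difference weighted by rho s / 2 remain. *)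
Lemma decay_KL_dist s t s' t' : 0 <= s -> 0 <= t -> 0 <= s' -> 0 <= t' ->
  decay_KL s t - decay_KL s' t' <= `|s - s'| + `|t - t'| * rho s / 2.
Proof.
move=> s0 t0 s'0 t'0; have := decay_KL_eq s0 t0; have := decay_KL_eq s'0 t'0.
have := decay_KL_le s0 t0.
move: (decay_KL s t) (decay_KL s' t') => c c' cs [c'0 c's'] [c0 ccs].
have ss := ler_norm (s - s').
have rs : rho c <= rho s by exact: (Kinfty_le rhoK).
have rs0 : 0 <= rho c by exact: (Kinfty_ge0 rhoK).
have [cc|/ltW cc] := leP c c'.
  have : 0 <= `|t - t'| * rho s by rewrite mulr_ge0//; lra.
  have := normr_ge0 (s - s'); lra.
have : t' * rho c' <= t' * rho c.
  by rewrite ler_wpM2l//; exact: (Kinfty_le rhoK).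
have : (t' - t) * rho c <= `|t - t'| * rho s.
  rewrite (@le_trans _ _ (`|t - t'| * rho c))//.
    by rewrite ler_wpM2r// distrC ler_norm.
  by rewrite ler_wpM2l.
lra.
Qed.

Lemma classKL_decay : classKL decay_KL.
Proof.
have [r0 rlt rc rM] := rhoK; split.
- apply: (within_continuousP (W1 := (R * R)%type) (W2 := R)).
  move=> -[s t] /= [s0 t0] e e0.
  have rs0 : 0 <= rho (s + 1) by apply: (Kinfty_ge0 rhoK); rewrite addr_ge0.
  (* The bound 1 keeps [s'] below [s + 1], so that [rho (s + 1)] controls the Lipschitz constant in
     time for both points. *)
  pose d := Num.min 1 (Num.min (e / 2) (e / (rho (s + 1) + 1))).
  have d0 : 0 < d by rewrite !lt_min ltr01 !divr_gt0//= ltr_wpDl.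
  exists d => // -[s' t'] /= [s'0 t'0].
  rewrite prod_normE/= !gt_max => /andP[].
  rewrite !lt_min => /andP[s1 /andP[s2 _]] /andP[_ /andP[_ t3]].
  have le1 := decay_KL_dist s'0 t'0 s0 t0.
  have le2 := decay_KL_dist s0 t0 s'0 t'0.
  rewrite (distrC s) (distrC t) in le2.
  move: t3; rewrite ltr_pdivlMr ?ltr_wpDl// => t3.
  have ss := ler_norm (s' - s).
  have H u : 0 <= u -> u <= s + 1 -> `|t' - t| * rho u <= `|t' - t| * (rho (s +
    1) + 1).
    move=> u0 us; rewrite ler_wpM2l// (le_trans (Kinfty_le rhoK u0 us))//.
    by rewrite lerDl.
  have H1 := H s' s'0; have H2 := H s s0.
  rewrite ltr_norml; apply/andP; split.
    have := H2 (_ : s <= s + 1); rewrite lerDl => /(_ ler01); lra.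
  have := H1 (_ : s' <= s + 1); lra.
- move=> t t0; have dK := Kinfty_decay t; split.
  + exact: Kinv0.
  + by move=> s s0; exact: Kinv_ge0.
  + by move=> s s' s0 ss'; exact: Kinv_lt.
  + by apply: continuous_subspaceT; exact: Kinv_continuous.
- move=> s t1 t2 s0 t10 t12; have t20 := le_trans t10 t12.
  have [c0 cs] := decay_KL_eq s0 t20.
  apply: le_decay_KL => //; rewrite -[leRHS]cs lerD2l ler_pM2r ?invr_gt0//.
  by rewrite ler_wpM2r// (Kinfty_ge0 rhoK).
- move=> s s0; apply/cvgrPdist_lt => e e0.
  have re : 0 < rho e by rewrite -r0 rlt.
  (* A value at least [e] at time [t] would force t rho e <= 2 s. *)
  exists (2 * s / rho e); split; first exact: num_real.
  move=> t; rewrite ltr_pdivrMr// => st.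
  have t0 : 0 <= t.
    rewrite leNgt; apply/negP => tn; have : t * rho e <= 0 by rewrite
      nmulr_rle0// ltW.
    lra.
  have [c0 cs] := decay_KL_eq s0 t0.
  rewrite sub0r normrN ger0_norm// ltNge; apply/negP => ec.
  have : t * rho e <= t * rho (decay_KL s t).
    by rewrite ler_wpM2l//; apply: (Kinfty_le rhoK); first exact: ltW.
  lra.
Qed.

(** The level beyond which rho v >= 2 s, so that a perturbation [s] consumes at most half of the
    decay rate. *)
Definition gain_Koo (s : R) : R := Kinv rho (2 * s).

Lemma gain_Koo_continuous : continuous gain_Koo.
Proof.
move=> s; apply: (@continuous_comp R R R (fun s : R => 2 * s) (Kinv rho) s).
  by apply: cvgMr; exact: cvg_id.
exact: Kinv_continuous.
Qed.

Lemma classKoo_gain : classKoo gain_Koo.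
Proof.
split; first split.
- by rewrite /gain_Koo mulr0 Kinv0.
- by move=> s s0; exact: Kinv_ge0.
- by move=> s t s0 st; apply: Kinv_lt => //; [rewrite mulr_ge0|lra].
- by apply: continuous_subspaceT; exact: gain_Koo_continuous.
- apply/cvgryPge => A; have [s s0 sP] := Kinv_unbounded rhoK A.
  exists s; split; first exact: num_real.
  by move=> t st; apply: sP; lra.
Qed.

End decay.

(** * Scalar differential inequalities *)

Lemma has_derivN {R : realType} {W : normedModType R} (x : R -> W) (t : R) v :
  has_deriv x t v -> has_deriv (fun s => - x s) t (- v).
Proof.
move=> xv e e0; have [d d0 dP] := xv e e0; exists d => // s /dP.
by rewrite scalerN -!opprD normrN.
Qed.

Lemma ac_ge_slope {R : realType} (a b c : R) (x : R -> R) :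
  a <= b -> abs_continuous a b x ->
  {ae (@lebesgue_measure R), forall t : R, a < t -> t < b ->
    exists2 v, has_deriv x t v & c <= v} ->
  c * (b - a) <= x b - x a.
Proof.
move=> ab ac xc.
have acN : abs_continuous a b (fun u => - x u).
  apply: (ac_lipschitz_comp ler01 ac) => u u' _ _.
  by rewrite mul1r -opprD normrN.
have := ac_le_slope (c := - c) ab acN; rewrite mulNr.
suff H : {ae (@lebesgue_measure R), forall t : R, a < t -> t < b ->
    exists2 v, has_deriv (fun u => - x u) t v & v <= - c}.
  by move=> /(_ H); lra.
apply: ae_imply xc => t Ht at_ tb; have [v xv cv] := Ht at_ tb.
by exists (- v); [exact: has_derivN|rewrite lerN2].
Qed.

Lemma has_deriv_subc {R : realType} (x : R -> R) (c t v : R) :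
  has_deriv x t v -> has_deriv (fun s => x s - c) t v.
Proof.
move=> xv e e0; have [d d0 dP] := xv e e0; exists d => // s /dP.
by rewrite (_ : x s - c - (x t - c) = x s - x t); last by lra.
Qed.

Lemma has_deriv_addM {R : realType} (x y : R -> R) (k t v w : R) :
  has_deriv x t v -> has_deriv y t w ->
  has_deriv (fun s => x s + k * y s) t (v + k * w).
Proof.
move=> xv yw e e0; have k0 : 0 < `|k| + 1 by rewrite ltr_wpDl.
have [|d1 d10 d1P] := xv (e / 2); first by lra.
have [|d2 d20 d2P] := yw (e / 2 / (`|k| + 1)); first by rewrite !divr_gt0.
exists (Num.min d1 d2) => [|s]; first by rewrite lt_min d10.
rewrite lt_min => /andP[/d1P X /d2P Y]; rewrite /GRing.scale/= in X Y *.
have -> : x s + k * y s - (x t + k * y t) - (s - t) * (v + k * w) =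
  (x s - x t - (s - t) * v) + k * (y s - y t - (s - t) * w) by ring.
rewrite (le_trans (ler_normD _ _))// normrM.
have : `|k| * `|y s - y t - (s - t) * w| <= (`|k| + 1) * (e / 2 / (`|k| + 1) *
  `|s - t|).
  by apply: ler_pM => //; rewrite lerDl.
rewrite mulrA mulrCA divff ?mulr1 ?gt_eqF//; lra.
Qed.

Lemma has_deriv_sqr_pos_part_sub {R : realType} (x : R -> R) (c t v : R) :
  has_deriv x t v ->
  has_deriv (fun s => pos_part (x s - c) ^+ 2) t (2 * pos_part (x t - c) * v).
Proof.
move=> /(has_deriv_subc c) xv.
exact: (@has_deriv_comp R R R (fun u : R => pos_part u ^+ 2) (fun s => x s - c)
  t v _ (has_frechet_real (has_deriv_sqr_pos_part (x t - c))) xv).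
Qed.

Lemma ac_sqr_pos_part {R : realType} (a b c : R) (x : R -> R) :
  abs_continuous a b x ->
  abs_continuous a b (fun s => pos_part (x s - c) ^+ 2).
Proof.
apply: (ac_lip_on_balls (F := fun u : R => pos_part (u - c) ^+ 2)).
apply: lip_on_ballsX; apply: (lip_on_balls_comp (F := fun u : R => u - c)).
  by apply: (@lip_on_balls_lip _ _ _ _ 1) => // x1 x2;
     rewrite mul1r opprB addrA subrK.
exact: lip_on_balls_pos_part.
Qed.

(** The squared positive part of x - c is differentiable wherever [x] is, with nonpositive
    derivative. This replaces a first-crossing argument, ill suited to inequalities that hold almost
    everywhere. *)
Lemma barrier {R : realType} (a b c : R) (x : R -> R) : a <= b ->
  abs_continuous a b x ->
  {ae (@lebesgue_measure R), forall t : R, a < t -> t < b ->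
    exists2 v, has_deriv x t v & c < x t -> v <= 0} ->
  x b <= Num.max c (x a).
Proof.
move=> ab ac xc.
have /ac_le_slope -/(_ 0 ab) H := ac_sqr_pos_part c ac.
have : pos_part (x b - c) ^+ 2 <= pos_part (x a - c) ^+ 2.
  rewrite -subr_le0; apply: (le_trans (H _)); last by rewrite mul0r.
  apply: ae_imply xc => t Ht at_ tb; have [v xv vc] := Ht at_ tb.
  exists (2 * pos_part (x t - c) * v); first exact: has_deriv_sqr_pos_part_sub.
  have [cx|xc] := ltP c (x t); last by rewrite pos_part_eq0 ?mulr0 ?mul0r//
    subr_le0.
  by rewrite mulr_ge0_le0 ?vc// mulr_ge0// pos_part_ge0.
rewrite ler_sqr ?nnegrE ?pos_part_ge0// => le.
rewrite le_max; move: le; rewrite /pos_part.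
by case: (leP (x b - c) 0); case: (leP (x a - c) 0) => ? ? ?;
  apply/orP; solve [left; lra | right; lra].
Qed.

(** If [v T] exceeds the level [c], the barrier started at any earlier time shows v >= v T > c on
    the whole interval. There half of [rho] absorbs [chi0] and the rate is at most the constant -
    rho (v T) / 2; integrating it gives the inequality that [le_decay_KL] expects. *)
Lemma decay_estimate {R : realType} (rho v : R -> R) (T chi0 : R) :
  Kinfty rho -> 0 <= T -> 0 <= chi0 -> (forall t, 0 <= v t) ->
  abs_continuous 0 T v ->
  {ae (@lebesgue_measure R), forall t : R, 0 < t -> t < T ->
    exists2 w, has_deriv v t w & w <= - rho (v t) + chi0} ->
  v T <= decay_KL rho (v 0) T + gain_Koo rho chi0.
Proof.
move=> rhoK T0 chi0_ge0 v0 ac vw; set c := gain_Koo rho chi0.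
have c0 : 0 <= c by exact: Kinv_ge0.
have rc : rho c = 2 * chi0 by rewrite /c /gain_Koo KinvK// mulr_ge0.
have [d0 _] := decay_KL_eq rhoK (v0 0) T0.
have [vc|cv] := leP (v T) c; first by rewrite (le_trans vc)// lerDr.
have vT s : 0 <= s -> s <= T -> v T <= v s.
  move=> s0 sT.
  have : v T <= Num.max c (v s).
    apply: barrier => //; first exact: ac_subitv ac.
    apply: ae_imply vw => t Ht st tT.
    have [|w vtw wle] := Ht _ tT; first exact: le_lt_trans st.
    exists w => // cvt; have : rho c <= rho (v t).
      by apply: (Kinfty_le rhoK) => //; exact: ltW.
    lra.
  by rewrite le_max leNgt cv.
rewrite -[leLHS]addr0 lerD//; apply: le_decay_KL => //.
have : v T - v 0 <= (- rho (v T) / 2) * (T - 0).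
  apply: ac_le_slope => //; apply: ae_imply vw => t Ht t0 tT.
  have [w vtw wle] := Ht t0 tT; exists w => //.
  have vTt := vT t (ltW t0) (ltW tT).
  have : rho (v T) <= rho (v t) by exact: (Kinfty_le rhoK).
  have : rho c <= rho (v t).
    by apply: (Kinfty_le rhoK) => //; exact: le_trans (ltW cv) vTt.
  lra.
lra.
Qed.

(* Once [E >= Es], [E + G / (2 eta) * ((v - eps)^+)^2] no longer increases. *)
Lemma adaptation_bound {R : realType} (E v : R -> R) (T G eps eta Es B : R) :
  0 <= T -> 0 <= G -> 0 < eta -> (forall t, 0 <= t -> t <= T -> 0 <= v t <= B)
    ->
  0 <= eps ->
  abs_continuous 0 T E -> abs_continuous 0 T v ->
  {ae (@lebesgue_measure R), forall t : R, 0 < t -> t < T ->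
    exists w, [/\ has_deriv v t w, has_deriv E t (G * pos_part (v t - eps)) &
      Es <= E t -> eps < v t -> w <= - eta]} ->
  E T <= Num.max (E 0) Es + G / (2 * eta) * B ^+ 2.
Proof.
move=> T0 G0 eta0 vB eps0 acE acv H.
have eta2 : 0 < 2 * eta by rewrite mulr_gt0.
set k := G / (2 * eta).
have k0 : 0 <= k by rewrite divr_ge0// ltW.
have B2 : 0 <= k * B ^+ 2 by rewrite mulr_ge0// sqr_ge0.
have mono s t : 0 <= s -> s <= t -> t <= T -> E s <= E t.
  move=> s0 st tT; rewrite -subr_ge0 -(mul0r (t - s)).
  apply: (ac_ge_slope st (ac_subitv s0 tT acE));
    apply: ae_imply H => u Hu su ut.
  have [||w [_ Ew _]] := Hu; [exact: le_lt_trans su|exact: lt_le_trans tT|].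
  by exists (G * pos_part (v u - eps)); rewrite // mulr_ge0// pos_part_ge0.
have [EsT|TEs] := leP (E T) Es.
  by rewrite (le_trans EsT)// (@le_trans _ _ (Num.max (E 0) Es))// ?lerDl//
    le_max lexx orbT.
(* From [t1] on, [E >= Es]: it is the origin, or a time where [E] takes the value [Es]. *)
have [t1 [t10 t1T Et1 Est1]] : exists t1, [/\ 0 <= t1, t1 <= T,
    E t1 <= Num.max (E 0) Es & Es <= E t1].
  have [E0|E0] := leP Es (E 0).
    by exists 0; split => //; rewrite le_max lexx.
  have [|t1] := IVT T0 (ac_continuous acE) (v := Es).
    by rewrite ge_min le_max (ltW E0) (ltW TEs) orbT.
  rewrite in_itv/= => /andP[t10 t1T] Et1; exists t1; rewrite Et1.
  by split => //; rewrite le_max lexx orbT.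
have acW : abs_continuous t1 T (fun s => E s + k * pos_part (v s - eps) ^+ 2).
  apply: (ac_dominated (K := 1 + k) _ (ac_subitv t10 (lexx T) acE)
    (ac_subitv t10 (lexx T) (ac_sqr_pos_part eps acv)));
      first by rewrite addr_ge0.
  move=> s t _ _; set p := fun s => pos_part (v s - eps) ^+ 2.
  have -> : E t + k * p t - (E s + k * p s) = (E t - E s) + k * (p t - p s) by
    ring.
  rewrite (le_trans (ler_normD _ _))// normrM (ger0_norm k0).
  have := normr_ge0 (E t - E s); have := normr_ge0 (p t - p s); nra.
have := ac_le_slope (c := 0) t1T acW; rewrite mul0r subr_le0 => W.
have {W} : E T + k * pos_part (v T - eps) ^+ 2 <=
    E t1 + k * pos_part (v t1 - eps) ^+ 2.
  apply: W; apply: ae_imply H => t Ht t1t tT.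
  have t0 : 0 < t by exact: le_lt_trans t1t.
  have [w [vw Ew wle]] := Ht t0 tT.
  exists (G * pos_part (v t - eps) + k * (2 * pos_part (v t - eps) * w)).
    exact: has_deriv_addM Ew (has_deriv_sqr_pos_part_sub eps vw).
  have Et : Es <= E t by rewrite (le_trans Est1)// mono// ltW.
  have [ev|ve] := ltP eps (v t); last first.
    by rewrite pos_part_eq0 ?subr_le0// !(mul0r, mulr0) addr0.
  have {}wle := wle Et ev; have := pos_part_ge0 (v t - eps).
  move: (pos_part _) => P P0.
  (* The weight [k] is tuned to this cancellation: the growth G P of [E] is offset by 2 k P w once w
     <= - eta. *)
  have -> : G = k * (2 * eta) by rewrite /k divfK// gt_eqF.
  have : 0 <= k * P * (- eta - w) by apply: mulr_ge0; [exact: mulr_ge0|lra].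
  lra.
have : k * pos_part (v t1 - eps) ^+ 2 <= k * B ^+ 2.
  have /andP[v1 v2] := vB t1 t10 t1T.
  rewrite ler_wpM2l// ler_sqr ?nnegrE ?pos_part_ge0//;
    last exact: le_trans v1 v2.
  rewrite /pos_part; case: (leP (v t1 - eps) 0) => ?; lra.
have : 0 <= k * pos_part (v T - eps) ^+ 2 by rewrite mulr_ge0// sqr_ge0.
lra.
Qed.

(** * The Lyapunov inequality *)

Lemma cauchy_schwarz {R : realType} {k : nat} (x y : 'cV[R]_k) :
  `|(x^T *m y) ord0 ord0| <= enorm x * enorm y.
Proof.
pose X := \sum_(i < k) x i ord0 ^+ 2; pose Y := \sum_(i < k) y i ord0 ^+ 2.
pose P := \sum_(i < k) x i ord0 * y i ord0.
have -> : (x^T *m y) ord0 ord0 = P.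
  by rewrite mxE; apply: eq_bigr => i _; rewrite mxE.
have X0 : 0 <= X by apply: sumr_ge0 => i _; exact: sqr_ge0.
have Y0 : 0 <= Y by apply: sumr_ge0 => i _; exact: sqr_ge0.
have H a b : 0 <= a ^+ 2 * X - 2 * (a * b) * P + b ^+ 2 * Y.
  have -> : a ^+ 2 * X - 2 * (a * b) * P + b ^+ 2 * Y =
      \sum_(i < k) (a * x i ord0 - b * y i ord0) ^+ 2.
    rewrite !mulr_sumr -sumrB -big_split/=.
    by apply: eq_bigr => i _; ring.
  by apply: sumr_ge0 => i _; exact: sqr_ge0.
have PXY : P ^+ 2 <= X * Y.
  have [Y0'|Y0'] := eqVneq Y 0.
    (* With a = P, b = (X + 1) / 2 and Y = 0 the quadratic form equals - P^2. *)
    have := H P ((X + 1) / 2); rewrite Y0' => HP.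
    by have : P ^+ 2 = 0; [apply/eqP; rewrite eq_le sqr_ge0 andbT;
      nra|move=> ->; rewrite mulr0].
  have {}Y0' : 0 < Y by rewrite lt_neqAle eq_sym Y0'.
  (* With a = Y and b = P the quadratic form equals Y (X Y - P^2). *)
  have := H Y P; rewrite -subr_ge0 => HP.
  have : 0 <= Y * (X * Y - P ^+ 2) by lra.
  by rewrite pmulr_rge0// subr_ge0.
rewrite /enorm -/X -/Y -sqrtrM// -sqrtr_sqr ler_sqrt//.
by rewrite mulr_ge0.
Qed.

Lemma enorm_ge0 {R : realType} {k : nat} (x : 'cV[R]_k) : 0 <= enorm x.
Proof. exact: sqrtr_ge0. Qed.

Lemma enorm_sqr {R : realType} {k : nat} (x : 'cV[R]_k) :
  enorm x ^+ 2 = \sum_(i < k) x i ord0 ^+ 2.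
Proof. by rewrite /enorm sqr_sqrtr// sumr_ge0// => i _; exact: sqr_ge0. Qed.

(* Young's inequality with weight [a]; the constants of [gainr] and [chi] all
   come from it, with [a = C * (kappa + exp z)]. *)
Lemma young {R : realType} (a x y : R) : 0 < a ->
  x * y <= a * x ^+ 2 + y ^+ 2 / (4 * a).
Proof.
move=> a0; have : 0 <= (2 * a * x - y) ^+ 2 / (4 * a).
  by rewrite divr_ge0 ?sqr_ge0// mulr_ge0// ltW.
have -> : (2 * a * x - y) ^+ 2 / (4 * a) = a * x ^+ 2 + y ^+ 2 / (4 * a) - x *
  y.
  by field; rewrite gt_eqF.
by rewrite subr_ge0.
Qed.

(* Nothing is needed when [beta * w >= 1]; otherwise
   [1 - beta * w = beta * (1/beta - w)^+]. *)
Lemma absorb {R : realType} (a w beta S : R) : 0 < a -> 0 < beta -> 0 <= S ->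
  S - beta * (a * S ^+ 2 + w * S) <=
    beta * pos_part (beta^-1 - w) ^+ 2 / (4 * a).
Proof.
move=> a0 b0 S0.
have [wb|bw] := leP w beta^-1; last first.
  have bw1 : 1 <= beta * w by rewrite mulrC -ler_pdivrMr// mul1r ltW.
  have : 0 <= beta * pos_part (beta^-1 - w) ^+ 2 / (4 * a).
    apply: divr_ge0; last by rewrite mulr_ge0// ltW.
    by rewrite mulr_ge0 ?sqr_ge0// ltW.
  have : 0 <= beta * a * S ^+ 2 by rewrite mulr_ge0 ?sqr_ge0// mulr_ge0// ltW.
  have : 0 <= (beta * w - 1) * S by rewrite mulr_ge0// subr_ge0.
  lra.
rewrite pos_part_id ?subr_ge0//.
have := young S (beta^-1 - w) a0; rewrite -(ler_pM2l b0).
have -> : beta * (S * (beta^-1 - w)) = S - beta * (w * S).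
  by rewrite mulrBr mulrBr mulrCA divff ?gt_eqF// mulr1 (mulrC S w).
rewrite -(mulrA beta (_ ^+ 2)); lra.
Qed.

(** Young's inequality with weight [a] turns the sigma, theta and d terms into a P L^2 plus squares
    over 4 a, theta using two of the four summands of [P]. The feedback contributes - b r L^2 with r
    L^2 = (a S1^2 + w S1) + (a S2^2 + w S2), and [absorb] is applied once to S1 = s L^2 and once to
    S2 = a P L^2. *)
Lemma channel_bound {R : realType} (C w mu sigma delta s L D Th beta b phin An
    pt Ad P : R) : 0 < C -> 0 < w -> 0 < mu -> 0 <= s -> 0 < beta ->
  beta <= b -> 0 <= phin -> 0 <= An -> 0 <= D ->
  `|pt| <= phin * Th -> `|Ad| <= An * D ->
  P = phin ^+ 2 + An ^+ 2 + w ^+ 2 * mu + delta ^+ 2 ->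
  sigma * (delta * L) + s * L ^+ 2 +
    (b * (- (C * w * s ^+ 2 * L ^+ 2 + w * s + C ^+ 3 * w ^+ 3 * P ^+ 2 * L ^+ 2
            + C * w ^+ 2 * P) * L) + pt + Ad) * L <=
  (D ^+ 2 + sigma ^+ 2 + pos_part (Th - w) ^+ 2 +
    2 * beta * pos_part (beta^-1 - w) ^+ 2 + phin ^+ 2 / mu) / (4 * C * w).
Proof.
move=> C0 w0 mu0 s0 beta0 beta_b ph0 An0 D0 ptle Adle PE.
set a := C * w; have a0 : 0 < a by rewrite mulr_gt0.
have -> : 4 * C * w = 4 * a by rewrite /a mulrA.
set X := pos_part (beta^-1 - w); set T := pos_part (Th - w).
have T0 : 0 <= T by exact: pos_part_ge0.
have ThT : Th <= T + w.
  by rewrite /T /pos_part; case: (leP (Th - w) 0) => ?; lra.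
have P0 : 0 <= P.
  by rewrite PE !addr_ge0 ?sqr_ge0// mulr_ge0 ?sqr_ge0// ltW.
pose K := (4 * a)^-1.
have Y1 : sigma * (delta * L) <= a * (delta ^+ 2 * L ^+ 2) + sigma ^+ 2 * K.
  by have := young (delta * L) sigma a0; rewrite exprMn mulrC.
have Y2 : Ad * L <= a * (An ^+ 2 * L ^+ 2) + D ^+ 2 * K.
  have := young (An * `|L|) D a0; rewrite exprMn real_normK ?num_real//.
  apply: le_trans; rewrite (le_trans (ler_norm _))// normrM mulrAC.
  by rewrite ler_wpM2r.
(* As Th <= T + w, the theta term splits: the excess T is handled with weight a, the part w with
   weight a mu, which leaves phin^2 / mu for assumption (B). *)
have Y3 : pt * L <= a * (phin ^+ 2 * L ^+ 2) + T ^+ 2 * K +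
    (a * (w ^+ 2 * mu * L ^+ 2) + phin ^+ 2 / mu * K).
  have A1 := young (phin * `|L|) T a0; rewrite exprMn real_normK ?num_real//
    -/K in A1.
  have am : 0 < a * mu by rewrite mulr_gt0.
  have A2 := young (w * `|L|) phin am; rewrite exprMn real_normK ?num_real// in
    A2.
  have -> : phin ^+ 2 / mu * K = phin ^+ 2 / (4 * (a * mu)).
    by rewrite /K; field; rewrite !gt_eqF.
  have : pt * L <= phin * (T + w) * `|L|.
    rewrite (le_trans (ler_norm _))// normrM ler_wpM2r// (le_trans ptle)//.
    by rewrite ler_wpM2l.
  lra.
pose S1 := s * L ^+ 2; pose S2 := a * (P * L ^+ 2).
have S10 : 0 <= S1 by rewrite mulr_ge0// sqr_ge0.
have S20 : 0 <= S2 by rewrite mulr_ge0 ?(ltW a0)// mulr_ge0// sqr_ge0.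
have Z1 := absorb w a0 beta0 S10; have Z2 := absorb w a0 beta0 S20.
rewrite -/X in Z1 Z2.
set r := (C * w * _ ^+ 2 * _ + _ + _ + _).
have rE : r * L ^+ 2 = (a * S1 ^+ 2 + w * S1) + (a * S2 ^+ 2 + w * S2).
  by rewrite /r /S1 /S2 /a; ring.
(* This sign lets the unknown gain [b] be replaced by its lower bound [beta]. *)
have r0 : 0 <= r * L ^+ 2.
  have q1 : 0 <= a * S1 ^+ 2 by rewrite mulr_ge0 ?sqr_ge0// ltW.
  have q2 : 0 <= a * S2 ^+ 2 by rewrite mulr_ge0 ?sqr_ge0// ltW.
  have q3 : 0 <= w * S1 by rewrite mulr_ge0// ltW.
  have q4 : 0 <= w * S2 by rewrite mulr_ge0// ltW.
  by rewrite rE; lra.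
have br : beta * (r * L ^+ 2) <= b * (r * L ^+ 2) by rewrite ler_wpM2r.
have S2E : S2 = a * (phin ^+ 2 * L ^+ 2) + a * (An ^+ 2 * L ^+ 2) +
    a * (w ^+ 2 * mu * L ^+ 2) + a * (delta ^+ 2 * L ^+ 2).
  by rewrite /S2 PE; ring.
have -> : (b * (- r * L) + pt + Ad) * L = - (b * (r * L ^+ 2)) + pt * L + Ad *
  L.
  by ring.
rewrite -/S1.
rewrite -/K in Z1 Z2 *.
rewrite rE in br *.
lra.
Qed.

Lemma chi_ge0 {R : realType} (m : nat) (sigma C kappa Lambda s1 s2 s3 s4 : R) :
  0 < C -> 0 < kappa -> 0 <= Lambda -> 0 < s3 -> 0 <= s4 ->
  0 <= chi m sigma C kappa Lambda s1 s2 s3 s4.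
Proof.
move=> C0 k0 L0 s30 s40; apply: divr_ge0; last first.
  by apply: mulr_ge0; [rewrite mulr_ge0// ltW|lra].
by do ?[exact: sqr_ge0|exact: ltW|apply: addr_ge0 => //|apply: mulr_ge0 => //].
Qed.

Lemma chi_anti {R : realType} (m : nat)
    (sigma C kappa Lambda s1 s2 s3 s4 s4' : R) :
  0 < C -> 0 < kappa -> 0 <= Lambda -> 0 < s3 -> 0 <= s4 -> s4 <= s4' ->
  chi m sigma C kappa Lambda s1 s2 s3 s4' <= chi m sigma C kappa Lambda s1 s2
    s3 s4.
Proof.
move=> C0 k0 L0 s30 s40 s44.
have pp (u : R) : pos_part (u - kappa - s4') ^+ 2 <= pos_part (u - kappa - s4)
  ^+ 2.
  by rewrite ler_sqr ?nnegrE ?pos_part_ge0// pos_part_mono//; lra.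
apply: ler_pM.
- by do ?[exact: sqr_ge0|exact: ltW|apply: addr_ge0 => //|apply: mulr_ge0 =>
  //].
- by rewrite invr_ge0; apply: mulr_ge0; [rewrite mulr_ge0// ltW|lra].
- rewrite lerD//; last by rewrite ler_wpM2l// mulr_ge0// ltW.
  by rewrite lerD2r lerD2l ler_wpM2l.
- have p1 : 0 < 4 * C by rewrite mulr_gt0.
  have p2 : 0 < kappa + s4 by lra.
  have p3 : 0 < kappa + s4' by lra.
  by rewrite lef_pV2 ?posrE ?mulr_gt0// ler_pM2l// lerD2l.
Qed.

(* An upper bound of the numerator of [chi] which is continuous in the data and
   does not depend on [s4]. *)
Definition chi_num {R : realType} (m : nat)
    (sigma C kappa Lambda s1 s2 s3 : R) : R :=
  m%:R * s1 ^+ 2 + m%:R * sigma ^+ 2 + m%:R * s2 ^+ 2 + 2 * C * kappa * Lambda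
  + 2 * m%:R * s3^-1.

Lemma chi_num_ge0 {R : realType} (m : nat) (sigma C kappa Lambda s1 s2 s3 : R) :
  0 < C -> 0 < kappa -> 0 <= Lambda -> 0 < s3 ->
  0 <= chi_num m sigma C kappa Lambda s1 s2 s3.
Proof.
move=> C0 k0 L0 s30.
by do ?[exact: sqr_ge0|exact: ltW|apply: addr_ge0 => //|apply: mulr_ge0 =>
  //|rewrite invr_ge0].
Qed.

Lemma chi_le {R : realType} (m : nat) (sigma C kappa Lambda s1 s2 s3 s4 : R) :
  0 < C -> 0 < kappa -> 0 <= Lambda -> 0 <= s2 -> 0 < s3 -> 0 <= s4 ->
  chi m sigma C kappa Lambda s1 s2 s3 s4 <=
    chi_num m sigma C kappa Lambda s1 s2 s3 / (4 * C * (kappa + s4)).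
Proof.
move=> C0 k0 L0 s20 s30 s40.
have pp (u : R) : 0 <= u -> pos_part (u - kappa - s4) ^+ 2 <= u ^+ 2.
  move=> u0; rewrite ler_sqr ?nnegrE ?pos_part_ge0//.
  by rewrite -[leRHS]pos_part_id// pos_part_mono//; lra.
rewrite ler_wpM2r//.
  by rewrite invr_ge0; apply: mulr_ge0; [rewrite mulr_ge0// ltW|lra].
rewrite lerD//; first by rewrite lerD2r lerD2l ler_wpM2l// pp.
rewrite -mulrA ler_wpM2l ?mulr_ge0//.
have := pp _ (_ : 0 <= s3^-1); rewrite invr_ge0 => /(_ (ltW s30)).
move=> H; apply: (@le_trans _ _ (s3 * s3^-1 ^+ 2)); first by rewrite ler_pM2l.
by rewrite expr2 mulrA divff ?mul1r// gt_eqF.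
Qed.

Lemma lyapunov_rate {R : realType} {n m p q : nat}
    (f : 'cV[R]_n -> 'cV[R]_n) (g : 'I_m -> 'cV[R]_n -> 'cV[R]_n)
    (phi : 'I_m -> 'cV[R]_n -> 'cV[R]_p) (A : 'I_m -> 'cV[R]_n -> 'cV[R]_q)
    (V Q mu : 'cV[R]_n -> R) (s delta : 'I_m -> 'cV[R]_n -> R)
    (sigma Lambda C kappa : R)
    (y : 'cV[R]_n) (z : R) (b : 'cV[R]_m) (theta : 'cV[R]_p) (d : 'cV[R]_q)
    (D Th beta : R) :
  0 <= Q y -> (forall i, 0 <= s i y) ->
  lie V f y <= - Q y + sigma * (\sum_(i < m) delta i y * lie V (g i) y)
               + \sum_(i < m) s i y * lie V (g i) y ^+ 2 ->
  0 < mu y -> 0 <= Lambda ->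
  \sum_(i < m) enorm (phi i y) ^+ 2 <= mu y * (Q y + Lambda) ->
  0 < C -> 0 < kappa -> 1 <= 2 * C * kappa ->
  0 < beta -> (forall i, beta <= b i ord0) -> enorm theta <= Th ->
  enorm d <= D ->
  (grad V y *m ydot f g phi A
     (fun i => feedback C kappa V (g i) (phi i) (A i) mu (delta i) (s i) y z)
     b theta d y) ord0 ord0
  <= - Q y / 2 + chi m sigma C kappa Lambda D Th beta (expR z).
Proof.
move=> Q0 s0 hA mu0 L0 hB C0 k0 Ck beta0 bb thT dD.
set w := kappa + expR z.
have e0 := expR_gt0 z.
have w0 : 0 < w by rewrite addr_gt0.
set T := pos_part (Th - w); set X := pos_part (beta^-1 - w).
pose K := (4 * C * w)^-1.
have Cw : 0 < 4 * C * w by rewrite !mulr_gt0.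
have K0 : 0 < K by rewrite invr_gt0.
set u := fun i => _.
pose c i := b i ord0 * u i + ((phi i y)^T *m theta) ord0 ord0
     + ((A i y)^T *m d) ord0 ord0.
have -> : (grad V y *m ydot f g phi A u b theta d y) ord0 ord0 =
    lie V f y + \sum_(i < m) c i * lie V (g i) y.
  rewrite /ydot mulmxDr mulmx_sumr mxE summxE; congr (_ + _).
  by apply: eq_bigr => i _; rewrite -scalemxAr mxE.
have chan i : sigma * (delta i y * lie V (g i) y) + s i y * lie V (g i) y ^+ 2 +
    c i * lie V (g i) y <=
    (D ^+ 2 + sigma ^+ 2 + T ^+ 2 + 2 * beta * X ^+ 2) * K +
    K / mu y * enorm (phi i y) ^+ 2.
  have := @channel_bound _ C w (mu y) sigma (delta i y) (s i y)
    (lie V (g i) y) D Th beta (b i ord0) (enorm (phi i y)) (enorm (A i y))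
    (((phi i y)^T *m theta) ord0 ord0) (((A i y)^T *m d) ord0 ord0)
    (gainP kappa (phi i) (A i) mu (delta i) y z) C0 w0 mu0 (s0 i) beta0 (bb i)
    (enorm_ge0 _) (enorm_ge0 _) (le_trans (enorm_ge0 _) dD) _ _ (erefl _).
  rewrite /c /u /feedback /gainr -/w -/T -/X -/K => H.
  apply: le_trans (H _ _) _.
  - by rewrite (le_trans (cauchy_schwarz _ _))// ler_wpM2l ?enorm_ge0.
  - by rewrite (le_trans (cauchy_schwarz _ _))// ler_wpM2l ?enorm_ge0.
  - by lra.
have := ler_sum (index_enum _) (P := xpredT) (fun i _ => chan i).
rewrite !big_split/= -!mulr_sumr sumr_const card_ord -[_ *+ m]mulr_natl => S.
have B1 : K / mu y * (\sum_(i < m) enorm (phi i y) ^+ 2) <= K * (Q y + Lambda).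
  by rewrite -mulrA ler_pM2l// mulrC ler_pdivrMr// mulrC.
(* The condition 2 C kappa >= 1 acts twice: 4 C w >= 2, so theta consumes at most half of Q, and
   Lambda is majorised by 2 C kappa Lambda, the form it has in [chi]. *)
have K2 : K <= 1 / 2.
  rewrite div1r /K lef_pV2 ?posrE//.
  have : 4 * C * kappa <= 4 * C * w by rewrite ler_pM2l ?mulr_gt0// lerDl ltW.
  lra.
have KQ : K * Q y <= 1 / 2 * Q y by rewrite ler_wpM2r.
have KL : K * Lambda <= K * (2 * C * kappa * Lambda).
  by rewrite ler_pM2l// ler_peMl.
rewrite /chi -/K -!addrA -!opprD -/w -/T -/X.
lra.
Qed.

(** * Caratheodory differential equations *)

Lemma subrACA {G : zmodType} (a b c d : G) :
  a - b - (c - d) = a - c - (b - d).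
Proof. by rewrite !opprD addrACA. Qed.

Lemma le_add_geometric {R : realType} (a b c : R) :
  (forall k, a <= b + c / 2 ^+ k) -> a <= b.
Proof.
move=> H; apply/ler_addgt0Pr => e e0.
have [k kP] : exists k, `|c| / 2 ^+ k < e.
  exists (Num.bound (`|c| / e)).
  have := archi_boundP (divr_ge0 (normr_ge0 c) (ltW e0)).
  set k := Num.bound _ => ck.
  rewrite ltr_pdivrMr ?exprn_gt0// mulrC -ltr_pdivrMr//.
  apply: lt_le_trans ck _; rewrite -natrX ler_nat ltnW// ltn_expl//.
apply: (le_trans (H k)); rewrite lerD2l ltW// (le_lt_trans _ kP)//.
by rewrite ler_wpM2r ?invr_ge0 ?exprn_ge0// ler_norm.
Qed.

(** Completeness with an explicit rate, in the form Picard iteration uses; it passes from the reals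
    to columns and pairs coordinatewise. *)
Definition geo_complete {R : realType} (W : normedModType R) : Prop :=
  forall (u : nat -> W) (A : R),
    (forall k, `|u k.+1 - u k| <= A / 2 ^+ k) ->
    exists l, forall k, `|u k - l| <= 2 * A / 2 ^+ k.

(** The radii w k = 2 A / 2^k decrease by exactly A / 2^k, so the intervals [u k - w k, u k + w k]
    are nested and the supremum of their left ends lies in all of them. *)
Lemma geo_complete_real {R : realType} : geo_complete (R : normedModType R).
Proof.
move=> u A uA; pose w k := 2 * A / 2 ^+ k.
have wS k : w k.+1 = w k - A / 2 ^+ k.
  by rewrite /w exprS; field; rewrite expf_neq0.
have step k : u k - w k <= u k.+1 - w k.+1 /\ u k.+1 + w k.+1 <= u k + w k.
  by have := uA k; rewrite ler_norml wS; lra.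
have incr j k : (j <= k)%N -> u j - w j <= u k - w k /\ u k + w k <= u j + w j.
  elim: k => [|k IH]; first by rewrite leqn0 => /eqP ->.
  rewrite leq_eqVlt ltnS => /predU1P[->//|/IH[h1 h2]].
  by have [h3 h4] := step k; split; lra.
have A0 : 0 <= A by have := uA 0%N; rewrite expr0 divr1; exact: le_trans.
have w0 k : 0 <= w k by rewrite divr_ge0 ?exprn_ge0// mulr_ge0.
have ub j k : u j - w j <= u k + w k.
  have [/incr[h1 h2]|/ltnW/incr[h1 h2]] := leqP j k.
    by have := w0 k; lra.
  by have := w0 j; lra.
pose E := [set u k - w k | k in setT].
have supE : has_sup E.
  split; first by exists (u 0%N - w 0%N), 0%N.
  by exists (u 0%N + w 0%N) => _ [k _ <-].
exists (sup E) => k; rewrite ler_norml -/(w k).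
have : u k - w k <= sup E by apply: sup_upper_bound => //; exists k.
have : sup E <= u k + w k.
  by apply: ge_sup; [exact: supE.1 | move=> _ [j _ <-]].
lra.
Qed.

Lemma geo_complete_cV {R : realType} (n : nat) :
  geo_complete ('cV[R]_n : normedModType R).
Proof.
move=> u A uA.
have A0 : 0 <= A by have := uA 0%N; rewrite expr0 divr1; exact: le_trans.
have H i : exists l, forall k, `|u k i ord0 - l| <= 2 * A / 2 ^+ k.
  apply: (@geo_complete_real R (fun k => u k i ord0)) => k.
  by apply: le_trans (uA k); have := coord_le_norm (u k.+1 - u k) i ord0;
    rewrite !mxE.
have [l lP] := choice H.
exists (\col_i l i) => k; apply: norm_le_coord => [|i j].
  by rewrite divr_ge0 ?exprn_ge0// mulr_ge0.
by rewrite (ord1 j) !mxE; exact: lP.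
Qed.

Lemma geo_complete_prod {R : realType} (W1 W2 : normedModType R) :
  geo_complete W1 -> geo_complete W2 ->
  geo_complete ((W1 * W2)%type : normedModType R).
Proof.
move=> c1 c2 u A uA.
have [l1 l1P] : exists l, forall k, `|(u k).1 - l| <= 2 * A / 2 ^+ k.
  by apply: c1 => k; apply: le_trans (uA k); rewrite prod_normE le_max lexx.
have [l2 l2P] : exists l, forall k, `|(u k).2 - l| <= 2 * A / 2 ^+ k.
  by apply: c2 => k; apply: le_trans (uA k); rewrite prod_normE le_max lexx
    orbT.
by exists (l1, l2) => k; rewrite prod_normE ge_max/= l1P l2P.
Qed.

Lemma acB {R : realType} {W : normedModType R} (a b : R) (x y : R -> W) :
  abs_continuous a b x -> abs_continuous a b y ->
  abs_continuous a b (fun t => x t - y t).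
Proof.
move=> acx acy; apply: (ac_dominated ler01 acx acy) => s t _ _.
by rewrite mul1r subrACA ler_normB.
Qed.

Lemma has_derivB {R : realType} {W : normedModType R} (x y : R -> W)
    (t : R) v w : has_deriv x t v -> has_deriv y t w ->
  has_deriv (fun s => x s - y s) t (v - w).
Proof.
move=> xv yw e e0; have e2 : 0 < e / 2 by rewrite divr_gt0.
have [d1 d10 d1P] := xv _ e2; have [d2 d20 d2P] := yw _ e2.
exists (Num.min d1 d2) => [|s]; first by rewrite lt_min d10.
rewrite lt_min => /andP[/d1P X /d2P Y].
rewrite (_ : _ - _ = (x s - x t - (s - t) *: v) - (y s - y t - (s - t) *: w)).
  by rewrite (le_trans (ler_normB _ _))//; lra.
by rewrite (scalerBr (s - t)) (subrACA (x s) (y s) (x t)) (subrACA (x s - x t)).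
Qed.

Lemma has_deriv_expM {R : realType} (K L t : R) :
  has_deriv (fun s => K * expR (L * s)) t (K * (L * expR (L * t))).
Proof.
apply/is_deriveP.
have : is_derive t 1 (fun s : R => K *: expR (L *: s)) (K *: (L *: 1 * expR (L
  *: t))).
  apply: is_deriveZ; rewrite mulrC.
  exact: (is_derive1_comp (f := expR) (g := fun s : R => L *: s)).
by rewrite /GRing.scale/= mulr1.
Qed.

(* The weight [exp (2 L t)] makes the integral operator a contraction with
   factor [1/2] on the whole half-line. *)
Lemma weighted_contraction {R : realType} {W : normedModType R} (u : R -> W)
    (K L t : R) : 0 < L -> 0 <= K -> 0 <= t -> abs_continuous 0 t u -> u 0 = 0
      ->
  {ae (@lebesgue_measure R), forall s : R, 0 < s -> s < t ->
    exists2 v, has_deriv u s v & `|v| <= L * (K * expR (2 * L * s))} ->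
  `|u t| <= K / 2 * expR (2 * L * t).
Proof.
move=> L0 K0 t0 ac u0 uv.
pose phi s := K / 2 * expR (2 * L * s).
have H : `|u t - u 0| <= phi t - phi 0.
  apply: ac_norm_le => //.
    move=> s s' _ ss' _; rewrite ler_wpM2l ?divr_ge0// ler_expR ler_wpM2l//.
    by rewrite mulr_ge0// ltW.
  apply: ae_imply uv => s Hs s0 st; have [v uv vle] := Hs s0 st.
  exists v, (K / 2 * (2 * L * expR (2 * L * s))); split => //.
    exact: has_deriv_expM.
  by apply: (le_trans vle); rewrite le_eqVlt; apply/orP; left; apply/eqP; field.
move: H; rewrite u0 subr0 => /le_trans; apply.
by rewrite gerBl mulr_ge0 ?expR_ge0// divr_ge0.
Qed.

(** Measure theory is isolated in the last hypothesis, which supplies a primitive of F t (x t) along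
    every M-Lipschitz path; the iterates and their limit all keep the Lipschitz constant [M]. *)
Lemma picard {R : realType} {W : normedModType R} (F : R -> W -> W) (x0 : W)
    (L M : R) : geo_complete W -> 0 < L -> 0 <= M ->
  {ae (@lebesgue_measure R), forall t : R, 0 <= t ->
    forall x y, `|F t x - F t y| <= L * `|x - y|} ->
  (forall x : R -> W, (forall s t, `|x s - x t| <= M * `|s - t|) ->
    exists X : R -> W, [/\ forall t, t <= 0 -> X t = x0,
      forall s t, `|X s - X t| <= M * `|s - t| &
      {ae (@lebesgue_measure R), forall t : R, 0 <= t ->
        has_deriv X t (F t (x t))}]) ->
  exists x : R -> W, [/\ x 0 = x0,
      forall s t, `|x s - x t| <= M * `|s - t| &
      {ae (@lebesgue_measure R), forall t : R, 0 <= t ->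
        has_deriv x t (F t (x t))}].
Proof.
move=> Wc L0 M0 FL FA.
have FA' (x : {x : R -> W | forall s t, `|x s - x t| <= M * `|s - t|}) :
    exists X : {x : R -> W | forall s t, `|x s - x t| <= M * `|s - t|},
    (forall t, t <= 0 -> sval X t = x0) /\
    {ae (@lebesgue_measure R), forall t : R, 0 <= t ->
        has_deriv (sval X) t (F t (sval x t))}.
  by have [X [X1 X2 X3]] := FA _ (svalP x); exists (exist _ X X2).
have [T TP] := choice FA'.
have c0P (s t : R) : `|x0 - x0| <= M * `|s - t| by rewrite subrr normr0
  mulr_ge0.
pose xs k := sval (iter k T (exist _ (fun _ : R => x0) c0P)).
have xsL k s t : `|xs k s - xs k t| <= M * `|s - t| := svalP (iter k T _) s t.
have xs0 k t : t <= 0 -> xs k t = x0.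
  by case: k => [//|k]; rewrite /xs iterS; exact: (TP _).1.
have xsD k : {ae (@lebesgue_measure R), forall t : R, 0 <= t ->
    has_deriv (xs k.+1) t (F t (xs k t))} := (TP (iter k T _)).2.
have acL (x : R -> W) a b : (forall s t, `|x s - x t| <= M * `|s - t|) ->
    abs_continuous a b x.
  by move=> xM; apply: (ac_lipschitz M0) => s t _ _; exact: xM.
(* Weighted distance of the first two iterates: M t <= M / (2 L) exp(2 L t), from 1 + u <= exp u. *)
pose A := M / (2 * L).
have A0 : 0 <= A by rewrite divr_ge0 ?mulr_ge0// ltW.
have step (x y X Y : R -> W) K : 0 <= K ->
    (forall s t, `|X s - X t| <= M * `|s - t|) ->
    (forall s t, `|Y s - Y t| <= M * `|s - t|) -> X 0 = Y 0 ->
    {ae (@lebesgue_measure R), forall t : R, 0 <= t ->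
      has_deriv X t (F t (x t))} ->
    {ae (@lebesgue_measure R), forall t : R, 0 <= t ->
      has_deriv Y t (F t (y t))} ->
    (forall t, 0 <= t -> `|x t - y t| <= K * expR (2 * L * t)) ->
    forall t, 0 <= t -> `|X t - Y t| <= K / 2 * expR (2 * L * t).
  move=> K0 XM YM XY0 XD YD xyK t t0.
  apply: (weighted_contraction L0 K0 t0 (u := fun t => X t - Y t)).
  - by apply: acB; exact: acL.
  - by rewrite XY0 subrr.
  - apply: ae_imply2 (ae_imply2 (fun _ => @conj _ _) XD YD) FL.
    move=> s [XDs YDs] FLs s0 st; have s0' := ltW s0.
    exists (F s (x s) - F s (y s)); first exact: has_derivB (XDs s0') (YDs s0').
    by apply: (le_trans (FLs s0' _ _)); rewrite ler_pM2l// xyK.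
have xsA k t : 0 <= t -> `|xs k.+1 t - xs k t| <= A / 2 ^+ k * expR (2 * L * t).
  elim: k t => [|k IH] t t0.
    have -> : xs 0%N t = xs 1%N 0 by rewrite (xs0 1%N).
    apply: le_trans (xsL 1%N t 0) _; rewrite subr0 ger0_norm// expr0 divr1 /A.
    have : 1 + 2 * L * t <= expR (2 * L * t) := expR_ge1Dx _.
    move=> ex; rewrite mulrAC ler_pdivlMr ?mulr_gt0//.
    have : M * (1 + 2 * L * t) <= M * expR (2 * L * t) by rewrite ler_wpM2l.
    lra.
  rewrite exprSr invfM mulrA.
  apply: (step (xs k.+1) (xs k)) => //; first by rewrite divr_ge0// exprn_ge0.
  by rewrite !xs0.
have lim t : exists l, 0 <= t ->
    forall k, `|xs k t - l| <= 2 * (A * expR (2 * L * t)) / 2 ^+ k.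
  have [t0|t0] := leP 0 t; last by exists 0.
  have [|l lP] := Wc (fun k => xs k t) (A * expR (2 * L * t)).
    by move=> k; rewrite mulrAC; exact: xsA.
  by exists l.
(* Freezing the limit at negative times makes it agree there with the primitives, which are
   constant. *)
have [l lP] := choice lim; pose x t := l (pos_part t).
have xP k t : 0 <= t -> `|xs k t - x t| <= 2 * A / 2 ^+ k * expR (2 * L * t).
  move=> t0; rewrite /x pos_part_id//; have := lP t t0 k.
  by rewrite mulrA mulrAC.
have xM' s t : 0 <= s -> 0 <= t -> `|x s - x t| <= M * `|s - t|.
  move=> s0 t0; apply: (@le_add_geometric _ _ _
    (2 * A * (expR (2 * L * s) + expR (2 * L * t)))) => k.
  have := ler_distD (xs k s) (x s) (x t); rewrite (distrC (x s) (xs k s)).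
  have := ler_distD (xs k t) (xs k s) (x t).
  have := xP k s s0; have := xP k t t0; have := xsL k s t; lra.
have xM s t : `|x s - x t| <= M * `|s - t|.
  have -> : x s - x t = x (pos_part s) - x (pos_part t).
    by rewrite /x !(pos_part_id (pos_part_ge0 _)).
  apply: (le_trans (xM' _ _ (pos_part_ge0 _) (pos_part_ge0 _))).
  by rewrite ler_wpM2l// pos_part_dist.
(* One more application of the integral operator, to the limit; [X] then turns out to be the limit
   itself. *)
have [X [X0 XM XD]] := FA x xM.
have Xx t : 0 <= t -> X t = x t.
  move=> t0; apply/eqP; rewrite -subr_eq0 -normr_le0.
  apply: (@le_add_geometric _ _ _ (3 * A * expR (2 * L * t))) => k;
    rewrite add0r.
  have h1 : `|X t - xs k.+1 t| <= 2 * A / 2 ^+ k / 2 * expR (2 * L * t).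
    apply: (step x (xs k)) => //.
    - by rewrite divr_ge0 ?exprn_ge0// mulr_ge0.
    - by rewrite X0// xs0.
    - by move=> s s0; rewrite distrC; exact: xP.
  have h2 := xP k.+1 t t0.
  have := ler_normD (X t - xs k.+1 t) (xs k.+1 t - x t); rewrite addrA subrK.
  have : 2 * A / 2 ^+ k.+1 * expR (2 * L * t) = A / 2 ^+ k * expR (2 * L * t).
    by rewrite exprS; field; rewrite expf_neq0.
  have : 0 <= A / 2 ^+ k * expR (2 * L * t).
    by rewrite mulr_ge0 ?expR_ge0// divr_ge0// exprn_ge0.
  lra.
exists x; split => //; first by rewrite -Xx// X0.
apply: ae_imply XD => t XDt t0.
(* [has_deriv] is two-sided, so at t = 0 the equality must also cover negative arguments. *)
rewrite -{1}(_ : X = x); first exact: XDt.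
apply/funext => s; have [s0|/ltW s0] := leP 0 s; first exact: Xx.
by rewrite X0// /x pos_part_eq0// -(pos_part_id (lexx 0)) -/(x 0) -Xx// X0.
Qed.

(** The difference is bounded on the interval, and the contraction halves its weighted bound any
    number of times, hence it vanishes. *)
Lemma caratheodory_unique {R : realType} {W : normedModType R} (F : R -> W -> W)
    (x y : R -> W) (L c : R) : 0 < L -> 0 <= c ->
  abs_continuous 0 c x -> abs_continuous 0 c y -> x 0 = y 0 ->
  {ae (@lebesgue_measure R), forall t : R, 0 < t -> t < c ->
    [/\ has_deriv x t (F t (x t)), has_deriv y t (F t (y t)) &
        `|F t (x t) - F t (y t)| <= L * `|x t - y t|]} ->
  x c = y c.
Proof.
move=> L0 c0 acx acy xy0 H.
have acxy := acB acx acy.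
have [B0 B0P] := ac_bounded acxy; pose B := `|B0|.
have e1 (t : R) : 0 <= t -> 1 <= expR (2 * L * t).
  by move=> t0; rewrite -expR0 ler_expR mulr_ge0// mulr_ge0// ltW.
have K k : forall t, 0 <= t -> t <= c ->
    `|x t - y t| <= B / 2 ^+ k * expR (2 * L * t).
  elim: k => [|k IH] t t0 tc.
    rewrite expr0 divr1 (le_trans (B0P t t0 tc))// (le_trans (ler_norm _))//.
    by rewrite ler_peMr// e1.
  rewrite exprSr invfM mulrA.
  apply: (weighted_contraction L0 _ t0 (u := fun t => x t - y t)).
  - by rewrite divr_ge0 ?exprn_ge0 ?normr_ge0.
  - exact: ac_subitv acxy.
  - by rewrite xy0 subrr.
  - apply: ae_imply H => s Hs s0 st.
    have sc : s < c by exact: lt_le_trans tc.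
    have [xs ys Fs] := Hs s0 sc.
    exists (F s (x s) - F s (y s)); first exact: has_derivB.
    by apply: (le_trans Fs); rewrite ler_pM2l// IH// ltW.
apply/eqP; rewrite -subr_eq0 -normr_le0.
apply: (@le_add_geometric _ _ _ (B * expR (2 * L * c))) => k; rewrite add0r.
by rewrite mulrAC K.
Qed.

(* The exceptional null sets of the superlevel sets of [x] at rational heights
   are removed all at once. *)
Lemma borel_version {R : realType} (x : R -> R) :
  lebesgue_measurable_fun `[0, +oo[ x ->
  exists2 y : R -> R,
    measurable_fun setT (y : measurableTypeR R -> measurableTypeR R) &
    {ae (@lebesgue_measure R), forall t : R, 0 <= t -> y t = x t}.
Proof.
move=> mx; pose D := `[0, +oo[%classic : set R.
have gE := @g_sigma_completed_algebra_genE R.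
have mD : (completed_algebra_gen (@lebesgue_measure R)).-sigma.-measurable D.
  rewrite gE; exists D; first exact: measurable_itv.
  by exists set0; [exact: negligible_set0|rewrite setU0].
(* A set of the completed sigma-algebra is a Borel set together with a part of a Borel null set. *)
have H (q : rat) : exists BA : set R * set R,
    [/\ measurable (BA.1 : set (measurableTypeR R)),
        measurable (BA.2 : set (measurableTypeR R)),
        lebesgue_measure BA.2 = 0%E &
        (D `&` [set t | ratr q < x t]) `\` BA.2 = BA.1 `\` BA.2].
  have := mx mD `]ratr q, +oo[%classic (measurable_itv _).
  rewrite -[X in X _]/((completed_algebra_gen (@lebesgue_measure
    R)).-sigma.-measurable).
  rewrite gE => -[B mB [N [A [mA A0 NA]]] BN].
  exists (B, A); split => //=.
  have -> : D `&` [set t | ratr q < x t] = B `|` N.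
    rewrite BN; apply/seteqP; split=> t [Dt xt]; split => //.
      by rewrite /= in_itv/= andbT.
    by move: xt; rewrite /= in_itv/= andbT.
  apply/seteqP; split => t [] //=; first by move=> [Bt|/NA Nt].
  by move=> Bt nAt; split => //; left.
have [BA BAP] := choice H.
pose N := \bigcup_q (BA q).2.
have mN : measurable (N : set (measurableTypeR R)).
  by apply: bigcupT_measurable_rat => q; have [] := BAP q.
have negN : (@lebesgue_measure R).-negligible N.
  have -> : N = \bigcup_n (if @unpickle rat n is Some q then (BA q).2 else
    set0).
    apply/seteqP; split => t [q _ qt]; last first.
      by case: (@unpickle rat q) qt => // r rt; exists r.
    exists (pickle q); first exact: I.
    by rewrite pickleK.
  apply: negligible_bigcup => n; case: unpickle => [q|];
    last exact: negligible_set0.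
  by have [_ mA A0 _] := BAP q; exact/negligibleP.
exists (x \_ (D `\` N)).
  apply/(measurable_restrictT _ _).1.
    by apply: measurableD => //; exact: measurable_itv.
  apply: (measurability (@RGenOInfty.G R)) => [|_ [_ [c ->] <-]].
    exact: RGenOInfty.measurableE.
  (* Off the common null set, the superlevel set at a real height is the union of those at larger
     rational heights. *)
  have -> : (D `\` N) `&` x @^-1` `]c, +oo[ =
      \bigcup_q (if c < ratr q then (BA q).1 `\` N else set0).
    apply/seteqP; split=> [t [[Dt nN]]|t [q _]] /=.
      rewrite in_itv/= andbT => /rat_in_itvoo[q];
        rewrite in_itv/= => /andP[cq qx].
      exists q => //; rewrite cq; split => //.
      have [_ _ _ E] := BAP q.
      have : ((D `&` [set t | ratr q < x t]) `\` (BA q).2) t.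
        by split => // At; apply: nN; exists q.
      by rewrite E => -[].
    case: ifPn => // cq [Bt nN].
    have [_ _ _ E] := BAP q.
    have : ((BA q).1 `\` (BA q).2) t by split => // At; apply: nN; exists q.
    rewrite -E => -[[Dt /= qx] _]; split; first by split.
    by rewrite in_itv/= andbT (lt_trans cq).
  apply: bigcupT_measurable_rat => q; case: ifP => // _.
  by apply: measurableD => //; have [] := BAP q.
have : {ae (@lebesgue_measure R), forall t : R, ~ N t}.
  by apply: negligibleS negN => t /= /contrapT.
apply: ae_imply => t nN t0; rewrite patchE mem_set//.
by split => //; rewrite /D/= in_itv/= t0.
Qed.

Lemma bounded_borel_version {R : realType} (x : R -> R) (M : R) :
  lebesgue_measurable_fun `[0, +oo[ x -> 0 <= M ->
  {ae (@lebesgue_measure R), forall t : R, 0 <= t -> `|x t| <= M} ->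
  exists y : R -> R, [/\
    measurable_fun setT (y : measurableTypeR R -> measurableTypeR R),
    forall t, `|y t| <= M &
    {ae (@lebesgue_measure R), forall t : R, 0 <= t -> y t = x t}].
Proof.
move=> /borel_version[y my yx] M0 xM.
exists (fun t => Num.max (- M) (Num.min M (y t))); split.
- apply: measurable_maxr; first exact: measurable_cst.
  by apply: measurable_minr => //; exact: measurable_cst.
- move=> t; rewrite ler_norml le_max lexx/= ge_max lerNl ge_min lexx andbT.
  by rewrite (le_trans _ M0)// oppr_le0.
- apply: ae_imply2 yx xM => t Y X t0; rewrite Y//; have := X t0.
  by rewrite ler_norml => /andP[X1 X2]; rewrite (min_idPr X2) (max_idPr X1).
Qed.

(** Lebesgue differentiation of the indefinite integral from 0, extended by 0 to the left so as to
    be Lipschitz on the whole line. *)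
Lemma antiderivative {R : realType} (h : R -> R) (M : R) :
  measurable_fun setT (h : measurableTypeR R -> measurableTypeR R) ->
  (forall t, `|h t| <= M) ->
  exists H : R -> R, [/\ forall t, t <= 0 -> H t = 0,
    forall s t, `|H s - H t| <= M * `|s - t| &
    {ae (@lebesgue_measure R), forall t : R, 0 <= t -> has_deriv H t (h t)}].
Proof.
move=> mh hM; have M0 : 0 <= M := le_trans (normr_ge0 _) (hM 0).
have hb (k : R -> R) (A : set R) : (forall t, `|k t| <= M) -> [bounded k x | x
  in A].
  move=> kM; exists M; split; first exact: num_real.
  by move=> B /ltW MB t _ /=; exact: le_trans (kM t) MB.
have bint (k : R -> R) (a b : R) (c d : bool) :
    measurable_fun setT (k : measurableTypeR R -> measurableTypeR R) ->
    (forall t, `|k t| <= M) ->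
    (@lebesgue_measure R).-integrable
    [set` Interval (BSide c a) (BSide d b)] (EFin \o k).
  move=> mk kM; apply: measurable_bounded_integrable => //.
  - rewrite [X in (X < _)%E](lebesgue_measure_itv (Interval (BSide c a) (BSide
    d b))).
    by case: ifP => // _; rewrite -EFinD ltry.
  - exact: measurable_funTS.
  - exact: hb.
have hint a b c d := bint h a b c d mh hM.
have loc : locally_integrable [set: R] h.
  split => //; first exact: openT.
  move=> K _ cK; have mK := compact_measurable cK.
  have Kfin : (lebesgue_measure K < +oo)%E.
    have [B [_ BP]] := compact_bounded cK.
    apply: (@le_lt_trans _ _ (lebesgue_measure `[- (B + 1), (B + 1)]%classic)).
      rewrite le_measure ?inE//.
      move=> t Kt; rewrite /= in_itv/= -ler_norml.
      by apply: (BP (B + 1)) => //; rewrite ltrDl.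
    rewrite [X in (X < _)%E](lebesgue_measure_itv `[- (B + 1), (B + 1)]).
    by case: ifP => // _; rewrite -EFinD ltry.
  have /integrableP[] : (@lebesgue_measure R).-integrable K (EFin \o h).
    apply: measurable_bounded_integrable => //; last exact: hb.
    exact: measurable_funTS.
  by move=> _.
pose F x := \int[lebesgue_measure]_(t in `[0, x]) h t.
have FTC := FTC1 (a := BLeft 0) (fun y => hint _ _ _ _) loc.
have Flip s t : 0 <= s -> s <= t -> `|F t - F s| <= M * (t - s).
  move=> s0 st; rewrite /F Rintegral_itvB ?bnd_simp//.
  have hN : (@lebesgue_measure R).-integrable `]s,
    t] (EFin \o (fun x => `|h x|)).
    have /integrable_norm := hint s t false false.
    by [].
  have hM' : (@lebesgue_measure R).-integrable `]s, t] (EFin \o (fun=> M)).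
    apply: bint; first exact: measurable_cst.
    by move=> _; rewrite ger0_norm.
  apply: le_trans (le_normr_Rintegral _ (hint _ _ _ _)) _ => //.
  apply: (@le_trans _ _ (\int[lebesgue_measure]_(x in `]s, t]) M)).
    by apply: le_Rintegral.
  rewrite Rintegral_cst//.
  rewrite [X in M * fine X](lebesgue_measure_itv `]s, t])/= lte_fin.
  by case: ltP => //= ts; rewrite mulr0 mulr_ge0// subr_ge0.
exists (fun t => F (pos_part t)); split.
- move=> t t0; rewrite /F pos_part_eq0//.
  by rewrite set_itv1 Rintegral_set1.
- have Flip' s t : s <= t -> `|F (pos_part t) - F (pos_part s)| <= M * `|t - s|.
    move=> st; have := Flip _ _ (pos_part_ge0 s) (pos_part_mono st).
    move=> /le_trans; apply; rewrite ler_wpM2l//.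
    by rewrite (le_trans _ (pos_part_dist t s))// ler_norm.
  move=> s t; have [st|/ltW ts] := leP s t; last exact: Flip'.
  by rewrite distrC (distrC s); exact: Flip'.
(* At t = 0 the extended primitive may have a corner, so this single time is discarded. *)
- have null0 : {ae (@lebesgue_measure R), forall t : R, t <> 0}.
    exists [set (0 : R)]; split => //; first exact: lebesgue_measure_set1.
    by move=> t /= /contrapT.
  apply: ae_imply2 FTC null0 => t FTCt tN0 t0.
  have {}t0 : 0 < t by rewrite lt_neqAle t0 andbT eq_sym; apply/eqP.
  have [|dF dFE] := FTCt; first by rewrite /= lte_fin.
  have /is_deriveP HF : is_derive t 1 F (h t).
    by rewrite -dFE derive1E; exact: (DeriveDef dF erefl).
  move=> e e0; have [d d0 dP] := HF e e0.
  exists (Num.min d t) => [|s]; first by rewrite lt_min d0.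
  rewrite lt_min => /andP[sd st].
  have s0 : 0 <= s by move: st; rewrite ltr_norml; lra.
  by rewrite !pos_part_id ?(ltW t0)//; exact: dP.
Qed.

Lemma has_deriv_cV {R : realType} {n : nat} (x : R -> 'cV[R]_n) (t : R)
    (v : 'cV[R]_n) :
  (forall i, has_deriv (fun s => x s i ord0) t (v i ord0)) -> has_deriv x t v.
Proof.
move=> H e e0.
have H' i : exists d : R, 0 < d /\ forall s, `|s - t| < d ->
    `|x s i ord0 - x t i ord0 - (s - t) *: v i ord0| <= e * `|s - t|.
  by have [d d0 dP] := H i e e0; exists d.
have [d dP] := choice H'.
exists (\big[Num.min/1]_(i < n) d i).
  by apply: lt_bigmin => // i _; exact: (dP i).1.
move=> s st; apply: norm_le_coord => [|i j]; first by rewrite mulr_ge0// ltW.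
rewrite (ord1 j) !mxE; apply: (dP i).2; apply: lt_le_trans st _.
exact: bigmin_le_cond.
Qed.

Lemma has_deriv_pair {R : realType} {W1 W2 : normedModType R}
    (x : R -> W1) (y : R -> W2) t v w :
  has_deriv x t v -> has_deriv y t w -> has_deriv (fun s => (x s, y s)) t (v,
    w).
Proof.
move=> xv yw e e0; have [d1 d10 d1P] := xv e e0; have [d2 d20 d2P] := yw e e0.
exists (Num.min d1 d2) => [|s]; first by rewrite lt_min d10.
rewrite lt_min => /andP[/d1P X /d2P Y].
by rewrite prod_normE ge_max/= X Y.
Qed.

Lemma has_deriv_fst {R : realType} {W1 W2 : normedModType R}
    (x : R -> W1 * W2) t v : has_deriv x t v -> has_deriv (fun s => (x s).1) t
      v.1.
Proof.
move=> xv e e0; have [d d0 dP] := xv e e0; exists d => // s /dP.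
by apply: le_trans; rewrite prod_normE le_max lexx.
Qed.

Lemma has_deriv_snd {R : realType} {W1 W2 : normedModType R}
    (x : R -> W1 * W2) t v : has_deriv x t v -> has_deriv (fun s => (x s).2) t
      v.2.
Proof.
move=> xv e e0; have [d d0 dP] := xv e e0; exists d => // s /dP.
by apply: le_trans; rewrite prod_normE le_max lexx orbT.
Qed.

(** The finite conjunction is read as a countable one through [insub], out-of-range indices giving
    [True]. *)
Lemma ae_forall_ord {R : realType} (n : nat) (P : 'I_n -> R -> Prop) :
  (forall i, {ae (@lebesgue_measure R), forall t, P i t}) ->
  {ae (@lebesgue_measure R), forall t, forall i, P i t}.
Proof.
move=> H.
have : {ae (@lebesgue_measure R), forall t, forall k,
    if insub k is Some i then P i t else True}.
  apply/ae_foralln => k; case: insubP => [i _ _|_]; first exact: H.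
  by apply: nearW.
apply: ae_imply => t Pt i; have := Pt (val i).
by rewrite valK.
Qed.

Lemma antiderivative_cV {R : realType} {n : nat} (h : R -> 'cV[R]_n)
    (x0 : 'cV[R]_n) (M : R) : 0 <= M ->
  (forall i, measurable_fun setT
    ((fun t => h t i ord0) : measurableTypeR R -> measurableTypeR R)) ->
  (forall t, `|h t| <= M) ->
  exists H : R -> 'cV[R]_n, [/\ forall t, t <= 0 -> H t = x0,
    forall s t, `|H s - H t| <= M * `|s - t| &
    {ae (@lebesgue_measure R), forall t : R, 0 <= t -> has_deriv H t (h t)}].
Proof.
move=> M0 mh hM.
have [H HP] := choice (fun i => antiderivative (mh i)
  (fun t => le_trans (coord_le_norm _ _ _) (hM t))).
exists (fun t => \col_i (x0 i ord0 + H i t)); split.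
- by move=> t t0; apply/colP => i; rewrite mxE; have [-> // _ _] := HP i;
  rewrite addr0.
- move=> s t; apply: norm_le_coord => [|i j]; first exact: mulr_ge0.
  have [_ Hl _] := HP i; rewrite !mxE.
  by rewrite opprD addrACA subrr add0r.
- have : {ae (@lebesgue_measure R), forall t : R, forall i,
      0 <= t -> has_deriv (H i) t (h t i ord0)}.
    by apply: ae_forall_ord => i; have [] := HP i.
  apply: ae_imply => t HD t0; apply: has_deriv_cV => i e e0.
  have [d d0 dP] := HD i t0 e e0; exists d => // s /dP.
  by rewrite !mxE opprD addrACA subrr add0r.
Qed.

(** * The closed loop *)

Lemma lip_on_balls_continuous {R : realType} {W1 W2 : normedModType R}
    (F : W1 -> W2) : lip_on_balls F -> continuous F.
Proof.
move=> lF; apply/continuous_distP => s e e0.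
have [K K0 KP] := lF (`|s| + 1); have K1 : 0 < K + 1 by rewrite ltr_wpDl.
exists (Num.min 1 (e / (K + 1))); first by rewrite lt_min ltr01 divr_gt0.
move=> t; rewrite lt_min ltr_pdivlMr// => /andP[ts1 tsK].
have tM : `|t| <= `|s| + 1.
  by have := ler_normD (t - s) s; rewrite subrK; lra.
apply: le_lt_trans (KP _ _ tM _) _; first by rewrite lerDl.
by have := normr_ge0 (t - s); lra.
Qed.

Lemma lip_on_balls_enorm_sqr {R : realType} {n p : nat}
    (phi : 'cV[R]_n -> 'cV[R]_p) : lip_on_balls phi ->
  lip_on_balls (fun y => enorm (phi y) ^+ 2).
Proof.
move=> lphi; under eq_fun do rewrite enorm_sqr.
apply: lip_on_balls_sum => i; apply: lip_on_ballsX.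
exact: (lip_on_balls_comp lphi (lip_on_balls_coord i ord0)).
Qed.

Lemma lip_on_balls_lie {R : realType} {n : nat} (V : 'cV[R]_n -> R)
    (g : 'cV[R]_n -> 'cV[R]_n) : smooth V -> smooth g ->
  lip_on_balls (lie V g).
Proof.
move=> sV sg; rewrite (_ : lie V g =
    fun y => \sum_(j < n) partial j V y * g y j ord0).
  apply: lip_on_balls_sum => j; apply: lip_on_ballsM.
    exact/smooth_lip_on_balls/smooth_partial.
  exact: lip_on_balls_comp (smooth_lip_on_balls sg) (lip_on_balls_coord j ord0).
by apply/funext => y; rewrite /lie mxE; apply: eq_bigr => j _; rewrite mxE.
Qed.

(* Composing with [clamp] makes the vector field globally Lipschitz and bounded
   without changing it on the max-norm ball of radius [M]. *)
Definition clamp_real {R : realType} (M x : R) : R :=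
  Num.max (- M) (Num.min M x).

Lemma clamp_real_le {R : realType} (M x : R) : 0 <= M -> `|clamp_real M x| <= M.
Proof.
move=> M0; rewrite /clamp_real ler_norml le_max lexx/= ge_max ge_min lexx andbT.
by rewrite (le_trans _ M0)// oppr_le0.
Qed.

Lemma clamp_real_id {R : realType} (M x : R) : `|x| <= M -> clamp_real M x = x.
Proof.
by rewrite ler_norml /clamp_real => /andP[h1 h2];
  rewrite (min_idPr h2) (max_idPr h1).
Qed.

Lemma clamp_real_dist {R : realType} (M x y : R) :
  `|clamp_real M x - clamp_real M y| <= `|x - y|.
Proof.
rewrite ler_norml; have := ler_norm (x - y); have := ler_norm (y - x).
rewrite (distrC y x) /clamp_real => h1 h2.
have h3 := normr_ge0 (x - y).
by case: (leP M x) => ?; case: (leP M y) => ?; case: (leP (- M) M) => ?;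
  case: (leP (- M) x) => ?; case: (leP (- M) y) => ?; lra.
Qed.

Definition clamp {R : realType} {n : nat} (M : R) (X : 'cV[R]_n * R) :
    'cV[R]_n * R :=
  (map_mx (clamp_real M) X.1, clamp_real M X.2).

Lemma clamp_le {R : realType} {n : nat} (M : R) (X : 'cV[R]_n * R) :
  0 <= M -> `|clamp M X| <= M.
Proof.
move=> M0; rewrite prod_normE ge_max clamp_real_le// andbT.
by apply: norm_le_coord => // i j; rewrite mxE clamp_real_le.
Qed.

Lemma clamp_id {R : realType} {n : nat} (M : R) (X : 'cV[R]_n * R) :
  `|X| <= M -> clamp M X = X.
Proof.
rewrite prod_normE ge_max => /andP[X1 X2]; case: X X1 X2 => y z /= X1 X2.
rewrite /clamp/= clamp_real_id//; congr (_, _); apply/matrixP => i j.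
by rewrite mxE clamp_real_id// (le_trans (coord_le_norm _ _ _)).
Qed.

Lemma clamp_dist {R : realType} {n : nat} (M : R) (X Y : 'cV[R]_n * R) :
  `|clamp M X - clamp M Y| <= `|X - Y|.
Proof.
rewrite [in leRHS]prod_normE prod_normE ge_max !le_max/=.
apply/andP; split; apply/orP; [left|right]; last exact: clamp_real_dist.
apply: norm_le_coord => // i j; rewrite !mxE.
apply: (le_trans (clamp_real_dist _ _ _)).
by have := coord_le_norm (X.1 - Y.1) i j; rewrite !mxE.
Qed.

Section closed_loop.
Context {R : realType} {n m p q : nat}.
Variables (f : 'cV[R]_n -> 'cV[R]_n) (g : 'I_m -> 'cV[R]_n -> 'cV[R]_n)
  (phi : 'I_m -> 'cV[R]_n -> 'cV[R]_p) (A : 'I_m -> 'cV[R]_n -> 'cV[R]_q)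
  (V mu : 'cV[R]_n -> R) (s delta : 'I_m -> 'cV[R]_n -> R)
  (eps Gamma C kappa : R).
Hypotheses (f_smooth : smooth f) (g_smooth : forall i, smooth (g i))
  (phi_smooth : forall i, smooth (phi i)) (A_smooth : forall i, smooth (A i))
  (V_smooth : smooth V) (s_smooth : forall i, smooth (s i))
  (delta_smooth : forall i, smooth (delta i)) (mu_smooth : smooth mu).

Definition loop_feedback (X : 'cV[R]_n * R) (i : 'I_m) : R :=
  feedback C kappa V (g i) (phi i) (A i) mu (delta i) (s i) X.1 X.2.

Definition loop_field (b : 'cV[R]_m) (theta : 'cV[R]_p) (d : 'cV[R]_q)
    (X : 'cV[R]_n * R) : 'cV[R]_n * R :=
  (ydot f g phi A (loop_feedback X) b theta d X.1, zdot Gamma eps V X.1 X.2).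

Lemma lip_feedback i : lip_on_balls (fun X => loop_feedback X i).
Proof.
have l1 := @lip_on_balls_fst R 'cV[R]_n R.
have l2 := @lip_on_balls_snd R 'cV[R]_n R.
have lw : lip_on_balls (fun X : 'cV[R]_n * R => kappa + expR X.2).
  apply: lip_on_ballsD; first exact: lip_on_balls_cst.
  exact: lip_on_balls_comp l2 lip_on_balls_expR.
have lL := lip_on_balls_comp l1 (lip_on_balls_lie V_smooth (g_smooth i)).
have ls := lip_on_balls_comp l1 (smooth_lip_on_balls (s_smooth i)).
have ld := lip_on_balls_comp l1 (smooth_lip_on_balls (delta_smooth i)).
have lm := lip_on_balls_comp l1 (smooth_lip_on_balls mu_smooth).
have lph := lip_on_balls_comp l1
  (lip_on_balls_enorm_sqr (smooth_lip_on_balls (phi_smooth i))).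
have lA := lip_on_balls_comp l1
  (lip_on_balls_enorm_sqr (smooth_lip_on_balls (A_smooth i))).
have lP : lip_on_balls (fun X : 'cV[R]_n * R =>
    gainP kappa (phi i) (A i) mu (delta i) X.1 X.2).
  apply: lip_on_ballsD; last exact: lip_on_ballsX.
  apply: lip_on_ballsD; first exact: lip_on_ballsD.
  by apply: lip_on_ballsM => //; exact: lip_on_ballsX.
have lc (c : R) := @lip_on_balls_cst R ('cV[R]_n * R)%type R c.
apply: lip_on_ballsM => //; apply: lip_on_ballsN.
by do ?[exact: lc | exact: lw | exact: ls | exact: lP | exact: lL
  | apply: lip_on_ballsD | apply: lip_on_ballsX | apply: lip_on_ballsM].
Qed.

(** Joint dependence on state and inputs, so that one Lipschitz constant and one bound serve for all
    times at which the inputs stay in a given ball. *)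
Lemma lip_loop_field :
  lip_on_balls (fun U : ('cV[R]_n * R) * ('cV[R]_m * ('cV[R]_p * 'cV[R]_q)) =>
    loop_field U.2.1 U.2.2.1 U.2.2.2 U.1).
Proof.
set S := ('cV[R]_n * R)%type; set I := ('cV[R]_m * ('cV[R]_p * 'cV[R]_q))%type.
have lS := @lip_on_balls_fst R S I.
have lI := @lip_on_balls_snd R S I.
have ly := lip_on_balls_comp lS (@lip_on_balls_fst R 'cV[R]_n R).
have lz := lip_on_balls_comp lS (@lip_on_balls_snd R 'cV[R]_n R).
have lb := lip_on_balls_comp lI (@lip_on_balls_fst R 'cV[R]_m ('cV[R]_p *
  'cV[R]_q)%type).
have lI2 := lip_on_balls_comp lI (@lip_on_balls_snd R 'cV[R]_m ('cV[R]_p *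
  'cV[R]_q)%type).
have lth := lip_on_balls_comp lI2 (@lip_on_balls_fst R 'cV[R]_p 'cV[R]_q).
have ld := lip_on_balls_comp lI2 (@lip_on_balls_snd R 'cV[R]_p 'cV[R]_q).
have ldot k (h : 'cV[R]_n -> 'cV[R]_k) (v : S * I -> 'cV[R]_k) : smooth h ->
    lip_on_balls v -> lip_on_balls (fun U => ((h U.1.1)^T *m v U) ord0 ord0).
  move=> sh lv.
  have -> : (fun U : S * I => ((h U.1.1)^T *m v U) ord0 ord0) =
      fun U => \sum_(j < k) h U.1.1 j ord0 * v U j ord0.
    by apply/funext => U; rewrite mxE; apply: eq_bigr => j _; rewrite mxE.
  apply: lip_on_balls_sum => j; apply: lip_on_ballsM.
    exact: lip_on_balls_comp (lip_on_balls_comp ly (smooth_lip_on_balls sh))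
      (lip_on_balls_coord j ord0).
  exact: lip_on_balls_comp lv (lip_on_balls_coord j ord0).
apply: lip_on_balls_pair.
  apply: lip_on_ballsD; first exact: lip_on_balls_comp ly (smooth_lip_on_balls
    f_smooth).
  apply: lip_on_balls_sum => i; apply: lip_on_ballsZ.
    apply: lip_on_ballsD; last exact: ldot.
    apply: lip_on_ballsD; last exact: ldot.
    apply: lip_on_ballsM.
      exact: lip_on_balls_comp lb (lip_on_balls_coord i ord0).
    exact: lip_on_balls_comp lS (lip_feedback i).
  exact: lip_on_balls_comp ly (smooth_lip_on_balls (g_smooth i)).
apply: lip_on_ballsM.
  apply: lip_on_ballsM; first exact: lip_on_balls_cst.
  by apply: lip_on_balls_comp lip_on_balls_expR; exact: lip_on_ballsN.
apply: lip_on_balls_comp lip_on_balls_pos_part.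
apply: lip_on_ballsD; last exact: lip_on_balls_cst.
exact: lip_on_balls_comp ly (smooth_lip_on_balls V_smooth).
Qed.

Definition borel (h : R -> R) : Prop :=
  measurable_fun setT (h : measurableTypeR R -> measurableTypeR R).

(** The inputs enter affinely, with coefficients that are continuous in time along [X], so sums and
    products of Borel functions suffice. *)
Lemma borel_loop_field (b : R -> 'cV[R]_m) (theta : R -> 'cV[R]_p)
    (d : R -> 'cV[R]_q) (X : R -> 'cV[R]_n * R) : continuous X ->
  (forall i, borel (fun t => b t i ord0)) ->
  (forall i, borel (fun t => theta t i ord0)) ->
  (forall i, borel (fun t => d t i ord0)) ->
  (forall i, borel (fun t => (loop_field (b t) (theta t) (d t) (X t)).1 i
    ord0)) /\
  borel (fun t => (loop_field (b t) (theta t) (d t) (X t)).2).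
Proof.
move=> cX mb mth md.
have bX (F : 'cV[R]_n * R -> R) : lip_on_balls F -> borel (fun t => F (X t)).
  move=> lF; apply: continuous_measurable_fun => t.
  by apply: continuous_comp; [exact: cX|exact: lip_on_balls_continuous].
have bY k (h : 'cV[R]_n -> 'cV[R]_k) j : smooth h ->
    borel (fun t => h (X t).1 j ord0).
  move=> sh; apply: (bX (fun U => h U.1 j ord0)).
  exact: lip_on_balls_comp (lip_on_balls_comp (@lip_on_balls_fst R 'cV[R]_n R)
    (smooth_lip_on_balls sh)) (lip_on_balls_coord j ord0).
have bdot k (h : 'cV[R]_n -> 'cV[R]_k) (v : R -> 'cV[R]_k) : smooth h ->
    (forall i, borel (fun t => v t i ord0)) ->
    borel (fun t => ((h (X t).1)^T *m v t) ord0 ord0).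
  move=> sh mv.
  have -> : (fun t => ((h (X t).1)^T *m v t) ord0 ord0) =
      fun t => \sum_(j < k) h (X t).1 j ord0 * v t j ord0.
    by apply/funext => t; rewrite mxE; apply: eq_bigr => j _; rewrite mxE.
  by apply: measurable_sum => j; apply: measurable_funM;
    [exact (bY k h j sh)|exact (mv j)].
split=> [l|].
  have -> : (fun t => (loop_field (b t) (theta t) (d t) (X t)).1 l ord0) =
      fun t => f (X t).1 l ord0 + \sum_(i < m)
        (b t i ord0 * loop_feedback (X t) i +
         ((phi i (X t).1)^T *m theta t) ord0 ord0 +
         ((A i (X t).1)^T *m d t) ord0 ord0) * g i (X t).1 l ord0.
    apply/funext => t; rewrite !mxE summxE; congr (_ + _).
    by apply: eq_bigr => i _; rewrite mxE.
  apply: measurable_funD; first exact (bY n f l f_smooth).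
  apply: measurable_sum => i; apply: measurable_funM;
    last exact (bY n (g i) l (g_smooth i)).
  apply: measurable_funD; last exact (bdot _ _ _ (A_smooth i) md).
  apply: measurable_funD; last exact (bdot _ _ _ (phi_smooth i) mth).
  by apply: measurable_funM; [exact (mb i)|exact (bX _ (lip_feedback i))].
refine (bX (fun U => zdot Gamma eps V U.1 U.2) _).
apply: lip_on_ballsM.
  apply: lip_on_ballsM; first exact: lip_on_balls_cst.
  apply: lip_on_balls_comp lip_on_balls_expR; apply: lip_on_ballsN.
  exact: lip_on_balls_snd.
apply: lip_on_balls_comp lip_on_balls_pos_part.
apply: lip_on_ballsD; last exact: lip_on_balls_cst.
exact: lip_on_balls_comp (@lip_on_balls_fst R 'cV[R]_n R) (smooth_lip_on_balls
  V_smooth).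
Qed.

Lemma borel_input {k : nat} (x : R -> 'cV[R]_k) (N : R) :
  (forall i, lebesgue_measurable_fun `[0, +oo[ (fun t => x t i ord0)) -> 0 <= N
    ->
  {ae (@lebesgue_measure R), forall t : R, 0 <= t -> `|x t| <= N} ->
  exists y : R -> 'cV[R]_k, [/\ forall i, borel (fun t => y t i ord0),
    forall t, `|y t| <= N &
    {ae (@lebesgue_measure R), forall t : R, 0 <= t -> y t = x t}].
Proof.
move=> mx N0 xN.
have xNi i : {ae (@lebesgue_measure R), forall t : R,
  0 <= t -> `|x t i ord0| <= N}.
  by apply: ae_imply xN => t H t0; exact: le_trans (coord_le_norm _ _ _) (H t0).
have [y yP] := choice (fun i => bounded_borel_version (mx i) N0 (xNi i)).
exists (fun t => \col_i y i t); split.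
- move=> i; have [my _ _] := yP i.
  by rewrite (_ : (fun t => _) = y i)//; apply/funext => t; rewrite mxE.
- by move=> t; apply: norm_le_coord => // i j; rewrite mxE; have [] := yP i.
- have : {ae (@lebesgue_measure R), forall t : R, forall i,
      0 <= t -> y i t = x t i ord0}.
    by apply: ae_forall_ord => i; have [] := yP i.
  by apply: ae_imply => t H t0; apply/colP => i; rewrite mxE H.
Qed.

(** Borel versions of the inputs, bounded at every time, meet the hypotheses of [picard]; the
    original inputs return at the end, being equal almost everywhere. *)
Lemma truncated_solution (M N : R) (y0 : 'cV[R]_n) (z0 : R)
    (b : R -> 'cV[R]_m) (theta : R -> 'cV[R]_p) (d : R -> 'cV[R]_q) :
  0 <= M -> 0 <= N ->
  (forall i, lebesgue_measurable_fun `[0, +oo[ (fun t => b t i ord0)) ->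
  (forall i, lebesgue_measurable_fun `[0, +oo[ (fun t => theta t i ord0)) ->
  (forall i, lebesgue_measurable_fun `[0, +oo[ (fun t => d t i ord0)) ->
  {ae (@lebesgue_measure R), forall t : R, 0 <= t -> `|b t| <= N} ->
  {ae (@lebesgue_measure R), forall t : R, 0 <= t -> `|theta t| <= N} ->
  {ae (@lebesgue_measure R), forall t : R, 0 <= t -> `|d t| <= N} ->
  exists (X : R -> 'cV[R]_n * R) (K : R), [/\ X 0 = (y0, z0), 0 <= K,
    forall s t, `|X s - X t| <= K * `|s - t| &
    {ae (@lebesgue_measure R), forall t : R, 0 <= t ->
      has_deriv X t (loop_field (b t) (theta t) (d t) (clamp M (X t)))}].
Proof.
move=> M0 N0 mb mth md bN thN dN.
have [b' [mb' b'N b'E]] := borel_input mb N0 bN.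
have [th' [mth' th'N th'E]] := borel_input mth N0 thN.
have [d' [md' d'N d'E]] := borel_input md N0 dN.
have [L L0 LP] := lip_loop_field (Num.max M N).
have [K K0 KP] := lip_on_balls_bounded lip_loop_field (Num.max M N).
pose U t (X : 'cV[R]_n * R) := (clamp M X, (b' t, (th' t, d' t))).
have UM t X : `|U t X| <= Num.max M N.
  rewrite !prod_normE !ge_max !le_max b'N th'N d'N !orbT andbT/=.
  by have := clamp_le X M0; rewrite prod_normE ge_max => /andP[-> ->].
pose F t (X : 'cV[R]_n * R) := loop_field (b' t) (th' t) (d' t) (clamp M X).
have FL t X Y : `|F t X - F t Y| <= (L + 1) * `|X - Y|.
  apply: (le_trans (LP (U t X) (U t Y) (UM t X) (UM t Y))).
  have -> : `|U t X - U t Y| = `|clamp M X - clamp M Y|.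
    by rewrite prod_normE/= [in X in Num.max _ X]subrr normr0 (max_idPl _).
  apply: (@le_trans _ _ (L * `|X - Y|)); first by rewrite ler_wpM2l//
    clamp_dist.
  by rewrite ler_wpM2r// lerDl.
have FK t X : `|F t X| <= K by exact: (KP (U t X)).
have [|||X [X0 XK XD]] := @picard R ('cV[R]_n * R)%type F (y0, z0) (L + 1) K
    (geo_complete_prod (@geo_complete_cV R n) (@geo_complete_real R)) _ K0 _ _.
- by rewrite ltr_wpDl.
- by apply: nearW => t _; exact: FL.
- move=> x xK.
  have cx : continuous (fun t => clamp M (x t)).
    apply/(continuous_distP (W1 := R)) => t e e0; exists (e / (K + 1)).
      by rewrite divr_gt0// ltr_wpDl.
    move=> r; rewrite ltr_pdivlMr ?ltr_wpDl// => rt.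
    apply: (le_lt_trans (clamp_dist _ _ _)); apply: (le_lt_trans (xK _ _)).
    by apply: le_lt_trans rt; rewrite mulrC ler_wpM2l// lerDl.
  have [mF1 mF2] := borel_loop_field cx mb' mth' md'.
  have FK1 t : `|(F t (x t)).1| <= K.
    by apply: le_trans (FK t (x t)); rewrite prod_normE le_max lexx.
  have FK2 t : `|(F t (x t)).2| <= K.
    by apply: le_trans (FK t (x t)); rewrite prod_normE le_max lexx orbT.
  have [Y [Y0 YK YD]] := antiderivative_cV y0 K0 mF1 FK1.
  have [Z [Z0 ZK ZD]] := antiderivative mF2 FK2.
  exists (fun t => (Y t, z0 + Z t)); split.
  + by move=> t t0; rewrite Y0// Z0// addr0.
  + move=> u t; rewrite prod_normE ge_max/= YK/=.
    by rewrite opprD addrACA subrr add0r.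
  + apply: ae_imply2 YD ZD => t YDt ZDt t0.
    rewrite [F t (x t)]surjective_pairing.
    apply: has_deriv_pair (YDt t0) _ => e e0.
    have [r r0 rP] := ZDt t0 e e0; exists r => // u /rP.
    by rewrite opprD addrACA subrr add0r.
exists X, K; split; [exact: X0|exact: K0|exact: XK|].
have inE := ae_imply2 (fun _ => @conj _ _) b'E (ae_imply2 (fun _ => @conj _ _)
  th'E d'E).
apply: ae_imply2 inE XD => t [bE [thE dE]] XDt t0.
by rewrite -(bE t0) -(thE t0) -(dE t0); exact: (XDt t0).
Qed.

(** * A priori estimates along trajectories and global existence *)

Variables (Q : 'cV[R]_n -> R) (rho : R -> R) (sigma Lambda : R).
Hypotheses (V_ge0 : forall y, 0 <= V y) (Q_ge0 : forall y, 0 <= Q y)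
  (s_ge0 : forall i y, 0 <= s i y)
  (hypA : forall y,
      lie V f y <= - Q y + sigma * (\sum_(i < m) delta i y * lie V (g i) y)
                   + \sum_(i < m) s i y * lie V (g i) y ^+ 2)
  (mu_gt0 : forall y, 0 < mu y) (Lambda_ge0 : 0 <= Lambda)
  (hypB : forall y,
      \sum_(i < m) enorm (phi i y) ^+ 2 <= mu y * (Q y + Lambda))
  (eps_gt0 : 0 < eps) (Gamma_gt0 : 0 < Gamma) (C_gt0 : 0 < C)
  (kappa_gt0 : 0 < kappa) (Ckappa : 1 <= 2 * C * kappa)
  (rhoK : Kinfty rho) (rhoQ : forall y, rho (V y) <= Q y / 2).

Section trajectory.
Variables (y0 : 'cV[R]_n) (z0 : R) (b : R -> 'cV[R]_m) (theta : R -> 'cV[R]_p)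
  (d : R -> 'cV[R]_q) (D Th beta : R).
Hypotheses (beta_gt0 : 0 < beta) (Th_ge0 : 0 <= Th)
  (b_ge : {ae (@lebesgue_measure R), forall t : R, 0 <= t ->
     forall i, beta <= b t i ord0})
  (theta_le : {ae (@lebesgue_measure R), forall t : R, 0 <= t ->
     enorm (theta t) <= Th})
  (d_le : {ae (@lebesgue_measure R), forall t : R, 0 <= t -> enorm (d t) <= D}).

(** Working on a compact interval lets the estimates apply to a truncated solution while it has not
    left the ball, before global existence is known. *)
Definition solution_upto (c : R) (y : R -> 'cV[R]_n) (z : R -> R) : Prop :=
  [/\ abs_continuous 0 c y, abs_continuous 0 c z, y 0 = y0, z 0 = z0 &
    {ae (@lebesgue_measure R), forall t : R, 0 < t -> t < c ->
      has_deriv y t (loop_field (b t) (theta t) (d t) (y t, z t)).1 /\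
      has_deriv z t (loop_field (b t) (theta t) (d t) (y t, z t)).2}].

Lemma solution_upto_le (c c' : R) y z : c' <= c ->
  solution_upto c y z -> solution_upto c' y z.
Proof.
move=> cc [acy acz y0E z0E H]; split => //; try exact: ac_subitv (lexx 0) cc _.
apply: ae_imply H => t Ht t0 tc'; apply: Ht => //; exact: lt_le_trans cc.
Qed.

Lemma solution_z_mono c y z u t : solution_upto c y z ->
  0 <= u -> u <= t -> t <= c -> z u <= z t.
Proof.
move=> [acy acz y0E z0E H] u0 ut tc; rewrite -subr_ge0 -(mul0r (t - u)).
apply: (ac_ge_slope ut (ac_subitv u0 tc acz)); apply: ae_imply H => r Hr ur rt.
have [||_ zr] := Hr; [exact: le_lt_trans ur|exact: lt_le_trans tc|].
exists (loop_field (b r) (theta r) (d r) (y r, z r)).2 => //.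
by rewrite mulr_ge0 ?pos_part_ge0// mulr_ge0 ?expR_ge0// ltW.
Qed.

Lemma solution_V_ac c y z : solution_upto c y z -> abs_continuous 0 c (V \o y).
Proof.
by move=> [acy _ _ _ _]; exact: ac_lip_on_balls (smooth_lip_on_balls V_smooth)
  acy.
Qed.

Lemma solution_V_rate c y z : solution_upto c y z ->
  {ae (@lebesgue_measure R), forall t : R, 0 < t -> t < c ->
    exists2 w, has_deriv (V \o y) t w &
      w <= - rho (V (y t)) + chi m sigma C kappa Lambda D Th beta (expR (z t))}.
Proof.
move=> [acy acz y0E z0E H].
apply: ae_imply2 (ae_imply2 (fun _ => @conj _ _) b_ge
  (ae_imply2 (fun _ => @conj _ _) theta_le d_le)) H.
move=> t [bt [tht dt]] Ht t0 tc; have [yt _] := Ht t0 tc; have t0' := ltW t0.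
exists ((grad V (y t) *m (loop_field (b t) (theta t) (d t) (y t,
  z t)).1) ord0 ord0).
  exact: has_deriv_comp (smooth_has_frechet (y t) V_smooth) yt.
apply: (@le_trans _ _ (- Q (y t) / 2 + chi m sigma C kappa Lambda D Th beta
  (expR (z t)))).
  have rate := lyapunov_rate A (z t) (Q_ge0 (y t)) (fun i => s_ge0 i (y t))
    (hypA (y t)) (mu_gt0 _) Lambda_ge0 (hypB _) C_gt0 kappa_gt0 Ckappa beta_gt0
    (bt t0') (tht t0') (dt t0').
  exact: rate.
have := rhoQ (y t); lra.
Qed.

Let chi0 := chi m sigma C kappa Lambda D Th beta (expR z0).

Lemma chi0_ge0 : 0 <= chi0.
Proof. by apply: chi_ge0 => //; exact: expR_ge0. Qed.

Lemma solution_chi_le c y z t : solution_upto c y z -> 0 <= t -> t <= c ->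
  chi m sigma C kappa Lambda D Th beta (expR (z t)) <= chi0.
Proof.
move=> sol t0 tc; apply: chi_anti; rewrite ?expR_ge0//.
have [_ _ _ z0E _] := sol; rewrite ler_expR -z0E.
exact: (solution_z_mono sol).
Qed.

Lemma solution_V_estimate c y z : solution_upto c y z -> 0 <= c ->
  V (y c) <= decay_KL rho (V y0) c + gain_Koo rho chi0.
Proof.
move=> sol c0; have [_ _ y0E _ _] := sol; rewrite -y0E.
apply: (decay_estimate (v := V \o y) rhoK c0 chi0_ge0).
- by move=> t; exact: V_ge0.
- exact: solution_V_ac sol.
- apply: ae_imply (solution_V_rate sol) => t Ht t0 tc.
  have [w Vw wle] := Ht t0 tc; exists w => //.
  by have := solution_chi_le sol (ltW t0) (ltW tc); rewrite /=; lra.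
Qed.

Lemma rho_eps_gt0 : 0 < rho eps.
Proof. by have [r0 rlt _ _] := rhoK; rewrite -[X in X < _]r0 rlt. Qed.

Let Nu := chi_num m sigma C kappa Lambda D Th beta.

Let Nu_ge0 : 0 <= Nu. Proof. exact: chi_num_ge0. Qed.

Lemma chi0_le : chi0 <= Nu / (4 * C * kappa).
Proof.
have e0 := expR_gt0 z0.
apply: (@le_trans _ _ (Nu / (4 * C * (kappa + expR z0)))).
  by apply: chi_le => //; exact: ltW.
rewrite ler_wpM2l// lef_pV2 ?posrE ?mulr_gt0 ?addr_gt0//.
by rewrite ler_pM2l ?mulr_gt0// lerDl ltW.
Qed.

(** The majorant of [chi0] removes [z0] and leaves an expression whose continuity in the data is
    easy to establish. *)
Let V_bound := V y0 + gain_Koo rho (Nu / (4 * C * kappa)).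

Lemma solution_V_bound c y z : solution_upto c y z -> 0 <= c ->
  V (y c) <= V_bound.
Proof.
move=> sol c0; apply: (le_trans (solution_V_estimate sol c0)).
apply: lerD; first exact: (decay_KL_le rhoK).
by apply: (Kinv_le rhoK); rewrite ler_pM2l// chi0_le.
Qed.

Lemma V_bound_ge0 : 0 <= V_bound.
Proof. by rewrite addr_ge0//; exact: (Kinv_ge0 rhoK). Qed.

Lemma solution_exp_z c y z : solution_upto c y z ->
  abs_continuous 0 c (expR \o z) /\
  {ae (@lebesgue_measure R), forall t : R, 0 < t -> t < c ->
    has_deriv (expR \o z) t (Gamma * pos_part (V (y t) - eps))}.
Proof.
move=> [acy acz y0E z0E H]; split; first exact: ac_lip_on_balls
  lip_on_balls_expR acz.
apply: ae_imply H => t Ht t0 tc; have [_ zt] := Ht t0 tc.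
have /is_deriveP ez : is_derive (z t) 1 expR (expR (z t)) by exact:
  is_derive_expR.
have := has_deriv_comp (has_frechet_real ez) zt.
have -> : expR (z t) * (loop_field (b t) (theta t) (d t) (y t, z t)).2 =
    Gamma * pos_part (V (y t) - eps).
  by rewrite /loop_field/= /zdot expRN; field; rewrite gt_eqF ?expR_gt0.
by apply.
Qed.

Lemma solution_exp_z_bound c y z : solution_upto c y z -> 0 <= c ->
  expR (z c) <= expR z0 + Nu / (2 * C * rho eps) + Gamma / rho eps * V_bound ^+
    2.
Proof.
move=> sol c0; have [acE HE] := solution_exp_z sol.
have re := rho_eps_gt0; have re2 : 0 < rho eps / 2 by rewrite divr_gt0.
(* From exp z = [Es] on, Nu / (4 C (kappa + exp z)) <= rho eps / 2; hence the decay rate eta = rho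
   eps / 2 and the weight G / (2 eta) = Gamma / rho eps. *)
set Es := Nu / _; have Es0 : 0 <= Es by rewrite divr_ge0// mulr_ge0 ?mulr_ge0//
  ltW.
have [_ _ _ z0E _] := sol.
have := @adaptation_bound R (expR \o z) (V \o y) c Gamma eps (rho eps / 2) Es
  V_bound
  c0 (ltW Gamma_gt0) re2 _ (ltW eps_gt0) acE (solution_V_ac sol).
have -> : 2 * (rho eps / 2) = rho eps by field.
move=> AB; apply: (le_trans (AB _ _)).
- move=> t t0 tc; rewrite V_ge0/=.
  by apply: (@solution_V_bound t y z _ t0); exact: solution_upto_le sol.
- apply: ae_imply2 HE (solution_V_rate sol) => t HEt HVt t0 tc.
  have [w Vw wle] := HVt t0 tc; exists w; split => //; first exact: HEt.
  move=> /= Est eV; have rV : rho eps <= rho (V (y t)).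
    by apply: (Kinfty_le rhoK); exact: ltW.
  have : chi m sigma C kappa Lambda D Th beta (expR (z t)) <= rho eps / 2.
    have e0 := expR_gt0 (z t).
    apply: (@le_trans _ _ (Nu / (4 * C * (kappa + expR (z t))))).
      by apply: chi_le => //; exact: ltW.
    have P : 0 < 4 * C * (kappa + expR (z t)) by rewrite mulr_gt0 ?mulr_gt0
      ?addr_gt0.
    rewrite ler_pdivrMr//.
    have : Nu <= expR (z t) * (2 * C * rho eps).
      by rewrite -ler_pdivrMr// mulr_gt0// mulr_gt0.
    have : 0 <= C * rho eps * kappa by rewrite !mulr_ge0// ltW.
    lra.
  lra.
- rewrite lerD2r/= z0E ge_max lerDl Es0/= lerDr expR_ge0//.
Qed.

(** Both trajectories are bounded on [0, c] and the inputs by [N], so one joint Lipschitz constant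
    is valid along both. *)
Lemma solution_unique (N c : R) y1 z1 y2 z2 : 0 <= c ->
  {ae (@lebesgue_measure R), forall t : R, 0 <= t -> `|b t| <= N} ->
  {ae (@lebesgue_measure R), forall t : R, 0 <= t -> `|theta t| <= N} ->
  {ae (@lebesgue_measure R), forall t : R, 0 <= t -> `|d t| <= N} ->
  solution_upto c y1 z1 -> solution_upto c y2 z2 -> y1 c = y2 c /\ z1 c = z2 c.
Proof.
move=> c0 bN thN dN [acy1 acz1 y10 z10 H1] [acy2 acz2 y20 z20 H2].
have ac1 := ac_pair acy1 acz1; have ac2 := ac_pair acy2 acz2.
have [M1 M1P] := ac_bounded ac1; have [M2 M2P] := ac_bounded ac2.
have [L L0 LP] := lip_loop_field (Num.max (Num.max M1 M2) N).
have L1 : 0 < L + 1 by rewrite ltr_wpDl.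
suff [] : (y1 c, z1 c) = (y2 c, z2 c) by [].
apply: (caratheodory_unique (F := fun t => loop_field (b t) (theta t) (d t)) L1
  c0 ac1 ac2).
  by rewrite y10 z10 y20 z20.
have inN := ae_imply2 (fun _ => @conj _ _) bN (ae_imply2 (fun _ => @conj _ _)
  thN dN).
apply: ae_imply2 inN (ae_imply2 (fun _ => @conj _ _) H1 H2).
move=> t [bt [tht dt]] [Ht1 Ht2] t0 tc.
have [h1 h2] := Ht1 t0 tc; have [h3 h4] := Ht2 t0 tc; have t0' := ltW t0.
split.
- by rewrite [loop_field _ _ _ _]surjective_pairing; exact: has_deriv_pair.
- by rewrite [loop_field _ _ _ _]surjective_pairing; exact: has_deriv_pair.
have UM (U : 'cV[R]_n * R) : `|U| <= Num.max M1 M2 ->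
    `|(U, (b t, (theta t, d t)))| <= Num.max (Num.max M1 M2) N.
  move=> UM; rewrite prod_normE ge_max/= le_max UM/= prod_normE ge_max/=.
  by rewrite le_max bt// orbT/= prod_normE ge_max/= !le_max tht// dt// !orbT.
have := LP _ _ (UM (y1 t, z1 t) _) (UM (y2 t, z2 t) _).
have -> : `|((y1 t, z1 t), (b t, (theta t, d t))) - ((y2 t, z2 t), (b t,
  (theta t, d t)))|
    = `|(y1 t, z1 t) - (y2 t, z2 t)|.
  by rewrite prod_normE/= [in X in Num.max _ X]subrr normr0 (max_idPl _).
move=> /= LL; apply: le_trans (LL _ _) _.
- by rewrite le_max M1P// ltW.
- by rewrite le_max M2P ?orbT// ltW.
- by rewrite ler_wpM2r// lerDl.
Qed.

(** This becomes the function R of the theorem: the inputs enter only through [D], [Th] and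
    [beta]. *)
Definition z_bound : R :=
  ln (expR z0 + Nu / (2 * C * rho eps) + Gamma / rho eps * V_bound ^+ 2).

Lemma solution_z_bound c y z : solution_upto c y z -> 0 <= c -> z c <= z_bound.
Proof.
move=> sol c0; have le := solution_exp_z_bound sol c0.
rewrite -[z c]expRK ler_ln ?posrE ?expR_gt0//.
exact: lt_le_trans (expR_gt0 _) le.
Qed.

(* The truncation radius [M] exceeds the a priori bounds by [1], so the solution
   of the truncated system never leaves the ball where the truncation is inert.
     *)
Lemma global_solution (N : R) : 0 <= N -> radially_unbounded V ->
  (forall i, lebesgue_measurable_fun `[0, +oo[ (fun t => b t i ord0)) ->
  (forall i, lebesgue_measurable_fun `[0, +oo[ (fun t => theta t i ord0)) ->
  (forall i, lebesgue_measurable_fun `[0, +oo[ (fun t => d t i ord0)) ->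
  {ae (@lebesgue_measure R), forall t : R, 0 <= t -> `|b t| <= N} ->
  {ae (@lebesgue_measure R), forall t : R, 0 <= t -> `|theta t| <= N} ->
  {ae (@lebesgue_measure R), forall t : R, 0 <= t -> `|d t| <= N} ->
  exists (y : R -> 'cV[R]_n) (z : R -> R),
    [/\ forall c, abs_continuous 0 c y, forall c, abs_continuous 0 c z,
        y 0 = y0, z 0 = z0 &
    {ae (@lebesgue_measure R), forall t : R, 0 <= t ->
      has_deriv y t (loop_field (b t) (theta t) (d t) (y t, z t)).1 /\
      has_deriv z t (loop_field (b t) (theta t) (d t) (y t, z t)).2}].
Proof.
move=> N0 Vunb mb mth md bN thN dN.
have [My [_ MyP]] := compact_bounded (Vunb (V_bound + 1) (ltr_wpDl V_bound_ge0
  ltr01)).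
pose M := `|My| + 1 + (`|z0| + `|z_bound|) + 1.
have M0 : 0 <= M by rewrite !addr_ge0.
have solM c y z : solution_upto c y z -> 0 <= c -> `|(y c, z c)| <= M - 1.
  move=> sol c0; rewrite prod_normE ge_max/=; apply/andP; split.
    apply: (@le_trans _ _ (`|My| + 1)).
      apply: (MyP (`|My| + 1)); first by rewrite ltr_pwDr// ler_norm.
      by rewrite /= (le_trans (solution_V_bound sol c0))// lerDl.
    by rewrite /M addrK lerDl addr_ge0.
  have h1 := solution_z_bound sol c0.
  have [_ _ _ z0E _] := sol.
  have := solution_z_mono sol (lexx 0) c0 (lexx c); rewrite z0E => h2.
  have := ler_norm z_bound; have := ler_norm (- z0); rewrite normrN.
  have := normr_ge0 My; have := normr_ge0 z0; have := normr_ge0 z_bound.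
  by rewrite /M ler_norml; lra.
have [X [K [X0 K0 XK XD]]] := truncated_solution y0 z0 M0 N0 mb mth md bN thN
  dN.
have acX c : abs_continuous 0 c X by apply: (ac_lipschitz K0) => u t _ _;
  exact: XK.
have acX1 c := ac_lip_on_balls (@lip_on_balls_fst R 'cV[R]_n R) (acX c).
have acX2 c := ac_lip_on_balls (@lip_on_balls_snd R 'cV[R]_n R) (acX c).
(* While it stays in the ball of radius M the path solves the original system, and the a priori
   bounds improve M to M - 1. *)
have XM c : 0 <= c -> (forall t, 0 <= t -> t <= c -> `|X t| <= M) -> `|X c| <=
  M - 1.
  move=> c0 XcM; rewrite [X c]surjective_pairing.
  apply: (solM c (fst \o X) (snd \o X)) => //; split => //;
    try by rewrite /= X0.
  apply: ae_imply XD => t XDt t0 tc; have := XDt (ltW t0).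
  rewrite clamp_id; last by apply: XcM; exact: ltW.
  move=> XDt'; rewrite [(_, _)](_ : _ = X t); last by rewrite /=
    -surjective_pairing.
  by split; [exact: has_deriv_fst XDt'|exact: has_deriv_snd XDt'].
have XleM t : 0 <= t -> `|X t| <= M.
  move=> t0; pose S c : Prop := forall t, 0 <= t -> t <= c -> `|X t| <= M.
  suff : S t by apply.
  have X0M : `|X 0| <= M.
    have : solution_upto 0 (fst \o X) (snd \o X).
      split => //; try by rewrite /= X0.
      by apply: nearW => r r0 /(lt_trans r0); rewrite ltxx.
    move=> /solM/(_ (lexx 0)) /=; rewrite -surjective_pairing => /le_trans;
      apply.
    by rewrite gerBl.
  apply: (straddle_induction t0).
    by move=> r r0 r0'; rewrite (_ : r = 0)//; apply/le_anti; rewrite r0 r0'.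
  move=> r r0 rt; have K1 : 0 < K + 1 by rewrite ltr_wpDl.
  (* During this time a K-Lipschitz path moves by at most 1, the margin between M - 1 and M. *)
  exists (K + 1)^-1; first by rewrite invr_gt0.
  move=> u v u0 ur rv vt uv Su w w0 wv.
  have [wu|/ltW uw] := leP w u; first exact: Su.
  have := XM u u0 Su; have := ler_normD (X w - X u) (X u); rewrite subrK.
  have : K * `|w - u| <= 1.
    apply: (@le_trans _ _ ((K + 1) * (v - u))).
      by rewrite ger0_norm ?subr_ge0//; apply: ler_pM;
        rewrite ?subr_ge0 ?lerD2r// lerDl.
    by move: uv; rewrite -[_^-1]div1r ltr_pdivlMr// mulrC => /ltW.
  have := XK w u; lra.
exists (fst \o X), (snd \o X); split => //; try by rewrite /= X0.
apply: ae_imply XD => t XDt t0; have := XDt t0; rewrite clamp_id ?XleM//.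
move=> XDt'; rewrite [(_, _)](_ : _ = X t); last by rewrite /=
  -surjective_pairing.
by split; [exact: has_deriv_fst XDt'|exact: has_deriv_snd XDt'].
Qed.

(* If [V] exceeded [eps + eta] at arbitrarily late times, then, since [V] grows
   at most at rate [chi0], [exp z] would increase each time by a fixed amount.
     *)
Lemma solution_V_eventually y z : (forall c, 0 <= c -> solution_upto c y z) ->
  forall eta, 0 < eta -> exists T, forall t, T <= t -> V (y t) <= eps + eta.
Proof.
move=> sol eta eta0.
have k0 : 0 < chi0 + 1 by rewrite ltr_wpDl// chi0_ge0.
(* A time in which [V], growing at rate below chi0 + 1, gains at most eta / 2. *)
pose tau := eta / 2 / (chi0 + 1).
have tau0 : 0 < tau by rewrite !divr_gt0.
pose E := [set expR (z t) | t in [set t | 0 <= t]].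
have supE : has_sup E.
  split; first by exists (expR (z 0)), 0 => //=.
  by exists (expR z_bound) => _ [t /= t0 <-]; rewrite ler_expR
    (solution_z_bound (sol t t0)).
have inc0 : 0 < Gamma * (eta / 2) * tau by rewrite mulr_gt0// mulr_gt0//
  divr_gt0.
(* After [T], exp z has less room below its supremum than one excursion of length tau would
   consume. *)
have [_ [T /= T0 <-] TE] := sup_adherent inc0 supE.
exists (T + tau) => t Tt.
have tt : 0 <= t - tau by lra.
have t0 : 0 <= t by lra.
rewrite leNgt; apply/negP => Vt.
have solt := sol t t0.
have Vs u : t - tau <= u -> u <= t -> eps + eta / 2 <= V (y u).
  move=> ut1 ut; have u0 : 0 <= u by lra.
  have : V (y t) - V (y u) <= (chi0 + 1) * (t - u).
    apply: (ac_le_slope (x := V \o y) ut (ac_subitv u0 (lexx t) (solution_V_ac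
      solt))).
    apply: ae_imply (solution_V_rate solt) => r Hr ur rt.
    have r0 : 0 < r by exact: le_lt_trans ur.
    have [w Vw wle] := Hr r0 rt; exists w => //; apply: (le_trans wle).
    have := solution_chi_le solt (ltW r0) (ltW rt).
    have := Kinfty_ge0 rhoK (V_ge0 (y r)); lra.
  have : (chi0 + 1) * (t - u) <= (chi0 + 1) * tau by rewrite ler_pM2l//; lra.
  have -> : (chi0 + 1) * tau = eta / 2 by rewrite /tau mulrC divfK// gt_eqF.
  lra.
have [acE HE] := solution_exp_z solt.
have : Gamma * (eta / 2) * (t - (t - tau)) <= expR (z t) - expR (z (t - tau)).
  apply: (ac_ge_slope (x := expR \o z) _ (ac_subitv tt (lexx t) acE));
    first by lra.
  apply: ae_imply HE => r Hr tr rt; have r0 : 0 < r by exact: le_lt_trans tr.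
  exists (Gamma * pos_part (V (y r) - eps)); first exact: Hr.
  have := Vs r (ltW tr) (ltW rt) => Vr.
  by rewrite ler_pM2l// pos_part_id; lra.
rewrite (_ : t - (t - tau) = tau); last by lra.
have : expR (z t) <= sup E by apply: sup_upper_bound => //; exists t.
have : expR (z T) <= expR (z (t - tau)).
  by rewrite ler_expR; apply: (solution_z_mono solt) => //; lra.
lra.
Qed.

Lemma solution_z_cvg y z : (forall c, 0 <= c -> solution_upto c y z) ->
  exists2 l, z t @[t --> +oo] --> l & l <= z_bound /\ forall t,
    0 <= t -> z t <= l.
Proof.
move=> sol; pose E := [set z t | t in [set t | 0 <= t]].
have supE : has_sup E.
  split; first by exists (z 0), 0 => //=.
  by exists z_bound => _ [t /= t0 <-]; exact: solution_z_bound (sol t t0) t0.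
have zE t : 0 <= t -> z t <= sup E by move=> t0; apply: sup_upper_bound => //;
  exists t.
exists (sup E); last first.
  split => //; apply: ge_sup; first exact: supE.1.
  by move=> _ [t /= t0 <-]; exact: solution_z_bound (sol t t0) t0.
apply/cvgrPdist_lt => e e0.
have [_ [T /= T0 <-] TE] := sup_adherent e0 supE.
exists T; split; first exact: num_real.
move=> t Tt; have t0 : 0 <= t by rewrite (le_trans T0)// ltW.
have := zE t t0; have := solution_z_mono (sol t t0) T0 (ltW Tt) (lexx t).
by move=> *; rewrite ger0_norm ?subr_ge0//; lra.
Qed.

Lemma solution_upto_of_closed_loop (T : \bar R) y1 z1 c :
  closed_loop_solution f g phi A V mu s delta eps Gamma C kappa
    d theta b y0 z0 T y1 z1 -> 0 <= c -> (c%:E < T)%E -> solution_upto c y1 z1.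
Proof.
move=> [y1E z1E [acy Hy] [acz Hz]] c0 cT.
split => //; [exact: acy|exact: acz|].
apply: ae_imply2 Hy Hz => t Ht1 Ht2 t0 tc.
have tT : (t%:E < T)%E by apply: lt_trans cT; rewrite lte_fin.
by split; apply/is_deriveP; [exact: Ht1 (ltW t0) tT|exact: Ht2 (ltW t0) tT].
Qed.

Lemma closed_loop_trajectory (N : R) : 0 <= N -> radially_unbounded V ->
  (forall i, lebesgue_measurable_fun `[0, +oo[ (fun t => b t i ord0)) ->
  (forall i, lebesgue_measurable_fun `[0, +oo[ (fun t => theta t i ord0)) ->
  (forall i, lebesgue_measurable_fun `[0, +oo[ (fun t => d t i ord0)) ->
  {ae (@lebesgue_measure R), forall t : R, 0 <= t -> `|b t| <= N} ->
  {ae (@lebesgue_measure R), forall t : R, 0 <= t -> `|theta t| <= N} ->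
  {ae (@lebesgue_measure R), forall t : R, 0 <= t -> `|d t| <= N} ->
  exists (y : R -> 'cV[R]_n) (z : R -> R),
    [/\ closed_loop_solution f g phi A V mu s delta eps Gamma C kappa
          d theta b y0 z0 +oo%E y z,
        forall (T : \bar R) (y1 : R -> 'cV[R]_n) (z1 : R -> R),
          (0 < T)%E ->
          closed_loop_solution f g phi A V mu s delta eps Gamma C kappa
            d theta b y0 z0 T y1 z1 ->
          forall t : R, 0 <= t -> (t%:E < T)%E -> y1 t = y t /\ z1 t = z t,
        (limf_esup (fun t : R => (V (y t))%:E) +oo%R <= eps%:E)%E,
        forall t : R, 0 <= t ->
          V (y t) <= decay_KL rho (V y0) t + gain_Koo rho chi0
      & cvg (z t @[t --> +oo]) /\
        forall t : R, 0 <= t ->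
          [/\ z0 <= z t, z t <= lim (z t @[t --> +oo])
            & lim (z t @[t --> +oo]) <= z_bound]].
Proof.
move=> N0 Vunb mb mth md bN thN dN.
have [y [z [acy acz y0E z0E H]]] := global_solution N0 Vunb mb mth md bN thN dN.
have sol c : 0 <= c -> solution_upto c y z.
  move=> c0; split => //; apply: ae_imply H => t Ht t0 _; exact: Ht (ltW t0).
exists y, z; split.
- split => //; split; [by move=> c _ _; exact: acy| |by move=> c _ _;
  exact: acz|].
    by apply: ae_imply H => t Ht t0 _; apply/is_deriveP; have [] := Ht t0.
  by apply: ae_imply H => t Ht t0 _; apply/is_deriveP; have [] := Ht t0.
- move=> T y1 z1 T0 sol1 t t0 tT.
  exact: (solution_unique t0 bN thN dN (solution_upto_of_closed_loop sol1 t0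
    tT) (sol t t0)).
- apply/lee_addgt0Pr => eta eta0.
  have [T TP] := solution_V_eventually sol eta0.
  (* The limit superior is an infimum over neighbourhoods of infinity, so one tail with V <= eps +
     eta suffices. *)
  rewrite limf_esupE; apply: (@le_trans _ _ (ereal_sup
      [set (V (y t))%:E | t in [set t | T <= t]])).
    apply: ereal_inf_lbound; exists [set t | T <= t] => //.
    by exists T; split => [|t /ltW //]; exact: num_real.
  apply: ge_ereal_sup => _ [t /= Tt <-].
  by rewrite -EFinD lee_fin TP.
- by move=> t t0; exact: solution_V_estimate (sol t t0) t0.
have [l zl [lb zle]] := solution_z_cvg sol.
have limE : lim (z t @[t --> +oo]) = l by apply: cvg_lim zl; exact: Rhausdorff.
split; first by apply/cvg_ex; exists l.
move=> t t0; rewrite limE; split => //; last exact: zle.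
by rewrite -z0E; exact: (solution_z_mono (sol t t0) (lexx 0) t0 (lexx t)).
Qed.

End trajectory.

End closed_loop.

(** * Essential bounds of the inputs and proof of the theorem *)

Lemma ae_half_line {R : realType} (P : R -> Prop) :
  (\forall t \ae (@half_line_measure R), P t) ->
  {ae (@lebesgue_measure R), forall t : R, 0 <= t -> P t}.
Proof.
(* A null set of the restricted measure may be large on negative times, hence the intersection. *)
move=> [A [mA A0 sA]]; exists (A `&` `[0, +oo[%classic); split.
- by apply: measurableI => //; exact: measurable_itv.
- exact: A0.
- move=> t /= /not_implyP[t0 nPt]; split; first exact: sA.
  by rewrite /= in_itv/= t0.
Qed.

(** Excludes the degenerate case where every property holds almost everywhere: norms get nonnegative
    essential suprema, and properties true almost everywhere have witnesses. *)
Lemma half_line_measure_gt0 {R : realType} :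
  (0 < @half_line_measure R setT)%E.
Proof.
rewrite /half_line_measure/= /mrestr setTI.
by rewrite (_ : lebesgue_measure _ = +oo%E)// [LHS](lebesgue_measure_itv `[0,
  +oo[)/= ltry.
Qed.

Lemma ess_sup_norm_ge0 {R : realType} {k : nat} (x : R -> 'cV[R]_k) :
  (0 <= ess_sup_norm x)%E.
Proof.
by apply: ess_sup_ger => [|t]; [exact: half_line_measure_gt0|rewrite lee_fin
  enorm_ge0].
Qed.

Lemma norm_infty_ge0 {R : realType} {k : nat} (x : R -> 'cV[R]_k) :
  0 <= norm_infty x.
Proof. by rewrite fine_ge0// ess_sup_norm_ge0. Qed.

Lemma ae_le_norm_infty {R : realType} {k : nat} (D : set 'cV[R]_k)
    (x : R -> 'cV[R]_k) : Linfty D x ->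
  {ae (@lebesgue_measure R), forall t : R, 0 <= t -> enorm (x t) <= norm_infty
    x}.
Proof.
move=> [_ _ xoo]; apply: ae_half_line.
have := @ess_sup_ge _ _ _ (@half_line_measure R) (fun t => (enorm (x t))%:E).
have ae_filter := ae_filter_ringOfSetsType (@half_line_measure R).
apply: filterS => t; rewrite -lee_fin /norm_infty fineK//.
by rewrite ge0_fin_numE// ess_sup_norm_ge0.
Qed.

Lemma norm_le_enorm {R : realType} {k : nat} (x : 'cV[R]_k) : `|x| <= enorm x.
Proof.
apply: norm_le_coord => [|i j]; first exact: enorm_ge0.
rewrite (ord1 j) -sqrtr_sqr ler_sqrt ?sumr_ge0// => [|l _]; last exact: sqr_ge0.
by rewrite (bigD1 i)//= lerDl sumr_ge0// => l _; exact: sqr_ge0.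
Qed.

Lemma min_ess_infP {R : realType} {m : nat} (D : set 'cV[R]_m)
    (b : R -> 'cV[R]_m) : (0 < m)%N -> Linfty D b ->
  (forall i, (0 < ess_inf_coord b i)%E) ->
  0 < min_ess_inf b /\
  {ae (@lebesgue_measure R), forall t : R, 0 <= t ->
     forall i, min_ess_inf b <= b t i ord0}.
Proof.
move=> m0 Lb b0.
have ae_filter := ae_filter_ringOfSetsType (@half_line_measure R).
pose mn := (\big[Order.min/+oo%E]_(i < m) ess_inf_coord b i)%E.
have mn0 : (0 < mn)%E by apply: lt_bigmin => // i _; exact: ltry.
have mnle i : (mn <= ess_inf_coord b i)%E by exact: bigmin_le_cond.
(* As m > 0 there is an index, and its essential infimum is at most some value of [b]; so the
   minimum is finite and [fine] loses nothing. *)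
have mnfin : mn \is a fin_num.
  rewrite ge0_fin_numE ?(ltW mn0)//.
  have ae_proper := ae_properfilter_algebraOfSetsType (@half_line_measure_gt0
    R).
  have H1 := ess_inf_le (@half_line_measure R) (fun t => (b t (Ordinal m0)
    ord0)%:E).
  have [t tP] := filter_ex H1.
  by rewrite (le_lt_trans (mnle (Ordinal m0)))// (le_lt_trans tP)// ltry.
split; first by rewrite -lte_fin fineK.
have : {ae (@lebesgue_measure R), forall t : R, forall i,
    0 <= t -> min_ess_inf b <= b t i ord0}.
  apply: ae_forall_ord => i; apply: ae_half_line.
  have := ess_inf_le (@half_line_measure R) (fun t => (b t i ord0)%:E).
  apply: filterS => t bt; rewrite -lee_fin /min_ess_inf fineK//.
  exact: le_trans (mnle i) bt.
by apply: ae_imply => t H t0 i; exact: H.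
Qed.

(** Positivity of the last coordinate serves the inverse in [chi_num], and exp z0 > 0 keeps the
    argument of the logarithm positive. *)
Lemma z_bound_continuous {R : realType} {n m : nat} (V : 'cV[R]_n -> R)
    (eps Gamma C kappa : R) (rho : R -> R) (sigma Lambda : R) :
  continuous V -> 0 < eps -> 0 < Gamma -> 0 < C -> 0 < kappa -> 0 <= Lambda ->
  Kinfty rho ->
  {within [set x : ('cV[R]_n * R) * (R * R) * R |
             [/\ 0 <= x.1.2.1, 0 <= x.1.2.2 & 0 < x.2]],
    continuous (fun x => @z_bound R n m V eps Gamma C kappa rho sigma Lambda
                  x.1.1.1 x.1.1.2 x.1.2.1 x.1.2.2 x.2)}.
Proof.
move=> cV eps0 G0 C0 k0 L0 rhoK.
set S := (('cV[R]_n * R) * (R * R) * R)%type.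
have re : 0 < rho eps by have [r0 rlt _ _] := rhoK; rewrite -[X in X < _]r0 rlt.
have l1 := @lip_on_balls_fst R (('cV[R]_n * R) * (R * R))%type R.
have l11 := lip_on_balls_comp l1 (@lip_on_balls_fst R ('cV[R]_n * R)%type (R *
  R)%type).
have l12 := lip_on_balls_comp l1 (@lip_on_balls_snd R ('cV[R]_n * R)%type (R *
  R)%type).
have c2 := lip_on_balls_continuous (@lip_on_balls_snd R (('cV[R]_n * R) * (R *
  R))%type R).
have c111 := lip_on_balls_continuous (lip_on_balls_comp l11 (@lip_on_balls_fst
  R 'cV[R]_n R)).
have c112 := lip_on_balls_continuous (lip_on_balls_comp l11 (@lip_on_balls_snd
  R 'cV[R]_n R)).
have c121 := lip_on_balls_continuous (lip_on_balls_comp l12 (@lip_on_balls_fst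
  R R R)).
have c122 := lip_on_balls_continuous (lip_on_balls_comp l12 (@lip_on_balls_snd
  R R R)).
apply: continuous_in_subspaceT => x; rewrite inE => -[x1 x2 x3].
pose Nu (u : S) := chi_num m sigma C kappa Lambda u.1.2.1 u.1.2.2 u.2.
have cNu : {for x, continuous Nu}.
  rewrite /Nu /chi_num /prop_for /continuous_at.
  apply: cvgD; last first.
    by apply: cvgMr; apply: cvgV; [rewrite gt_eqF|exact: c2].
  apply: cvgD; last exact: cvg_cst.
  apply: cvgD.
    apply: cvgD; last exact: cvg_cst.
    by apply: cvgMr; apply: cvgM; exact: c121.
  by apply: cvgMr; apply: cvgM; exact: c122.
have cG : {for x, continuous (fun u : S => gain_Koo rho (Nu u / (4 * C *
  kappa)))}.
  apply: (@continuous_comp S R R (fun u => Nu u / (4 * C * kappa)) (gain_Koo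
    rho) x).
    by apply: cvgMl; exact: cNu.
  exact: gain_Koo_continuous.
have cB : {for x, continuous (fun u : S => V u.1.1.1 + gain_Koo rho (Nu u / (4
  * C * kappa)))}.
  apply: cvgD; last exact: cG.
  by apply: (@continuous_comp S _ R (fun u : S => u.1.1.1) V x);
    [exact: c111|exact: cV].
apply: (@continuous_comp S R R (fun u => expR u.1.1.2 + Nu u / (2 * C * rho
  eps) +
    Gamma / rho eps * (V u.1.1.1 + gain_Koo rho (Nu u / (4 * C * kappa))) ^+ 2)
      (@ln R) x).
  apply: cvgD.
    apply: cvgD; last by apply: cvgMl; exact: cNu.
    by apply: (@continuous_comp S R R (fun u : S => u.1.1.2) expR x);
      [exact: c112|exact: continuous_expR].
  by apply: cvgMr; apply: cvgM; exact: cB.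
apply: continuous_ln.
have h1 : 0 < expR x.1.1.2 := expR_gt0 _.
have h2 : 0 <= Nu x / (2 * C * rho eps).
  apply: divr_ge0; first exact: chi_num_ge0.
  by rewrite mulr_ge0 ?(ltW re)// mulr_ge0// ltW.
have h3 : 0 <= Gamma / rho eps *
    (V x.1.1.1 + gain_Koo rho (Nu x / (4 * C * kappa))) ^+ 2.
  by apply: mulr_ge0; [apply: divr_ge0; exact: ltW|exact: sqr_ge0].
exact: ltr_wpDr h3 (ltr_wpDr h2 h1).
Qed.

Theorem theorem1 (R : realType) (n m p q : nat)
    (n_gt0 : (0 < n)%N) (m_gt0 : (0 < m)%N) (p_gt0 : (0 < p)%N)
    (q_gt0 : (0 < q)%N)
    (f : 'cV[R]_n -> 'cV[R]_n) (g : 'I_m -> 'cV[R]_n -> 'cV[R]_n)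
    (phi : 'I_m -> 'cV[R]_n -> 'cV[R]_p) (A : 'I_m -> 'cV[R]_n -> 'cV[R]_q)
    (f_smooth : smooth f) (g_smooth : forall i, smooth (g i))
    (phi_smooth : forall i, smooth (phi i)) (A_smooth : forall i, smooth (A i))
    (f0 : f 0 = 0) (phi0 : forall i, phi i 0 = 0)
    (* assumption (A) *)
    (sigma : R) (V Q : 'cV[R]_n -> R) (s delta : 'I_m -> 'cV[R]_n -> R)
    (V_smooth : smooth V) (Q_smooth : smooth Q)
    (s_smooth : forall i, smooth (s i))
    (delta_smooth : forall i, smooth (delta i))
    (V_ge0 : forall y, 0 <= V y) (Q_ge0 : forall y, 0 <= Q y)
    (s_ge0 : forall i y, 0 <= s i y)
    (V_posdef : posdef V) (Q_posdef : posdef Q)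
    (V_unbounded : radially_unbounded V) (Q_unbounded : radially_unbounded Q)
    (hypA : forall y,
      lie V f y <= - Q y + sigma * (\sum_(i < m) delta i y * lie V (g i) y)
                   + \sum_(i < m) s i y * lie V (g i) y ^+ 2)
    (* assumption (B) *)
    (mu : 'cV[R]_n -> R) (Lambda : R)
    (mu_smooth : smooth mu) (mu_gt0 : forall y, 0 < mu y)
    (Lambda_ge0 : 0 <= Lambda)
    (hypB : forall y,
      \sum_(i < m) enorm (phi i y) ^+ 2 <= mu y * (Q y + Lambda))
    (eps Gamma C kappa : R)
    (eps_gt0 : 0 < eps) (Gamma_gt0 : 0 < Gamma) (C_gt0 : 0 < C)
    (kappa_gt0 : 0 < kappa) (Ckappa : 1 <= 2 * C * kappa) :
  exists (omega : R -> R -> R) (zeta : R -> R)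
         (Rho : ('cV[R]_n * R) * (R * R) * R -> R),
    [/\ classKL omega, classKoo zeta,
        {within [set x : ('cV[R]_n * R) * (R * R) * R |
                  [/\ 0 <= x.1.2.1, 0 <= x.1.2.2 & 0 < x.2]],
           continuous Rho}
      & forall (y0 : 'cV[R]_n) (z0 : R) (d : R -> 'cV[R]_q)
               (theta : R -> 'cV[R]_p) (b : R -> 'cV[R]_m),
          Linfty setT d -> Linfty setT theta ->
          Linfty [set x : 'cV[R]_m | forall i, 0 < x i ord0] b ->
          (forall i, (0 < ess_inf_coord b i)%E) ->
          exists (y : R -> 'cV[R]_n) (z : R -> R),
            [/\ (* the unique solution, defined on [0, +oo[ *)
                closed_loop_solution f g phi A V mu s delta eps Gamma C kappa
                  d theta b y0 z0 +oo%E y z,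
                forall (T : \bar R) (y1 : R -> 'cV[R]_n) (z1 : R -> R),
                  (0 < T)%E ->
                  closed_loop_solution f g phi A V mu s delta eps Gamma C kappa
                    d theta b y0 z0 T y1 z1 ->
                  forall t : R, 0 <= t -> (t%:E < T)%E ->
                    y1 t = y t /\ z1 t = z t,
                (limf_esup (fun t : R => (V (y t))%:E) +oo%R <= eps%:E)%E,
                forall t : R, 0 <= t ->
                  V (y t) <= omega (V y0) t
                    + zeta (chi m sigma C kappa Lambda
                              (norm_infty d) (norm_infty theta)
                              (min_ess_inf b) (expR z0))
              & cvg (z t @[t --> +oo]) /\
                forall t : R, 0 <= t ->
                  [/\ z0 <= z t,
                      z t <= lim (z t @[t --> +oo])
                    & lim (z t @[t --> +oo])
                        <= Rho (y0, z0, (norm_infty d, norm_infty theta),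
                                min_ess_inf b)]]].

Proof.
(* [rho] is built from V and Q before any initial state or input appears, so the three functions
   below are uniform in them. *)
have [rho rhoK rhoQ] := exists_gain Q_ge0 Q_posdef Q_unbounded V_posdef.1
  (V_smooth [::]).1 (Q_smooth [::]).1.
exists (decay_KL rho), (gain_Koo rho),
  (fun x => @z_bound R n m V eps Gamma C kappa rho sigma Lambda
     x.1.1.1 x.1.1.2 x.1.2.1 x.1.2.2 x.2); split.
- exact: classKL_decay.
- exact: classKoo_gain.
- exact: z_bound_continuous (V_smooth [::]).1 _ _ _ _ _ _.
move=> y0 z0 d theta b Ld Lth Lb b_gt0.
have [beta_gt0 b_ge] := min_ess_infP m_gt0 Lb b_gt0.
have d_le := ae_le_norm_infty Ld; have th_le := ae_le_norm_infty Lth.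
have b_le := ae_le_norm_infty Lb.
(* The size of [b] enters only through [N], which feeds existence and uniqueness but none of the
   estimates. *)
pose N := norm_infty b + norm_infty theta + norm_infty d.
have N0 : 0 <= N by rewrite !addr_ge0// norm_infty_ge0.
have bN : {ae (@lebesgue_measure R), forall t : R, 0 <= t -> `|b t| <= N}.
  apply: ae_imply b_le => t H t0; apply: le_trans (norm_le_enorm _) _.
  by rewrite (le_trans (H t0))// /N -addrA lerDl addr_ge0// norm_infty_ge0.
have thN : {ae (@lebesgue_measure R), forall t : R, 0 <= t -> `|theta t| <= N}.
  apply: ae_imply th_le => t H t0; apply: le_trans (norm_le_enorm _) _.
  by rewrite (le_trans (H t0))// /N addrAC lerDr addr_ge0// norm_infty_ge0.
have dN : {ae (@lebesgue_measure R), forall t : R, 0 <= t -> `|d t| <= N}.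
  apply: ae_imply d_le => t H t0; apply: le_trans (norm_le_enorm _) _.
  by rewrite (le_trans (H t0))// /N lerDr addr_ge0// norm_infty_ge0.
have [_ mb _] := Lb; have [_ mth _] := Lth; have [_ md _] := Ld.
exact: (closed_loop_trajectory f_smooth g_smooth phi_smooth A_smooth V_smooth
  s_smooth delta_smooth mu_smooth V_ge0 Q_ge0 s_ge0 hypA mu_gt0 Lambda_ge0 hypB
  eps_gt0 Gamma_gt0 C_gt0 kappa_gt0 Ckappa rhoK rhoQ y0 z0 beta_gt0
  (norm_infty_ge0 theta) b_ge th_le d_le N0 V_unbounded mb mth md bN thN dN).
Qed.
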